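(* Let $X$ be the Cantor set, let $T$ be a minimal homeomorphism of $X$, and let $[[T]]$ be the topological full group of $T$. Then the C*-algebra $C^*([[T]])$ is quasidiagonal. Moreover, if the commutator subgroup of $[[T]]$ is an infinite, simple, amenable and finitely generated group, then its C*-algebra is quasidiagonal as well.
   Context: The topological full group $[[T]]$ is the (countable discrete) group of all homeomorphisms of $X$ that are locally equal to an integer power of $T$. $T$ is minimal if every $T$-orbit is dense in $X$. A separable set $\Omega\subset B(H)$, $H$ a separable Hilbert space, is quasidiagonal if there is an increasing sequence of compact self-adjoint projections $P_n$ with $P_n\to1_H$ strongly and $\|P_nS-SP_n\|\to0$ for every $S\in\Omega$. A separable C*-algebra is quasidiagonal if it has a faithful representation on a separable Hilbert space whose image is a quasidiagonal set. $C^*(\cdot)$ is the full group C*-algebra. *)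

(* Defs.v *)
From HB Require Import structures.
From mathcomp Require Import all_boot all_order all_algebra.
From mathcomp Require Import sesquilinear complex.
From mathcomp Require Import all_classical all_reals all_analysis.

Set Implicit Arguments.
Unset Strict Implicit.
Unset Printing Implicit Defensive.

Import Order.TTheory GRing.Theory Num.Theory.
Import numFieldNormedType.Exports.

Local Open Scope classical_set_scope.
Local Open Scope ring_scope.

(** * Groups *)

(* Integer powers; monoid.v only has natural powers and their inverses. *)
Definition zexpg (G : groupType) (x : G) (n : int) : G :=
  match n with Posz k => (x ^+ k)%g | Negz k => (x ^- k.+1)%g end.

Section zexpg_theory.
Variables (G : groupType) (x : G).

Lemma zexpgS n : zexpg x (n + 1) = (zexpg x n * x)%g.
Proof.
case: n => [k|[|k]].
- by rewrite -(PoszD k 1) addn1 /= expgSr.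
- by rewrite /= mulVg.
- have -> : Negz k.+1 + 1 = Negz k by rewrite !NegzE -(addn1 k.+1) PoszD opprD addrNK.
  by rewrite /= [(x ^+ k.+2)%g]expgS invgM -mulgA mulVg mulg1.
Qed.

Lemma zexpgB1 n : zexpg x (n - 1) = (zexpg x n * x^-1)%g.
Proof. by rewrite -{2}(subrK 1 n) zexpgS mulgK. Qed.

Lemma zexpgD m n : zexpg x (m + n) = (zexpg x m * zexpg x n)%g.
Proof.
elim: n => [|n IHn|n IHn].
- by rewrite addr0 mulg1.
- by rewrite -addn1 PoszD addrA !zexpgS IHn mulgA.
- by rewrite -addn1 PoszD opprD addrA !zexpgB1 IHn mulgA.
Qed.

Lemma zexpgN n : zexpg x (- n) = ((zexpg x n)^-1)%g.
Proof. by apply: (mulIg (zexpg x n)); rewrite -zexpgD addNr mulVg. Qed.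

End zexpg_theory.

Definition infinite_group (G : groupType) := infinite_set [set: G].

Definition finitely_generated (G : groupType) :=
  exists s : seq G, forall K : groupClosed G,
    {subset s <= K} -> forall x, x \in K.

Definition simple_group (G : groupType) :=
  (exists x : G, x != 1%g) /\
  forall N : groupClosed G,
    (forall x g, x \in N -> (x ^ g)%g \in N) ->
    (forall x, x \in N -> x = 1%g) \/ (forall x, x \in N).

(* Amenability of a discrete group: a left-invariant finitely additive
   probability measure on all subsets. *)
Definition amenable (R : realType) (G : groupType) :=
  exists m : set G -> R,
    [/\ forall A, 0 <= m A,
        m setT = 1,
        forall A B, A `&` B = set0 -> m (A `|` B) = m A + m B
      & forall g A, m [set (g * x)%g | x in A] = m A].

Section commutator_subgroup.
Variable G : groupType.

Definition commutator_pred : pred G := fun x =>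
  `[< forall K : groupClosed G, (forall a b : G, [~ a, b]%g \in K) -> x \in K >].

Lemma commutator_group_closed : group_closed commutator_pred.
Proof.
split=> [|x y].
  by apply/asboolP => K _; exact: gpred1.
move=> /asboolP Kx /asboolP Ky; apply/asboolP => K KC.
by apply: gpredM; [exact: Kx|rewrite gpredV; exact: Ky].
Qed.

Definition commutator_subgroup := {x : G | commutator_pred x}.

HB.instance Definition _ := Choice.on commutator_subgroup.
HB.instance Definition _ := SubType.on commutator_subgroup.
HB.instance Definition _ := SubChoice_isSubGroup.Build G commutator_pred
  commutator_subgroup commutator_group_closed.

End commutator_subgroup.

(** * Homeomorphisms and topological full groups *)

Record homeo (X : topologicalType) := Homeo {
  homeo_fun :> X -> X;
  homeo_inv : X -> X;
  homeoK : cancel homeo_fun homeo_inv;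
  homeoVK : cancel homeo_inv homeo_fun;
  homeo_continuous : continuous homeo_fun;
  homeoV_continuous : continuous homeo_inv }.

Section homeo_group.
Variable X : topologicalType.

HB.instance Definition _ := gen_eqMixin (homeo X).
HB.instance Definition _ := gen_choiceMixin (homeo X).

Lemma homeo_ext (f g : homeo X) : f =1 g -> f = g.
Proof.
case: f g => [f fi fK fiK cf cfi] [g gi gK giK cg cgi] /= /funext fg.
subst g; have figi : fi = gi.
  by apply/funext => x; rewrite -{1}(giK x) fK.
subst gi; congr Homeo; exact: Prop_irrelevance.
Qed.

Let continuous_idfun : continuous (@idfun X).
Proof. by move=> x; exact: cvg_id. Qed.

Definition homeo1 : homeo X :=
  @Homeo X idfun idfun (fun=> erefl) (fun=> erefl)
    continuous_idfun continuous_idfun.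

Definition homeoV (f : homeo X) : homeo X :=
  Homeo (@homeoVK _ f) (@homeoK _ f)
    (@homeoV_continuous _ f) (@homeo_continuous _ f).

Definition homeoM (f g : homeo X) : homeo X :=
  @Homeo X (f \o g) (homeo_inv g \o homeo_inv f)
    (can_comp (@homeoK _ f) (@homeoK _ g))
    (can_comp (@homeoVK _ g) (@homeoVK _ f))
    (fun x => continuous_comp (@homeo_continuous _ g x) (@homeo_continuous _ f _))
    (fun x => continuous_comp (@homeoV_continuous _ f x)
      (@homeoV_continuous _ g _)).

Lemma homeoMA : associative homeoM.
Proof. by move=> f g h; exact: homeo_ext. Qed.
Lemma homeo1M : left_id homeo1 homeoM.
Proof. by move=> f; exact: homeo_ext. Qed.
Lemma homeoM1 : right_id homeo1 homeoM.
Proof. by move=> f; exact: homeo_ext. Qed.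
Lemma homeoVM : left_inverse homeo1 homeoV homeoM.
Proof. by move=> f; apply: homeo_ext => x /=; exact: homeoK. Qed.
Lemma homeoMV : right_inverse homeo1 homeoV homeoM.
Proof. by move=> f; apply: homeo_ext => x /=; exact: homeoVK. Qed.

HB.instance Definition _ := isGroup.Build (homeo X)
  homeoMA homeo1M homeoM1 homeoVM homeoMV.

End homeo_group.

Definition minimal_homeo (X : topologicalType) (T : homeo X) :=
  forall x : X, dense [set y | exists n : int, y = zexpg T n x].

Section topological_full_group.
Variables (X : topologicalType) (T : homeo X).

Definition full_group_pred : pred (homeo X) := fun S =>
  `[< forall x : X, exists n : int, \forall y \near x, S y = zexpg T n y >].

Lemma full_group_closed : group_closed full_group_pred.
Proof.
split=> [|S1 S2].
  by apply/asboolP => x; exists 0; near=> y.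
move=> /asboolP S1T /asboolP S2T; apply/asboolP => x.
pose z := homeo_inv S2 x.
have [n1 S1n] := S1T z; have [n2 S2n] := S2T z.
exists (n1 - n2).
have cS2 : {for x, continuous (homeo_inv S2)} by exact: homeoV_continuous.
near=> y.
have yE : y = S2 (homeo_inv S2 y) by rewrite homeoVK.
have S2y : S2 (homeo_inv S2 y) = zexpg T n2 (homeo_inv S2 y).
  by near: y; exact: cS2 S2n.
have S1y : S1 (homeo_inv S2 y) = zexpg T n1 (homeo_inv S2 y).
  by near: y; exact: cS2 S1n.
rewrite zexpgD zexpgN [LHS]S1y; congr (homeo_fun (zexpg T n1) _).
by rewrite [in RHS]yE S2y; symmetry; exact: homeoK.
Unshelve. all: by end_near. Qed.

Definition full_group := {S : homeo X | full_group_pred S}.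

HB.instance Definition _ := Choice.on full_group.
HB.instance Definition _ := SubType.on full_group.
HB.instance Definition _ := SubChoice_isSubGroup.Build (homeo X) full_group_pred
  full_group full_group_closed.

End topological_full_group.

(** * Hilbert spaces and bounded operators *)

HB.mixin Record isHilbert (R : realType) V of NormedModule R[i] V := {
  hdot : {dot V for (@Num.conj R[i])};
  hdot_norm : forall v : V, `|v| ^+ 2 = hdot v v }.

#[short(type="hilbertType")]
HB.structure Definition Hilbert (R : realType) :=
  {V of CompleteNormedModule R[i] V & isHilbert R V}.

Definition separable (X : topologicalType) :=
  exists D : set X, countable D /\ dense D.

Section operators.
Variables (R : realType) (H : hilbertType R).

Record bounded_op := BoundedOp {
  bounded_op_fun :> {linear H -> H};
  bounded_op_continuous : continuous bounded_op_fun }.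

(* Norms take their values in R[i]; [complex.Re] reads them back in R. *)
Definition opnorm (f : H -> H) : R :=
  sup [set complex.Re `|f v| | v in [set v | `|v| <= 1]].

Definition compact_op (f : H -> H) := precompact (f @` [set v | `|v| <= 1]).

Definition self_adjoint (f : H -> H) :=
  forall v w, hdot (f v) w = hdot v (f w).

Definition op_le (f g : H -> H) := forall v, hdot (f v) v <= hdot (g v) v.

Definition separable_op_set (Omega : set bounded_op) :=
  exists D : set bounded_op, [/\ countable D, D `<=` Omega &
    forall S, Omega S -> forall e : R, 0 < e ->
      exists2 S', D S' & opnorm (fun v => S v - S' v) < e].

Definition quasidiagonal_set (Omega : set bounded_op) :=
  [/\ separable H, separable_op_set Omega &
   exists P : nat -> bounded_op,
   [/\ forall n, [/\ compact_op (P n), self_adjoint (P n) & P n \o P n =1 P n],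
       forall n, op_le (P n) (P n.+1),
       forall v, P n v @[n --> \oo] --> v
     & forall S, Omega S ->
         opnorm (fun v => P n (S v) - S (P n v)) @[n --> \oo] --> (0 : R)]].

End operators.

(** * C*-algebras *)

(* The product is carried by this mixin, and not by the algebra structures of
   ssralg.v, because the latter have no join with [normedModType].  No unit is
   required. *)
HB.mixin Record isCStar (R : realType) A of NormedModule R[i] A := {
  cmul : {bilinear A -> A -> A};
  star : A -> A;
  cmulA : associative cmul;
  starK : involutive star;
  starD : {morph star : a b / a + b};
  starZ : forall (c : R[i]) a, star (c *: a) = Num.conj c *: star a;
  starM : forall a b, star (cmul a b) = cmul (star b) (star a);
  norm_cmul_le : forall a b, `|cmul a b| <= `|a| * `|b|;
  cstar_identity : forall a, `|cmul (star a) a| = `|a| ^+ 2 }.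

#[short(type="cstarAlgType")]
HB.structure Definition CStarAlgebra (R : realType) :=
  {A of CompleteNormedModule R[i] A & isCStar R A}.

Record cstar_rep (R : realType) (A : cstarAlgType R) (H : hilbertType R) :=
  CStarRep {
    rep_fun :> A -> bounded_op H;
    rep_linear : forall (c : R[i]) a b v,
      rep_fun (c *: a + b) v = c *: rep_fun a v + rep_fun b v;
    rep_mul : forall a b v, rep_fun (cmul a b) v = rep_fun a (rep_fun b v);
    rep_star : forall a v w,
      hdot (rep_fun (star a) v) w = hdot v (rep_fun a w) }.

Definition faithful (R : realType) (A : cstarAlgType R) (H : hilbertType R)
    (pi : cstar_rep A H) :=
  forall a, (forall v, pi a v = 0) -> a = 0.

Definition quasidiagonal (R : realType) (A : cstarAlgType R) :=
  separable A /\
  exists (H : hilbertType R) (pi : cstar_rep A H),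
    faithful pi /\ quasidiagonal_set (range pi).

(** * Full group C*-algebras *)

Record unitary_rep (R : realType) (G : groupType) (H : hilbertType R) :=
  UnitaryRep {
    urep_fun :> G -> {linear H -> H};
    urep1 : forall v, urep_fun 1%g v = v;
    urepM : forall g h v, urep_fun (g * h)%g v = urep_fun g (urep_fun h v);
    urep_dot : forall g v w, hdot (urep_fun g v) (urep_fun g w) = hdot v w }.

Section full_group_cstar.
Variables (R : realType) (G : groupType).

(* An element of the group algebra C[G] is presented by a formal sum
   s = [:: (c_1, g_1); ...; (c_k, g_k)]; this is its universal norm, the
   supremum of the operator norms of pi(s) over all unitary representations. *)
Definition universal_norm (s : seq (R[i] * G)) : R :=
  sup [set r | exists (H : hilbertType R) (pi : unitary_rep G H),
         r = opnorm (fun v => \sum_(p <- s) p.1 *: pi p.2 v)].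

(* [u] exhibits [A] as C*(G), that is as the completion of the *-algebra C[G]
   in the universal norm: the *-homomorphism C[G] -> A extending [u] is
   isometric for that norm and has dense range.  This determines [A] up to a
   unique isometric *-isomorphism compatible with [u]. *)
Definition full_group_cstar (A : cstarAlgType R) (u : G -> A) :=
  [/\ forall g h, u (g * h)%g = cmul (u g) (u h),
      forall g, u (g^-1)%g = star (u g),
      forall s : seq (R[i] * G),
        `|\sum_(p <- s) p.1 *: u p.2| = (universal_norm s)%:C%C
    & dense (range (fun s : seq (R[i] * G) => \sum_(p <- s) p.1 *: u p.2))].

End full_group_cstar.

(* Main.v *)
Require Import Defs.
From HB Require Import structures.
From mathcomp Require Import all_boot all_order all_algebra finmap.
From mathcomp Require Import complex ring lra zify.
From mathcomp Require Import all_classical all_reals all_analysis.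

Set Implicit Arguments.
Unset Strict Implicit.
Unset Printing Implicit Defensive.

Import Order.TTheory GRing.Theory Num.Theory.
Import numFieldNormedType.Exports.

Local Open Scope classical_set_scope.
Local Open Scope ring_scope.

(* Fix the orbit [T^j x0], j in Z. A group [G] of homeomorphisms locally equal to powers of [T] acts
   on it, hence on Z, by permutations moving each point by a bounded amount; by minimality every
   finite pattern of displacements recurs with bounded gaps. Let [pi] be the permutation
   representation on l2 of the finite sequences of integers, the sum of all tensor powers of l2(Z).

   [pi] is quasidiagonal by Berg's technique: if the same pattern is seen near [a] and near [a + m],
   rotating [e_x] slowly into [e_(x+m)] while [x] crosses a long ramp at [a] gives a finite-rank
   projection on l2(Z) almost commuting with given elements of [G]; its tensor powers do the same
   for [pi].

   [pi] is faithful on the full group C*-algebra. If [G] has almost invariant vectors in l2(G), every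
   representation [sigma] is weakly contained in the regular one by Fell absorption, and the regular
   one in [pi] because sequences of integers separate finite subsets of [G]. The almost invariant
   vectors come, after Juschenko and Monod, from the vector [xi M = prod_(j in M delta N) t_j] on
   the sets [M] at finite distance from the half-line [N], with a wide tent [t]; it lifts to [G]
   because only finitely many elements of controlled shape realise a given displacement of [M]. *)

(** Everything about the group enters through its action [s] on Z: faithfulness, bounded
    displacements and the recurrence [s_rec]. These pass to subgroups, so one argument serves both
    groups. A single l2(Z) is not faithful on the group algebra: if [g] and [h] have disjoint
    supports, [(1 - g) (1 - h)] acts on it by zero. A long enough sequence of integers, in contrast,
    has pairwise distinct images under any given finite set of elements. Tensor powers up to [n]
    cost a factor [n 3^n] in the row-sum estimates; this is harmless because [n] is fixed before the
    ramp length [L]. The projections must increase exactly, not approximately: each stage is the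
    identity on a core that contains the whole support of the previous one. Almost invariance is a
    one-dimensional effect: about [2 n] sites each lose a proportion of order [(C / n)^2], in total
    of order [C^2 / n]. Fell absorption is carried out by explicit finite sums of vectors of the
    given Hilbert space, with no tensor product of Hilbert spaces. *)

Section real_norm.
Variable R : realType.

(* The norm [`|v|] lives in [R[i]]; [rn v] is the same number in [R]. *)
Definition rn (V : normedZmodType R[i]) (v : V) : R := complex.Re `|v|.

Section normedZmod.
Variable V : normedZmodType R[i].
Implicit Types u v : V.

Lemma rnE v : `|v| = (rn v)%:C%C.
Proof.
have /complex.ger0_Im := normr_ge0 v.
by rewrite /rn; case: `|v| => a b /= ->.
Qed.

Lemma rn_ge0 v : 0 <= rn v.
Proof. by rewrite -ler0c -rnE. Qed.

Lemma rnD u v : rn (u + v) <= rn u + rn v.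
Proof. by rewrite -lecR rmorphD /= -!rnE ler_normD. Qed.

Lemma rnN v : rn (- v) = rn v.
Proof. by rewrite /rn normrN. Qed.

Lemma rnBC u v : rn (u - v) = rn (v - u).
Proof. by rewrite -rnN opprB. Qed.

Lemma rnB u v : rn (u - v) <= rn u + rn v.
Proof. by rewrite -(rnN v); exact: rnD. Qed.

Lemma rn0 : rn (0 : V) = 0.
Proof. by rewrite /rn normr0. Qed.

Lemma rn_eq0 v : (rn v == 0) = (v == 0).
Proof. by rewrite -(normr_eq0 v) rnE -(inj_eq (@complexI R)). Qed.

Lemma rn0_eq0 v : rn v = 0 -> v = 0.
Proof. by move/eqP; rewrite rn_eq0 => /eqP. Qed.

Lemma rn_gt0 v : (0 < rn v) = (v != 0).
Proof. by rewrite lt_def rn_ge0 andbT rn_eq0. Qed.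

Lemma rn_triangle w u v : rn (u - v) <= rn (u - w) + rn (w - v).
Proof. by apply: le_trans (rnD _ _); rewrite addrA subrK. Qed.

Lemma rn_sum I (r : seq I) (P : pred I) (F : I -> V) :
  rn (\sum_(i <- r | P i) F i) <= \sum_(i <- r | P i) rn (F i).
Proof.
elim/big_ind2 : _ => [|x a y b xa yb|//]; first by rewrite rn0.
by apply: le_trans (rnD _ _) _; exact: lerD.
Qed.

Lemma rn_dist u v : `|rn u - rn v| <= rn (u - v).
Proof.
rewrite ler_norml; apply/andP; split.
  have := rnD (v - u) u; rewrite subrK rnBC => h; lra.
have := rnD (u - v) v; rewrite subrK => h; lra.
Qed.

End normedZmod.

Lemma rn_small_eq0 (V : normedZmodType R[i]) (v : V) (C : R) :
  (forall e : R, 0 < e -> rn v <= C * e) -> v = 0.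
Proof.
move=> h; apply/rn0_eq0/eqP; rewrite eq_le rn_ge0 andbT.
apply/ler_addgt0Pr => e e0.
have C1 : 0 < `|C| + 1 by rewrite ltr_pwDr.
apply: le_trans (h (e / (`|C| + 1)) _) _; first exact: divr_gt0.
rewrite add0r mulrCA -[leRHS]mulr1 ler_pM2l// ler_pdivrMr// mul1r.
by apply: le_trans (ler_norm _) _; rewrite lerDl.
Qed.

Implicit Types z w : R[i].

Lemma rnM z w : rn (z * w) = rn z * rn w.
Proof. by apply: (@complexI R); rewrite -rnE normrM !rnE rmorphM. Qed.

Lemma rn_real (x : R) : rn (x%:C%C) = `|x|.
Proof.
rewrite /rn normc_def /= expr0n /= addr0 sqrtr_sqr //.
Qed.

Lemma rn1 : rn (1 : R[i]) = 1.
Proof. by rewrite /rn normr1. Qed.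

Lemma rn_sqr z : rn z ^+ 2 = complex.Re z ^+ 2 + complex.Im z ^+ 2.
Proof. by rewrite /rn normc_def /= sqr_sqrtr // addr_ge0 ?sqr_ge0. Qed.

Lemma rn_mulJ z : z * Num.conj z = (rn z ^+ 2)%:C%C.
Proof. by rewrite -normCK rnE rmorphXn. Qed.

Lemma cjM z w : Num.conj (z * w) = Num.conj z * Num.conj w.
Proof. exact: rmorphM. Qed.
Lemma cjD z w : Num.conj (z + w) = Num.conj z + Num.conj w.
Proof. exact: rmorphD. Qed.
Lemma cjB z w : Num.conj (z - w) = Num.conj z - Num.conj w.
Proof. exact: rmorphB. Qed.
Lemma cjK z : Num.conj (Num.conj z) = z.
Proof. exact: conjCK. Qed.
Lemma cj_real (x : R) : Num.conj (x%:C%C : R[i]) = x%:C%C.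
Proof. by rewrite /Num.conj /= oppr0. Qed.
Lemma cj_sum I (r : seq I) (P : pred I) (F : I -> R[i]) :
  Num.conj (\sum_(i <- r | P i) F i) = \sum_(i <- r | P i) Num.conj (F i).
Proof. exact: rmorph_sum. Qed.

Lemma rnJ z : rn (Num.conj z) = rn z.
Proof. by rewrite /rn norm_conjC. Qed.

Lemma Re_le_rn z : complex.Re z <= rn z.
Proof.
apply: le_trans (ler_norm _) _; rewrite -(@ler_pXn2r _ 2) ?nnegrE ?rn_ge0//.
by rewrite rn_sqr real_normK ?num_real// lerDl sqr_ge0.
Qed.

Lemma rn_le_ReIm z : rn z <= `|complex.Re z| + `|complex.Im z|.
Proof.
rewrite -(@ler_pXn2r _ 2) ?nnegrE ?rn_ge0 ?addr_ge0//.
rewrite rn_sqr sqrrD !real_normK ?num_real// addrAC lerDl mulrn_wge0 ?mulr_ge0//.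
Qed.

Lemma normRe_le_rn z : `|complex.Re z| <= rn z.
Proof.
rewrite -(@ler_pXn2r _ 2) ?nnegrE ?rn_ge0//.
by rewrite rn_sqr real_normK ?num_real// lerDl sqr_ge0.
Qed.

Lemma normIm_le_rn z : `|complex.Im z| <= rn z.
Proof.
rewrite -(@ler_pXn2r _ 2) ?nnegrE ?rn_ge0//.
by rewrite rn_sqr real_normK ?num_real// lerDr sqr_ge0.
Qed.

Lemma ReB z w : complex.Re (z - w) = complex.Re z - complex.Re w.
Proof. by case: z w => a b []. Qed.
Lemma ImB z w : complex.Im (z - w) = complex.Im z - complex.Im w.
Proof. by case: z w => a b []. Qed.

Lemma rnZ (V : normedModType R[i]) z (v : V) : rn (z *: v) = rn z * rn v.
Proof. by apply: (@complexI R); rewrite -rnE normrZ !rnE rmorphM. Qed.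

Section topology.
Variable V : normedModType R[i].
Implicit Types (v : V) (F : set_system V).

Lemma cvg_rnP (T : Type) (F : set_system T) (f : T -> V) v :
  Filter F ->
  (f @ F --> v) <-> (forall e : R, 0 < e -> \forall x \near F, rn (f x - v) < e).
Proof.
move=> FF; split.
  move=> /cvgr_distC_lt h e e0; have := h (e%:C)%C; rewrite ltcR => /(_ e0).
  by apply: filterS => x; rewrite rnE ltcR.
move=> h; apply/cvgrPdistC_lt => -[e e'] /=; rewrite ltcE /= => /andP[/eqP -> e0].
have := h e e0; apply: filterS => x; rewrite rnE => hx.
by rewrite ltcE /= eqxx.
Qed.

Lemma nbhs_rnP v (A : set V) :
  nbhs v A <-> exists2 e : R, 0 < e & forall u, rn (u - v) < e -> A u.
Proof.
split=> [/nbhs_normP [[e e']]|[e e0 h]].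
  rewrite /= ltcE /= => /andP[/eqP -> e0] h; exists e => // u uv; apply: h => /=.
  by rewrite distrC rnE ltcE /= eqxx.
apply/nbhs_normP; exists (e%:C)%C => /=; first by rewrite ltcR.
by move=> u /=; rewrite distrC rnE ltcR; exact: h.
Qed.

Lemma dense_rnP (D : set V) :
  dense D <-> (forall v (e : R), 0 < e -> exists2 d, D d & rn (v - d) < e).
Proof.
split=> [dD v e e0|h O [v Ov] oO].
  have := dD [set u | rn (u - v) < e]; case.
  - by exists v; rewrite /= subrr rn0.
  - rewrite openE => u /= uv; apply/nbhs_rnP.
    exists (e - rn (u - v)); first by rewrite subr_gt0.
    move=> w wu /=; apply: le_lt_trans (rn_triangle u _ _) _; lra.
  - by move=> d [/= dv Dd]; exists d => //; rewrite rnBC.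
have /nbhs_rnP[e e0 he] : nbhs v O by exact: open_nbhs_nbhs.
have [d Dd vd] := h v e e0; exists d; split => //.
by apply: he; rewrite rnBC.
Qed.

End topology.

Lemma cauchy_rn (V : completeNormedModType R[i]) (x : nat -> V) :
  (forall e : R, 0 < e -> exists N, forall m n, (N <= m)%N -> (N <= n)%N ->
    rn (x m - x n) < e) ->
  exists l, forall e : R, 0 < e -> exists N, forall n, (N <= n)%N -> rn (x n - l) < e.
Proof.
move=> xC.
have : cvg (x @ \oo).
  apply: cauchy_cvg; apply/cauchy_ballP => -[e e'].
  rewrite ltcE /= => /andP[/eqP -> e0].
  have [N xN] := xC e e0.
  exists (x @` [set n | (N <= n)%N], x @` [set n | (N <= n)%N]) => /=.
    by split; exists N => // n /= Nn; exists n.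
  move=> [a b] /= [[m Nm <-] [n Nn <-]].
  by rewrite -ball_normE /ball_ /= rnE ltcE /= eqxx /= xN.
move=> /cvg_ex [l /cvg_rnP xl]; exists l => e e0.
have [N _ hN] := xl e e0; exists N => n Nn; exact: hN.
Qed.

Lemma lipschitz_continuous (V W : normedModType R[i]) (f : {linear V -> W}) (C : R) :
  (forall v, rn (f v) <= C * rn v) -> continuous f.
Proof.
move=> fC v; apply/cvg_rnP => e e0.
have C1 : 0 < `|C| + 1 by rewrite ltr_pwDr.
apply/nbhs_rnP; exists (e / (`|C| + 1)); first exact: divr_gt0.
move=> u uv; rewrite -linearB.
apply: le_lt_trans (fC _) _; apply: le_lt_trans (_ : _ <= (`|C| + 1) * rn (u - v)) _.
  by rewrite ler_wpM2r ?rn_ge0//; apply: le_trans (ler_norm _) _; rewrite lerDl.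
by rewrite mulrC -ltr_pdivlMr.
Qed.

End real_norm.

(** * The Hilbert space l2(S) *)

Lemma big_uniq_sub (T : eqType) (U : Type) (idx : U) (op : Monoid.com_law idx)
    (s s' : seq T) (F : T -> U) :
  uniq s -> uniq s' -> {subset s <= s'} ->
  (forall x, x \in s' -> x \notin s -> F x = idx) ->
  \big[op/idx]_(x <- s') F x = \big[op/idx]_(x <- s) F x.
Proof.
move=> us us' ss' F0; rewrite (bigID (mem s)) /=.
rewrite [X in op _ X]big1_seq ?Monoid.mulm1; last first.
  by move=> x /andP[xs xs']; exact: F0.
rewrite -big_filter; apply: perm_big; apply: uniq_perm => //.
  exact: filter_uniq.
move=> x; rewrite mem_filter /=; case: (boolP (x \in s)) => //= /ss' ->.
by [].
Qed.

Lemma big_uniq_eq (T : eqType) (U : Type) (idx : U) (op : Monoid.com_law idx)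
    (s s' : seq T) (F : T -> U) :
  uniq s -> uniq s' ->
  (forall x, x \in s -> x \notin s' -> F x = idx) ->
  (forall x, x \in s' -> x \notin s -> F x = idx) ->
  \big[op/idx]_(x <- s) F x = \big[op/idx]_(x <- s') F x.
Proof.
move=> us us' h h'.
rewrite -(@big_uniq_sub T U idx op s (undup (s ++ s'))) ?undup_uniq//.
- apply: big_uniq_sub; rewrite ?undup_uniq// => x; rewrite mem_undup mem_cat.
    by move=> ->; rewrite orbT.
  by case/orP => [|->//] xs; exact: h.
- by move=> x; rewrite mem_undup mem_cat => ->.
- by move=> x; rewrite mem_undup mem_cat => /orP[->//|]; exact: h'.
Qed.

Lemma sum_uniq_le (R : realType) (T : eqType) (s s' : seq T) (F : T -> R) :
  (forall x, 0 <= F x) -> uniq s -> uniq s' -> {subset s <= s'} ->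
  \sum_(x <- s) F x <= \sum_(x <- s') F x.
Proof.
move=> F0 us us' ss'; rewrite [leRHS](bigID (mem s)) /=.
have -> : \sum_(x <- s) F x = \sum_(x <- s' | x \in s) F x.
  rewrite -[RHS]big_filter; apply: perm_big; apply: uniq_perm => //.
    exact: filter_uniq.
  by move=> x; rewrite mem_filter; case: (boolP (x \in s)) => //= /ss' ->.
by rewrite lerDl sumr_ge0.
Qed.

(** * Unconditional sums over a set *)

Section csum.
Variables (R : realType) (S : choiceType).
Implicit Types (f g : S -> R[i]) (phi : S -> R).

Definition bounded_sums phi (M : R) := forall s, uniq s -> \sum_(x <- s) phi x <= M.

Definition is_csum f (v : R[i]) := forall e : R, 0 < e ->
  exists s0 : seq S, forall s, uniq s -> {subset s0 <= s} ->
    rn (\sum_(x <- s) f x - v) < e.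

Lemma is_csum_uniq f v w : is_csum f v -> is_csum f w -> v = w.
Proof.
move=> fv fw; apply/eqP; rewrite -subr_eq0; apply/eqP.
apply: (@rn_small_eq0 _ _ _ 2) => e e0.
have [s hs] := fv e e0; have [t ht] := fw e e0.
have h1 := hs (undup (s ++ t)) (undup_uniq _).
have h2 := ht (undup (s ++ t)) (undup_uniq _).
apply: le_trans (rn_triangle (\sum_(x <- undup (s ++ t)) f x) _ _) _.
rewrite mulr2n mulrDl mul1r rnBC lerD// ltW//.
  by apply: h1 => x xs; rewrite mem_undup mem_cat xs.
by apply: h2 => x xs; rewrite mem_undup mem_cat xs orbT.
Qed.

Lemma is_csumD f g v w : is_csum f v -> is_csum g w -> is_csum (fun x => f x + g x) (v + w).
Proof.
move=> fv gw e e0; have e2 : 0 < e / 2 by rewrite divr_gt0.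
have [s hs] := fv _ e2; have [t ht] := gw _ e2.
exists (s ++ t) => r ur rst; rewrite big_split /= opprD addrACA.
apply: le_lt_trans (rnD _ _) _; rewrite [e]splitr ltrD//.
  by apply: hs => // x xs; apply: rst; rewrite mem_cat xs.
by apply: ht => // x xs; apply: rst; rewrite mem_cat xs orbT.
Qed.

Lemma is_csumZ (c : R[i]) f v : is_csum f v -> is_csum (fun x => c * f x) (c * v).
Proof.
move=> fv e e0; have c1 : 0 < rn c + 1 by rewrite ltr_pwDr// rn_ge0.
have [s hs] := fv _ (divr_gt0 e0 c1); exists s => r ur sr.
rewrite -mulr_sumr -mulrBr rnM; apply: le_lt_trans (_ : _ <= (rn c + 1) * rn (\sum_(x <- r) f x - v)) _.
  by rewrite ler_wpM2r ?rn_ge0 ?lerDl.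
by rewrite mulrC -ltr_pdivlMr//; exact: hs.
Qed.

Lemma is_csumJ f v : is_csum f v -> is_csum (fun x => Num.conj (f x)) (Num.conj v).
Proof.
move=> fv e e0; have [s hs] := fv _ e0; exists s => r ur sr.
by rewrite -rmorph_sum -rmorphB rnJ; exact: hs.
Qed.

Lemma is_csum_ge0 phi M : (forall x, 0 <= phi x) -> bounded_sums phi M ->
  is_csum (fun x => (phi x)%:C%C)
    (sup [set \sum_(x <- s) phi x | s in [set s : seq S | uniq s]])%:C%C.
Proof.
move=> phi0 phiM e e0; set A := [set _ | _ in _].
have hA : has_sup A.
  split; first by exists 0, [::] => //=; rewrite big_nil.
  by exists M => _ [s /= us <-]; exact: phiM.
have [_ [s0 us0 <-] hs0] := sup_adherent e0 hA.
exists s0 => s us s0s; rewrite -rmorph_sum -rmorphB rn_real /= ltr_norml.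
have := sum_uniq_le phi0 us0 us s0s.
have : \sum_(x <- s) phi x <= sup A by apply: sup_upper_bound => //; exists s.
by move=> h1 h2; apply/andP; split; lra.
Qed.

Lemma is_csum_ex f M : bounded_sums (fun x => rn (f x)) M -> exists v, is_csum f v.
Proof.
move=> fM.
(* Nonnegative families are summed by a supremum; [f] is [(p - |f|) + i (q - |f|)], where [p], [q]
   and [|f|] are nonnegative with bounded sums. *)
pose p x := rn (f x) + complex.Re (f x).
pose q x := rn (f x) + complex.Im (f x).
have Re_n (z : R[i]) : `|complex.Re z| <= rn z by exact: normRe_le_rn.
have Im_n (z : R[i]) : `|complex.Im z| <= rn z by exact: normIm_le_rn.
have p0 x : 0 <= p x by have := Re_n (f x); rewrite ler_norml /p => /andP[]; lra.
have q0 x : 0 <= q x by have := Im_n (f x); rewrite ler_norml /q => /andP[]; lra.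
have n0 (x : S) : 0 <= rn (f x) by exact: rn_ge0.
have bp : bounded_sums p (M + M).
  move=> s us; rewrite big_split /=; apply: lerD; first exact: fM.
  by apply: le_trans (fM s us); apply: ler_sum => x _; exact: Re_le_rn.
have bq : bounded_sums q (M + M).
  move=> s us; rewrite big_split /=; apply: lerD; first exact: fM.
  apply: le_trans (fM s us); apply: ler_sum => x _.
  by apply: le_trans (ler_norm _) _; exact: Im_n.
have hn := is_csum_ge0 n0 fM.
have hp := is_csum_ge0 p0 bp.
have hq := is_csum_ge0 q0 bq.
set vn := (X in is_csum _ X) in hn.
set vp := (X in is_csum _ X) in hp.
set vq := (X in is_csum _ X) in hq.
exists ((vp + (-1) * vn) + 'i%C * (vq + (-1) * vn)).
have := is_csumD (is_csumD hp (is_csumZ (-1) hn))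
  (is_csumZ 'i%C (is_csumD hq (is_csumZ (-1) hn))).
congr (is_csum _ _); apply/funext => x.
rewrite !mulN1r -!rmorphB /= /p /q addrAC subrr add0r addrAC subrr add0r.
by rewrite -complexE.
Qed.

Definition csum f : R[i] := xget 0 (is_csum f).

Lemma csumP f M : bounded_sums (fun x => rn (f x)) M -> is_csum f (csum f).
Proof. by move=> /is_csum_ex[v fv]; rewrite /csum; apply: xgetPex; exists v. Qed.

Lemma csumE f v : is_csum f v -> csum f = v.
Proof.
move=> fv; apply: (@is_csum_uniq f) => //.
by rewrite /csum; apply: xgetPex; exists v.
Qed.

Lemma is_csum_fin f (s : seq S) : uniq s -> (forall x, x \notin s -> f x = 0) ->
  is_csum f (\sum_(x <- s) f x).
Proof.
move=> us f0 e e0; exists s => r ur sr.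
rewrite (@big_uniq_sub _ _ _ _ s r) ?subrr ?rn0//.
by move=> x _; exact: f0.
Qed.

End csum.

(** * Cauchy-Schwarz and Minkowski inequalities for finite sums *)

Section minkowski.
Variables (R : realType) (T : eqType).

Lemma prod_sum_le (s : seq T) (p q : T -> R) (A B : R) :
  (forall x, 0 <= p x) -> (forall x, 0 <= q x) -> 0 <= A -> 0 <= B ->
  \sum_(x <- s) p x ^+ 2 <= A ^+ 2 -> \sum_(x <- s) q x ^+ 2 <= B ^+ 2 ->
  \sum_(x <- s) p x * q x <= A * B.
Proof.
move=> p0 q0 A0 B0 hA hB.
apply/ler_addgt0Pr => e e0.
(* Sum [2 C D p q <= D^2 p^2 + C^2 q^2] and divide by [2 C D]. This needs positive bounds, while [A]
   or [B] may vanish; hence the slack [d] below. *)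
have key C D : 0 < C -> 0 < D -> A <= C -> B <= D -> \sum_(x <- s) p x * q x <= C * D.
  move=> C0 D0 AC BD.
  rewrite -(@ler_pM2l _ (2 * (C * D))) ?mulr_gt0//.
  have : \sum_(x <- s) (D ^+ 2 * p x ^+ 2 + C ^+ 2 * q x ^+ 2) <= 2 * (C * D) * (C * D).
    rewrite big_split /= -!mulr_sumr.
    have h1 : D ^+ 2 * \sum_(x <- s) p x ^+ 2 <= D ^+ 2 * C ^+ 2.
      by rewrite ler_wpM2l ?sqr_ge0//; apply: le_trans hA _; rewrite ler_pXn2r ?nnegrE// ltW.
    have h2 : C ^+ 2 * \sum_(x <- s) q x ^+ 2 <= C ^+ 2 * D ^+ 2.
      by rewrite ler_wpM2l ?sqr_ge0//; apply: le_trans hB _; rewrite ler_pXn2r ?nnegrE// ltW.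
    nra.
  apply: le_trans; rewrite mulr_sumr; apply: ler_sum => x _.
  by have := sqr_ge0 (D * p x - C * q x); nra.
pose d := Num.min 1 (e / (A + B + 1)).
have AB : 0 < A + B + 1 by rewrite ltr_pwDr// addr_ge0.
have d0 : 0 < d by rewrite lt_min ltr01 divr_gt0.
apply: le_trans (key (A + d) (B + d) _ _ _ _) _.
- by rewrite ltr_wpDl.
- by rewrite ltr_wpDl.
- by rewrite lerDl ltW.
- by rewrite lerDl ltW.
have d1 : d <= 1 by rewrite ge_min lexx.
have : d * (A + B + 1) <= e by rewrite -ler_pdivlMr// ge_min lexx orbT.
nra.
Qed.

Lemma minkowski_seq (s : seq T) (p q r : T -> R) (A B : R) :
  (forall x, 0 <= p x) -> (forall x, 0 <= q x) -> (forall x, 0 <= r x <= p x + q x) ->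
  0 <= A -> 0 <= B ->
  \sum_(x <- s) p x ^+ 2 <= A ^+ 2 -> \sum_(x <- s) q x ^+ 2 <= B ^+ 2 ->
  \sum_(x <- s) r x ^+ 2 <= (A + B) ^+ 2.
Proof.
move=> p0 q0 r0 A0 B0 hA hB; have := prod_sum_le p0 q0 A0 B0 hA hB => h.
apply: (@le_trans _ _ (\sum_(x <- s) (p x ^+ 2 + q x ^+ 2 + 2 * (p x * q x)))).
  by apply: ler_sum => x _; have /andP[] := r0 x; have := p0 x; have := q0 x; nra.
rewrite !big_split /= -mulr_sumr; nra.
Qed.

End minkowski.

Section l2_def.
Variables (R : realType) (S : choiceType).

Definition sqn (f : S -> R[i]) (x : S) : R := rn (f x) ^+ 2.

Lemma sqn_ge0 f x : 0 <= sqn f x.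
Proof. exact: sqr_ge0. Qed.

Definition l2_pred : pred (S -> R[i]) := fun f =>
  `[< exists2 A : R, 0 <= A & bounded_sums (sqn f) (A ^+ 2) >].

Lemma l2_closed : submod_closed l2_pred.
Proof.
split.
  apply/asboolP; exists 0 => // s us; rewrite big1 ?expr0n//= => x _.
  by rewrite /sqn rn0 expr0n.
move=> c f g /asboolP[A A0 hA] /asboolP[B B0 hB]; apply/asboolP.
exists (rn c * A + B); first by rewrite addr_ge0 ?mulr_ge0 ?rn_ge0.
move=> s us; rewrite /sqn.
apply: (@minkowski_seq _ _ _ (fun x => rn c * rn (f x)) (fun x => rn (g x))) => //.
- by move=> x; rewrite mulr_ge0 ?rn_ge0.
- by move=> x; rewrite rn_ge0.
- move=> x; rewrite rn_ge0 /= -rnM.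
  by apply: le_trans (rnD _ _) _; rewrite lexx.
- by rewrite mulr_ge0 ?rn_ge0.
- under eq_bigr do rewrite exprMn.
  by rewrite -mulr_sumr exprMn ler_wpM2l ?sqr_ge0// hA.
- exact: hB.
Qed.

HB.instance Definition _ := GRing.isSubmodClosed.Build R[i] (S -> R[i]) l2_pred
  l2_closed.

Definition l2 := {f : S -> R[i] | l2_pred f}.

HB.instance Definition _ := Choice.on l2.
HB.instance Definition _ := SubType.on l2.
HB.instance Definition _ :=
  GRing.SubChoice_isSubLmodule.Build R[i] (S -> R[i]) l2_pred l2 l2_closed.

End l2_def.

Section l2_norm.
Variables (R : realType) (S : choiceType).
Local Notation l2 := (l2 R S).
Implicit Types f g h : l2.

Lemma l2D f g x : val (f + g) x = val f x + val g x.
Proof. by rewrite raddfD. Qed.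
Lemma l2B f g x : val (f - g) x = val f x - val g x.
Proof. by rewrite raddfB. Qed.
Lemma l2Z c f x : val (c *: f) x = c * val f x.
Proof. by rewrite linearZ. Qed.
Lemma l20 x : val (0 : l2) x = 0.
Proof. by rewrite raddf0. Qed.
Lemma l2_sum I (r : seq I) (P : pred I) (F : I -> l2) x :
  val (\sum_(i <- r | P i) F i) x = \sum_(i <- r | P i) val (F i) x.
Proof.
elim/big_rec2 : _ => [|i y z _ <-]; first by rewrite l20.
by rewrite l2D.
Qed.

Lemma l2_ext f g : val f =1 val g -> f = g.
Proof. by move=> fg; apply/val_inj/funext. Qed.

Let sums f := [set \sum_(x <- s) sqn (val f) x | s in [set s : seq S | uniq s]].

Definition l2n f : R := Num.sqrt (sup (sums f)).

Let has_sup_sums f : has_sup (sums f).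
Proof.
split; first by exists 0, [::] => //=; rewrite big_nil.
have /asboolP[A _ hA] := valP f; exists (A ^+ 2) => _ [s us <-]; exact: hA.
Qed.

Let sup_sums_ge0 f : 0 <= sup (sums f).
Proof.
by apply: sup_upper_bound; [exact: has_sup_sums|exists [::] => //=; rewrite big_nil].
Qed.

Lemma l2n_ge0 f : 0 <= l2n f. Proof. exact: sqrtr_ge0. Qed.

Lemma l2n_ub f : bounded_sums (sqn (val f)) (l2n f ^+ 2).
Proof.
move=> s us; rewrite sqr_sqrtr//.
by apply: sup_upper_bound; [exact: has_sup_sums|exists s].
Qed.

Lemma l2n_le f (B : R) : 0 <= B -> bounded_sums (sqn (val f)) (B ^+ 2) -> l2n f <= B.
Proof.
move=> B0 hB; rewrite -(@ler_pXn2r _ 2) ?nnegrE ?l2n_ge0// sqr_sqrtr//.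
by apply: ge_sup; [exact: (has_sup_sums f).1|move=> _ [s us <-]; exact: hB].
Qed.

Lemma l2_coord_le f x : rn (val f x) <= l2n f.
Proof.
rewrite -(@ler_pXn2r _ 2) ?nnegrE ?l2n_ge0 ?rn_ge0//.
by have := l2n_ub f (s := [:: x]) isT; rewrite big_seq1.
Qed.

Lemma l2nD f g : l2n (f + g) <= l2n f + l2n g.
Proof.
apply: l2n_le => [|s us]; first by rewrite addr_ge0 ?l2n_ge0.
apply: (@minkowski_seq _ _ s (fun x => rn (val f x)) (fun x => rn (val g x))) => //.
- by move=> x; exact: rn_ge0.
- by move=> x; exact: rn_ge0.
- by move=> x; rewrite rn_ge0 l2D rnD.
- exact: l2n_ge0.
- exact: l2n_ge0.
- exact: l2n_ub.
- exact: l2n_ub.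
Qed.

Lemma l2n_eq0 f : l2n f = 0 -> f = 0.
Proof.
move=> f0; apply: l2_ext => x; rewrite l20; apply/rn0_eq0/eqP.
by rewrite eq_le rn_ge0 andbT -f0 l2_coord_le.
Qed.

Lemma l2nZ c f : l2n (c *: f) = rn c * l2n f.
Proof.
have le_nZ (d : R[i]) g : l2n (d *: g) <= rn d * l2n g.
  apply: l2n_le => [|s us]; first by rewrite mulr_ge0 ?rn_ge0 ?l2n_ge0.
  under eq_bigr do rewrite /sqn l2Z rnM exprMn.
  by rewrite -mulr_sumr exprMn ler_wpM2l ?sqr_ge0// l2n_ub.
apply/eqP; rewrite eq_le le_nZ /=.
have [->|c0] := eqVneq c 0; first by rewrite rn0 mul0r l2n_ge0.
have rc0 : 0 < rn c by rewrite rn_gt0.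
have rcV : rn c^-1 = (rn c)^-1.
  by apply: (mulIf (lt0r_neq0 rc0)); rewrite -rnM !mulVf// ?rn1// lt0r_neq0.
have := le_nZ c^-1 (c *: f); rewrite scalerA mulVf// scale1r rcV.
by rewrite ler_pdivlMl.
Qed.

Definition l2norm f : R[i] := (l2n f)%:C%C.

Lemma l2normD f g : l2norm (f + g) <= l2norm f + l2norm g.
Proof. by rewrite /l2norm -rmorphD lecR l2nD. Qed.

Lemma l2normZ c f : l2norm (c *: f) = `|c| * l2norm f.
Proof. by rewrite /l2norm l2nZ rnE -rmorphM. Qed.

Lemma l2norm_eq0 f : l2norm f = 0 -> f = 0.
Proof. by move=> /complexI /l2n_eq0. Qed.

HB.instance Definition _ := Lmodule_isNormed.Build R[i] l2 l2normD l2normZ l2norm_eq0.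

Lemma l2_rnE f : rn f = l2n f.
Proof. by []. Qed.

End l2_norm.

Section l2_complete.
Variables (R : realType) (S : choiceType).
Local Notation l2 := (l2 R S).

Lemma cauchy_lim_real (T : Type) (F : set_system T) (phi : T -> R) :
  ProperFilter F ->
  (forall e : R, 0 < e -> exists t0, \forall t \near F, `|phi t - phi t0| < e) ->
  exists l, forall e : R, 0 < e -> \forall t \near F, `|phi t - l| < e.
Proof.
move=> FF h.
have : cvg (phi @ F).
  apply: cauchy_cvg; apply: cauchy_exP => e e0.
  have [t0 ht0] := h e e0; exists (phi t0).
  apply: filterS ht0 => t ht /=.
  by rewrite -ball_normE /ball_ /= distrC.
move=> /cvg_ex[l /cvgrPdistC_lt hl]; exists l => e e0; exact: hl.
Qed.

Lemma l2_complete (F : set_system l2) : ProperFilter F -> cauchy F -> cvg F.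
Proof.
move=> FF /cauchyP FC.
have {}FC (e : R) : 0 < e -> exists f0, \forall f \near F, rn (f - f0) < e.
  move=> e0; have [|f0 hf0] := FC (e%:C%C); first by rewrite ltcR.
  exists f0; apply: filterS hf0 => f.
  by rewrite -ball_normE /ball_ /= distrC rnE ltcR.
have hRe x : exists l : R, forall e : R, 0 < e ->
    \forall f \near F, `|complex.Re (val f x) - l| < e.
  apply: cauchy_lim_real => e e0; have [f0 hf0] := FC e e0; exists f0.
  apply: filterS hf0 => f hf; rewrite -ReB -l2B.
  apply: le_lt_trans (normRe_le_rn _) _.
  by apply: le_lt_trans (l2_coord_le _ _) _; rewrite -l2_rnE.
have hIm x : exists l : R, forall e : R, 0 < e ->
    \forall f \near F, `|complex.Im (val f x) - l| < e.
  apply: cauchy_lim_real => e e0; have [f0 hf0] := FC e e0; exists f0.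
  apply: filterS hf0 => f hf; rewrite -ImB -l2B.
  apply: le_lt_trans (normIm_le_rn _) _.
  by apply: le_lt_trans (l2_coord_le _ _) _; rewrite -l2_rnE.
have [lr hlr] := choice hRe; have [li hli] := choice hIm.
pose l x : R[i] := Complex (lr x) (li x).
have hl x (e : R) : 0 < e -> \forall f \near F, rn (val f x - l x) < e.
  move=> e0; have e2 : 0 < e / 2 by rewrite divr_gt0.
  apply: filterS2 (hlr x _ e2) (hli x _ e2) => f h1 h2.
  apply: le_lt_trans (rn_le_ReIm _) _.
  by rewrite [e]splitr ReB ImB ltrD.
have hls (s : seq S) (e : R) : 0 < e ->
    \forall f \near F, forall x, x \in s -> rn (val f x - l x) < e.
  move=> e0; elim: s => [|x s IH]; first by near=> f.
  apply: filterS2 IH (hl x e e0) => f h1 h2 y; rewrite inE => /orP[/eqP->//|].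
  exact: h1.
(* The Cauchy bound passes to the pointwise limit [l]: some [f] within [e] of [f0] is also within
   [d / n] of [l] at each point of [s], and [n = size s + 1] keeps the accumulated error below
   [d]. *)
have key (f0 : l2) (e : R) : (\forall f \near F, rn (f - f0) < e) ->
    bounded_sums (sqn (fun x => l x - val f0 x)) (e ^+ 2).
  move=> hf0 s us.
  have e0 : 0 <= e.
    have [f hf] := filter_ex hf0; by apply: le_trans (rn_ge0 _) (ltW hf).
  have step (d : R) : 0 < d -> \sum_(x <- s) sqn (fun x => l x - val f0 x) x
      <= (e + d) ^+ 2.
    move=> d0; pose n := (size s).+1%:R : R.
    have n0 : 0 < n by rewrite ltr0n.
    have dn : 0 < d / n by rewrite divr_gt0.
    have [f [hf1 hf2]] := filter_ex (filterI hf0 (hls s _ dn)).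
    rewrite /sqn; apply: (@minkowski_seq _ _ s (fun x => rn (val (f - f0) x))
      (fun x => rn (l x - val f x))) => //.
    - by move=> x; exact: rn_ge0.
    - by move=> x; exact: rn_ge0.
    - move=> x; rewrite rn_ge0 andTb l2B [leRHS]addrC.
      by apply: le_trans (rnD _ _); rewrite addrA subrK.
    - exact: ltW.
    - apply: le_trans (l2n_ub (f - f0) us) _.
      by rewrite ler_pXn2r ?nnegrE ?l2n_ge0// -l2_rnE ltW.
    - apply: (@le_trans _ _ (\sum_(x <- s) (d / n) ^+ 2)).
        rewrite big_seq [leRHS]big_seq; apply: ler_sum => x xs.
        by rewrite ler_pXn2r ?nnegrE ?rn_ge0 ?ltW// rnBC hf2.
      rewrite big_const_seq count_predT iter_addr_0 -mulr_natr expr_div_n.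
      rewrite mulrAC ler_pdivrMr ?exprn_gt0// ler_wpM2l ?sqr_ge0//.
      have sn : (size s)%:R <= n by rewrite ler_nat.
      have n1 : 1 <= n by rewrite ler1n.
      by apply: le_trans sn _; rewrite expr2 ler_peMl// ltW.
  apply/ler_addgt0Pr => d d0.
  pose c := Num.min 1 (d / (2 * e + 1)).
  have e1 : 0 < 2 * e + 1 by rewrite ltr_wpDl// mulr_ge0.
  have c0 : 0 < c by rewrite lt_min ltr01 divr_gt0.
  have c1 : c <= 1 by rewrite ge_min lexx.
  have cd : c * (2 * e + 1) <= d by rewrite -ler_pdivlMr// ge_min lexx orbT.
  by apply: le_trans (step c c0) _; nra.
have lP : l2_pred l.
  have [f0 hf0] := FC 1 ltr01.
  have dP : l2_pred (fun x => l x - val f0 x) by apply/asboolP; exists 1 => //; exact: key.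
  have -> : l = val ((exist (@l2_pred R S) _ dP : l2) + f0).
    by apply/funext => x; rewrite l2D /= subrK.
  exact: valP.
apply/cvg_ex; exists (exist (@l2_pred R S) _ lP : l2).
apply/(@cvg_rnP R (l2 : normedModType R[i]) _ F id) => e e0.
have e2 : 0 < e / 2 by rewrite divr_gt0.
have [f0 hf0] := FC _ e2; apply: filterS (hf0) => f hf.
apply: le_lt_trans (rn_triangle f0 _ _) _; rewrite [ltRHS]splitr ltr_leD//.
rewrite rnBC l2_rnE; apply: l2n_le; first exact: ltW.
have -> : sqn (val ((exist (@l2_pred R S) _ lP : l2) - f0)) = sqn (fun x => l x - val f0 x).
  by apply/funext => x; rewrite /sqn l2B.
exact: key.
Unshelve. all: by end_near. Qed.

HB.instance Definition _ := Uniform_isComplete.Build l2 l2_complete.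

End l2_complete.

Section l2_dot.
Variables (R : realType) (S : choiceType).
Local Notation l2 := (l2 R S).
Implicit Types f g h : l2.

Definition l2dot f g : R[i] := csum (fun x => val f x * Num.conj (val g x)).

Lemma l2dotP f g : is_csum (fun x => val f x * Num.conj (val g x)) (l2dot f g).
Proof.
apply: (@csumP _ _ _ (l2n f * l2n g)) => s us.
under eq_bigr do rewrite rnM rnJ.
apply: prod_sum_le; [| | exact: l2n_ge0| exact: l2n_ge0| exact: l2n_ub| exact: l2n_ub].
- by move=> x; exact: rn_ge0.
- by move=> x; exact: rn_ge0.
Qed.

Lemma l2dotC f g : l2dot f g = Num.conj (l2dot g f).
Proof.
apply: csumE; have := is_csumJ (l2dotP g f); congr (is_csum _ _).
by apply/funext => x; rewrite cjM cjK mulrC.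
Qed.

Lemma l2dotlP c f g h : l2dot (c *: f + g) h = c * l2dot f h + l2dot g h.
Proof.
apply: csumE; have := is_csumD (is_csumZ c (l2dotP f h)) (l2dotP g h).
by congr (is_csum _ _); apply/funext => x; rewrite l2D l2Z mulrDl mulrA.
Qed.

Lemma l2dot_linl h : GRing.linear_for *%R (l2dot^~ h).
Proof. by move=> c f g; rewrite l2dotlP. Qed.

Lemma l2dot_linr f : GRing.linear_for (Num.conj \; *%R) (l2dot f).
Proof.
by move=> c g h; rewrite l2dotC l2dotlP cjD cjM -!l2dotC.
Qed.

Lemma l2dot_norm f : l2dot f f = (l2n f ^+ 2)%:C%C.
Proof.
apply: csumE; rewrite sqr_sqrtr; last first.
  by apply: sup_upper_bound; [split; [exists 0, [::] => //=; rewrite big_nil|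
    exists (l2n f ^+ 2) => _ [s us <-]; exact: l2n_ub]|exists [::] => //=; rewrite big_nil].
have := is_csum_ge0 (@sqn_ge0 R S (val f)) (@l2n_ub _ _ f); congr (is_csum _ _).
by apply/funext => x; rewrite rn_mulJ.
Qed.

Lemma l2dot_gt0 f : f != 0 -> 0 < l2dot f f.
Proof. by move=> f0; rewrite l2dot_norm ltcR exprn_gt0// -l2_rnE rn_gt0. Qed.

Lemma l2dot_herm f g : l2dot f g = (-1) ^+ false * Num.conj (l2dot g f).
Proof. by rewrite expr0 mul1r -l2dotC. Qed.

HB.instance Definition _ := @bilinear_isBilinear.Build R[i] l2 l2 R[i]
  *%R (Num.conj \; *%R) l2dot (l2dot_linl, l2dot_linr).
HB.instance Definition _ := @isHermitianSesquilinear.Build R[i] l2 false Num.conj l2dot l2dot_herm.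
HB.instance Definition _ := @isDotProduct.Build R[i] l2 l2dot l2dot_gt0.

Lemma l2_hdot_norm f : `|f| ^+ 2 = l2dot f f.
Proof. by rewrite l2dot_norm rnE -rmorphXn l2_rnE. Qed.

HB.instance Definition _ := isHilbert.Build R l2 l2_hdot_norm.

End l2_dot.

(** * Operators on Hilbert spaces *)

Section hilbert.
Variables (R : realType) (H : hilbertType R).
Implicit Types u v w : H.

Lemma hdotDl u v w : hdot (u + v) w = hdot u w + hdot v w.
Proof. exact: linearDl. Qed.
Lemma hdotBl u v w : hdot (u - v) w = hdot u w - hdot v w.
Proof. exact: linearBl. Qed.
Lemma hdotZl c u v : hdot (c *: u) v = c * hdot u v.
Proof. exact: linearZl_LR. Qed.
Lemma hdotC u v : hdot u v = Num.conj (hdot v u).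
Proof. by rewrite [LHS]hermitian_subproof expr0 mul1r. Qed.
Lemma hdotDr u v w : hdot u (v + w) = hdot u v + hdot u w.
Proof. by rewrite hdotC hdotDl cjD -!hdotC. Qed.
Lemma hdotBr u v w : hdot u (v - w) = hdot u v - hdot u w.
Proof. by rewrite hdotC hdotBl cjB -!hdotC. Qed.
Lemma hdotZr c u v : hdot u (c *: v) = Num.conj c * hdot u v.
Proof. by rewrite hdotC hdotZl cjM -hdotC. Qed.
Lemma hdot0l v : hdot 0 v = 0.
Proof. by rewrite -[X in hdot X](scale0r 0) hdotZl mul0r. Qed.
Lemma hdot0r v : hdot v 0 = 0.
Proof. by rewrite hdotC hdot0l; exact: rmorph0. Qed.
Lemma hdot_suml I (r : seq I) (P : pred I) (F : I -> H) v :
  hdot (\sum_(i <- r | P i) F i) v = \sum_(i <- r | P i) hdot (F i) v.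
Proof.
elim/big_rec2 : _ => [|i x y _ <-]; [exact: hdot0l|exact: hdotDl].
Qed.
Lemma hdot_sumr I (r : seq I) (P : pred I) (F : I -> H) v :
  hdot v (\sum_(i <- r | P i) F i) = \sum_(i <- r | P i) hdot v (F i).
Proof.
elim/big_rec2 : _ => [|i x y _ <-]; [exact: hdot0r|exact: hdotDr].
Qed.

Lemma hdotvv v : hdot v v = (rn v ^+ 2)%:C%C.
Proof. by rewrite -hdot_norm rnE -rmorphXn. Qed.

Lemma hdot_CS u v : rn (hdot u v) <= rn u * rn v.
Proof.
have [->|v0] := eqVneq v 0; first by rewrite hdot0r !rn0 mulr0.
have rv : 0 < rn v by rewrite rn_gt0.
set z := hdot u v; pose c : R[i] := (rn v ^- 2)%:C%C * z.
have vv : ((rn v ^+ 2)%:C%C : R[i]) != 0.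
  by apply/eqP => /complexI h; have := exprn_gt0 2 rv; rewrite h ltxx.
have key : rn (u - c *: v) ^+ 2 = rn u ^+ 2 - rn v ^- 2 * rn z ^+ 2.
  apply: (@complexI R); rewrite -hdotvv hdotBl !hdotBr hdotZl !hdotZr !hdotZl !hdotvv.
  have rB (x y : R) : ((x - y)%:C)%C = (x%:C)%C - (y%:C)%C :> R[i] by exact: rmorphB.
  have rM (x y : R) : ((x * y)%:C)%C = (x%:C)%C * (y%:C)%C :> R[i] by exact: rmorphM.
  have rV (x : R) : ((x^-1)%:C)%C = ((x%:C)%C)^-1 :> R[i] by exact: fmorphV.
  rewrite (hdotC v u) -/z /c cjM cj_real rB (rM (rn v ^- 2)) -(rn_mulJ z) rV.
  by move: (((rn v ^+ 2)%:C)%C : R[i]) vv => x x0; field.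
have := sqr_ge0 (rn (u - c *: v)); rewrite key subr_ge0.
rewrite mulrC ler_pdivrMr ?exprn_gt0// -exprMn => h.
by rewrite -(@ler_pXn2r _ 2) ?nnegrE ?mulr_ge0 ?rn_ge0.
Qed.

Section orthogonal_projection.
Variable P : {linear H -> H}.
Hypotheses (Psa : self_adjoint P) (PP : P \o P =1 P).

Lemma hdot_proj v : hdot (P v) v = (rn (P v) ^+ 2)%:C%C.
Proof. by rewrite -hdotvv -[RHS]Psa; congr (hdot _ v); exact/esym/PP. Qed.

Lemma proj_contract v : rn (P v) <= rn v.
Proof.
rewrite -(@ler_pXn2r _ 2) ?nnegrE ?rn_ge0// -subr_ge0.
have -> : rn v ^+ 2 - rn (P v) ^+ 2 = rn (v - P v) ^+ 2.
  apply: (@complexI R); rewrite -hdotvv hdotBl !hdotBr !hdotvv.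
  rewrite -(Psa v v) hdot_proj rmorphB /=.
  by rewrite subrr subr0.
exact: sqr_ge0.
Qed.

End orthogonal_projection.

(** [(P v, v) = |P v|^2 = |P (Q v)|^2 <= |Q v|^2], so the order between projections reduces to the
    identity [P Q = P]. *)
Lemma proj_op_le (P Q : {linear H -> H}) :
  self_adjoint P -> P \o P =1 P -> self_adjoint Q -> Q \o Q =1 Q ->
  P \o Q =1 P -> op_le P Q.
Proof.
move=> Psa PP Qsa QQ PQ v; rewrite !hdot_proj// lecR.
rewrite ler_pXn2r ?nnegrE ?rn_ge0// -(PQ v) /=.
exact: proj_contract.
Qed.

Lemma opnorm_le (f : H -> H) (C : R) : 0 <= C -> (forall v, rn (f v) <= C * rn v) ->
  opnorm f <= C.
Proof.
move=> C0 fC; apply: ge_sup; first by exists (rn (f 0)), 0 => //=; rewrite normr0.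
move=> _ [v /= v1 <-]; apply: le_trans (fC v) _.
by rewrite ler_piMr// -lecR -rnE.
Qed.

Lemma opnorm_ge0 (f : H -> H) (C : R) : (forall v, rn (f v) <= C * rn v) ->
  0 <= opnorm f.
Proof.
move=> fC; apply: (@le_trans _ _ (rn (f 0))); first exact: rn_ge0.
apply: sup_upper_bound; last by exists 0 => //=; rewrite normr0.
split; first by exists (rn (f 0)), 0 => //=; rewrite normr0.
exists `|C| => _ [v /= v1 <-]; apply: le_trans (fC v) _.
apply: le_trans (_ : _ <= `|C| * rn v) _; first by rewrite ler_wpM2r ?rn_ge0 ?ler_norm.
by rewrite ler_piMr// -lecR -rnE.
Qed.

(** The a priori constant [C] makes the set under [sup] bounded above, so that [opnorm] is a genuine
    supremum; it then disappears from the conclusion. *)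
Lemma opnorm_ub (f : H -> H) (C : R) : (forall c v, f (c *: v) = c *: f v) ->
  (forall v, rn (f v) <= C * rn v) -> forall v, rn (f v) <= opnorm f * rn v.
Proof.
move=> fZ fC v; have [->|v0] := eqVneq v 0.
  have f0 : f 0 = 0 by rewrite -[X in f X](scale0r 0) fZ scale0r.
  by rewrite f0 rn0 mulr0.
have rv : 0 < rn v by rewrite rn_gt0.
rewrite -ler_pdivrMr//.
have fE : rn (f v) / rn v = rn (f ((rn v)^-1%:C%C *: v)).
  by rewrite fZ rnZ rn_real ger0_norm ?invr_ge0 ?rn_ge0// mulrC.
rewrite fE; apply: sup_upper_bound.
  split; first by exists (rn (f 0)), 0 => //=; rewrite normr0.
  exists `|C| => _ [w /= w1 <-]; apply: le_trans (fC w) _.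
  apply: le_trans (_ : _ <= `|C| * rn w) _; first by rewrite ler_wpM2r ?rn_ge0 ?ler_norm.
  by rewrite ler_piMr// -lecR -rnE.
exists ((rn v)^-1%:C%C *: v) => //=.
rewrite rnE rnZ rn_real ger0_norm ?invr_ge0 ?rn_ge0// mulVf ?lt0r_neq0//.
Qed.

End hilbert.

Definition mk_bounded_op (R : realType) (H : hilbertType R) (f : {linear H -> H}) (C : R)
  (fC : forall v, rn (f v) <= C * rn v) : bounded_op H :=
  BoundedOp (lipschitz_continuous fC).

Section unitary.
Variables (R : realType) (G : groupType) (H : hilbertType R) (sigma : unitary_rep G H).

Lemma urep_rn g v : rn (sigma g v) = rn v.
Proof.
apply/eqP; rewrite -(@eqrXn2 _ 2) ?rn_ge0//; apply/eqP/(@complexI R).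
by rewrite -!hdotvv urep_dot.
Qed.

Definition urep_sum (s : seq (R[i] * G)) (v : H) : H := \sum_(p <- s) p.1 *: sigma p.2 v.

Lemma urep_sumD s v w : urep_sum s (v + w) = urep_sum s v + urep_sum s w.
Proof. by rewrite -big_split /=; apply: eq_bigr => p _; rewrite linearD scalerDr. Qed.

Lemma urep_sumZ s c v : urep_sum s (c *: v) = c *: urep_sum s v.
Proof.
by rewrite scaler_sumr; apply: eq_bigr => p _; rewrite linearZ /= !scalerA mulrC.
Qed.

Lemma urep_sum_bound s v : rn (urep_sum s v) <= (\sum_(p <- s) rn p.1) * rn v.
Proof.
apply: le_trans (rn_sum _ _ _) _; rewrite mulr_suml; apply: ler_sum => p _.
by rewrite rnZ urep_rn.
Qed.

Lemma urep_sum_opnorm s v : rn (urep_sum s v) <= opnorm (urep_sum s) * rn v.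
Proof. exact: (opnorm_ub (@urep_sumZ s) (urep_sum_bound s)). Qed.

Lemma opnorm_universal s : opnorm (urep_sum s) <= universal_norm s.
Proof.
apply: sup_upper_bound; last by exists H, sigma.
split; first by exists (opnorm (urep_sum s)), H, sigma.
(* The l1 norm of the coefficients bounds all unitary representations at once, so the universal norm
   is the supremum of a bounded set. *)
exists (\sum_(p <- s) rn p.1) => _ [K [tau ->]].
apply: opnorm_le; first by rewrite sumr_ge0// => p _; exact: rn_ge0.
move=> v; apply: le_trans (rn_sum _ _ _) _; rewrite mulr_suml; apply: ler_sum => p _.
rewrite rnZ ler_wpM2l ?rn_ge0//.
rewrite -(@ler_pXn2r _ 2) ?nnegrE ?rn_ge0// -lecR -!hdotvv urep_dot.
exact: lexx.
Qed.

End unitary.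

Section finite_support.
Variables (R : realType) (S : choiceType).
Local Notation l2 := (l2 R S).
Implicit Types (f g : l2) (s : seq S) (a : S -> R[i]).

Lemma l2_pred_fin a s : (forall x, x \notin s -> a x = 0) -> l2_pred a.
Proof.
move=> a0; have sq0 x : x \notin s -> sqn a x = 0.
  by move=> /a0; rewrite /sqn => ->; rewrite rn0 expr0n.
apply/asboolP; exists (Num.sqrt (\sum_(x <- undup s) sqn a x)); first exact: sqrtr_ge0.
move=> r ur; rewrite sqr_sqrtr ?sumr_ge0// => [|x _]; last exact: sqn_ge0.
apply: (@le_trans _ _ (\sum_(x <- undup (r ++ s)) sqn a x)).
  apply: sum_uniq_le; rewrite ?undup_uniq//; first exact: sqn_ge0.
  by move=> x xr; rewrite mem_undup mem_cat xr.
rewrite (@big_uniq_sub _ _ _ _ (undup s)) ?undup_uniq//.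
  by move=> x; rewrite !mem_undup mem_cat orbC => ->.
by move=> x _; rewrite mem_undup; exact: sq0.
Qed.

Lemma l2n_fin f s : uniq s -> (forall x, x \notin s -> val f x = 0) ->
  l2n f ^+ 2 = \sum_(x <- s) sqn (val f) x.
Proof.
move=> us f0; apply/eqP; rewrite eq_le l2n_ub// andbT.
have S0 : 0 <= \sum_(x <- s) sqn (val f) x by rewrite sumr_ge0// => x _; exact: sqn_ge0.
rewrite -[leRHS]sqr_sqrtr// ler_pXn2r ?nnegrE ?l2n_ge0 ?sqrtr_ge0//.
apply: l2n_le; first exact: sqrtr_ge0.
move=> r ur; rewrite sqr_sqrtr//.
rewrite -(@big_uniq_sub _ _ _ _ s (undup (r ++ s))) ?undup_uniq//; last 2 first.
- by move=> x xs; rewrite mem_undup mem_cat xs orbT.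
- by move=> x _ xs; rewrite /sqn f0// rn0 expr0n.
apply: sum_uniq_le; rewrite ?undup_uniq//; first exact: sqn_ge0.
by move=> x xr; rewrite mem_undup mem_cat xr.
Qed.

Lemma l2dot_fin f g s : uniq s ->
  (forall x, x \notin s -> val f x * Num.conj (val g x) = 0) ->
  l2dot f g = \sum_(x <- s) val f x * Num.conj (val g x).
Proof. by move=> us h; apply: csumE; exact: is_csum_fin. Qed.

Let fsupp_fun s a x : R[i] := if x \in s then a x else 0.

Let fsupp_l2 s a : l2_pred (fsupp_fun s a).
Proof.
by apply: (@l2_pred_fin _ s) => x; rewrite /fsupp_fun => /negPf ->.
Qed.

Definition fsupp s a : l2 := exist (@l2_pred R S) _ (fsupp_l2 s a).

Lemma fsuppE s a x : val (fsupp s a) x = if x \in s then a x else 0.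
Proof. by []. Qed.

Lemma fsupp0 s a x : x \notin s -> val (fsupp s a) x = 0.
Proof. by rewrite fsuppE => /negPf ->. Qed.

Lemma l2_approx f (e : R) : 0 < e ->
  exists2 s, uniq s & rn (f - fsupp s (val f)) < e.
Proof.
move=> e0; pose A := [set \sum_(x <- s) sqn (val f) x | s in [set s : seq S | uniq s]].
have hA : has_sup A.
  split; first by exists 0, [::] => //=; rewrite big_nil.
  by exists (l2n f ^+ 2) => _ [s us <-]; exact: l2n_ub.
have supA : sup A = l2n f ^+ 2.
  by rewrite sqr_sqrtr//; apply: sup_upper_bound => //; exists [::] => //=; rewrite big_nil.
have e20 : 0 < (e / 2) ^+ 2 by rewrite exprn_gt0// divr_gt0.
have [_ [s us <-] hs] := sup_adherent e20 hA; exists s => //.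
apply: (@le_lt_trans _ _ (e / 2)); last by rewrite ltr_pdivrMr// ltr_pMr// ltr1n.
rewrite l2_rnE; apply: l2n_le; first by rewrite ltW// divr_gt0.
move=> r ur; pose t := [seq x <- r | x \notin s].
have -> : \sum_(x <- r) sqn (val (f - fsupp s (val f))) x = \sum_(x <- t) sqn (val f) x.
  rewrite [RHS]big_filter [RHS]big_mkcond; apply: eq_bigr => x _.
  rewrite /sqn l2B fsuppE; case: (x \in s) => /=; last by rewrite subr0.
  by rewrite subrr rn0 expr0n.
have : \sum_(x <- s ++ t) sqn (val f) x <= l2n f ^+ 2.
  apply: l2n_ub; rewrite cat_uniq us filter_uniq//= andbT.
  by apply/hasPn => x; rewrite mem_filter => /andP[].
rewrite big_cat /= -supA; move: hs; lra.
Qed.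

Definition delta x : l2 := fsupp [:: x] (fun=> 1).

Lemma deltaE x y : val (delta x) y = (y == x)%:R.
Proof. by rewrite fsuppE inE; case: eqP. Qed.

Lemma fsupp_delta s a : uniq s -> fsupp s a = \sum_(x <- s) a x *: delta x.
Proof.
move=> us; apply: l2_ext => y; rewrite l2_sum fsuppE.
under eq_bigr do rewrite l2Z deltaE.
case: ifP => ys.
  rewrite (bigD1_seq y)//= eqxx mulr1 big1 ?addr0// => x.
  by rewrite eq_sym => /negPf ->; rewrite mulr0.
rewrite big_seq big1// => x xs; case: eqP => [yx|]; last by rewrite mulr0.
by rewrite yx xs in ys.
Qed.

End finite_support.

Section permutation_rep.
Variables (R : realType) (S : choiceType) (G : groupType) (act : G -> S -> S).
Hypotheses (act1 : act 1%g =1 id) (actM : forall g h x, act (g * h)%g x = act g (act h x)).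
Local Notation l2 := (l2 R S).

Lemma actK g : cancel (act g) (act g^-1%g).
Proof. by move=> x; rewrite -actM mulVg act1. Qed.
Lemma actVK g : cancel (act g^-1%g) (act g).
Proof. by move=> x; rewrite -actM mulgV act1. Qed.

Let perm_bounded g (a : S -> R[i]) (M : R) :
  bounded_sums (sqn a) M -> bounded_sums (sqn (a \o act g)) M.
Proof.
move=> h s us.
have -> : \sum_(x <- s) sqn (a \o act g) x = \sum_(x <- [seq act g x | x <- s]) sqn a x.
  by rewrite big_map.
by apply: h; rewrite map_inj_uniq//; exact: can_inj (@actK g).
Qed.

Let perm_l2 g (f : l2) : l2_pred (val f \o act g^-1%g).
Proof.
have /asboolP[A A0 hA] := valP f; apply/asboolP; exists A => //.
exact: perm_bounded.
Qed.

Definition lact g (f : l2) : l2 := exist (@l2_pred R S) _ (perm_l2 g f).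

Lemma lactE g f x : val (lact g f) x = val f (act g^-1%g x).
Proof. by []. Qed.

Let lact_linear g : linear (lact g).
Proof. by move=> c f h; apply: l2_ext => x; rewrite l2D l2Z !lactE l2D l2Z. Qed.

HB.instance Definition _ g := GRing.isLinear.Build R[i] l2 l2 *:%R (lact g) (lact_linear g).

Let lact1 f : lact 1%g f = f.
Proof. by apply: l2_ext => x; rewrite lactE invg1 act1. Qed.

Let lactM g h f : lact (g * h)%g f = lact g (lact h f).
Proof. by apply: l2_ext => x; rewrite !lactE invgM actM. Qed.

Let lact_dot g (f h : l2) : hdot (lact g f) (lact g h) = hdot f h.
Proof.
apply: csumE => e e0; have [s hs] := l2dotP f h e0.
exists [seq act g x | x <- s] => r ur sr.
have -> : \sum_(x <- r) val (lact g f) x * Num.conj (val (lact g h) x) =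
    \sum_(x <- [seq act g^-1%g x | x <- r]) val f x * Num.conj (val h x).
  by rewrite big_map.
apply: hs.
  by rewrite map_inj_uniq//; exact: can_inj (@actVK g).
move=> x xs; apply/mapP; exists (act g x); last by rewrite actK.
by apply: sr; exact: map_f.
Qed.

Definition perm_rep : unitary_rep G l2 :=
  UnitaryRep (urep_fun := fun g => (lact g : {linear l2 -> l2})) lact1 lactM lact_dot.

Lemma perm_repE g f x : val (perm_rep g f) x = val f (act g^-1%g x).
Proof. by []. Qed.

End permutation_rep.

(** * Finite-rank projections given by kernels *)

Section schur.
Variables (R : realType) (T : eqType).

Lemma wsum_sqr_le (s : seq T) (d p : T -> R) :
  (forall y, 0 <= d y) ->
  (\sum_(y <- s) d y * p y) ^+ 2 <=
  (\sum_(y <- s) d y) * \sum_(y <- s) d y * p y ^+ 2.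
Proof.
move=> d0; rewrite -subr_ge0.
set S0 := \sum_(y <- s) d y; set S2 := \sum_(y <- s) d y * p y ^+ 2.
set S1 := \sum_(y <- s) d y * p y.
(* Lagrange's identity: the defect in the weighted Cauchy-Schwarz inequality is a sum of squares. *)
have -> : S0 * S2 - S1 ^+ 2 =
  2^-1 * \sum_(y <- s) \sum_(z <- s) d y * d z * (p y - p z) ^+ 2.
  have inner y : \sum_(z <- s) d y * d z * (p y - p z) ^+ 2 =
      S2 * d y + (S0 * (d y * p y ^+ 2) + (-2 * S1) * (d y * p y)).
    transitivity (\sum_(z <- s) (d z * p z ^+ 2 * d y +
      (d z * (d y * p y ^+ 2) + d z * p z * (-2 * (d y * p y))))).
      by apply: eq_bigr => z _; ring.
    by rewrite !big_split /= -!mulr_suml; rewrite -/S0 -/S1 -/S2; ring.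
  under eq_bigr do rewrite inner.
  rewrite !big_split /= -!mulr_sumr -/S0 -/S1 -/S2.
  by field.
rewrite mulr_ge0 ?invr_ge0// sumr_ge0// => y _; rewrite sumr_ge0// => z _.
by apply: mulr_ge0; [apply: mulr_ge0|exact: sqr_ge0].
Qed.

(** Cauchy-Schwarz in each row with weights [|d x y|] costs one factor [rho]; after exchanging the
    sums, the column sums, equal to row sums by symmetry, cost the other. *)
Lemma schur_test (s : seq T) (d : T -> T -> R) (f : T -> R[i]) (rho : R) :
  (forall x y, d x y = d y x) ->
  (forall x, x \in s -> \sum_(y <- s) `|d x y| <= rho) -> 0 <= rho ->
  \sum_(x <- s) rn (\sum_(y <- s) (d x y)%:C%C * f y) ^+ 2 <=
  rho ^+ 2 * \sum_(y <- s) rn (f y) ^+ 2.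
Proof.
move=> dC dr rho0.
apply: (@le_trans _ _ (\sum_(x <- s) rho * \sum_(y <- s) `|d x y| * rn (f y) ^+ 2)).
  rewrite big_seq [leRHS]big_seq; apply: ler_sum => x xs.
  apply: (@le_trans _ _ ((\sum_(y <- s) `|d x y| * rn (f y)) ^+ 2)).
    rewrite ler_pXn2r ?nnegrE ?rn_ge0//; last first.
      by rewrite sumr_ge0// => y _; rewrite mulr_ge0 ?rn_ge0.
    apply: le_trans (rn_sum _ _ _) _; apply: ler_sum => y _.
    by rewrite rnM rn_real.
  apply: le_trans (wsum_sqr_le _ _ _) _ => //.
  by rewrite ler_wpM2r ?dr// sumr_ge0// => y _; rewrite mulr_ge0 ?sqr_ge0.
rewrite -mulr_sumr expr2 -mulrA ler_wpM2l// exchange_big /= mulr_sumr.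
rewrite big_seq [leRHS]big_seq; apply: ler_sum => y ys.
rewrite -mulr_suml ler_wpM2r ?sqr_ge0//.
by under eq_bigr do rewrite dC; exact: dr.
Qed.

End schur.

Section compact_box.
Variables (R : realType) (V : normedModType R[i]).

(** The coefficients are real, so that the box is a continuous image of a product of segments; a
    complex direction [e] enters as the two vectors [e] and [i e]. *)
Fixpoint box (us : seq V) : set V :=
  if us is u :: us' then
    (fun p : R * V => (p.1)%:C%C *: u + p.2) @` (`[-1, 1] `*` box us')
  else [set 0].

Lemma real_complex_continuous : continuous (fun x : R => (x%:C%C : R[i]^o)).
Proof.
move=> x; apply/(@cvg_rnP R R[i]^o) => e e0.
have : \forall y \near x, `|y - x| < e by exact: (@cvgr_distC_lt _ R _ _ _ idfun x (@cvg_id _ _)).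
by apply: filterS => y xy; rewrite -rmorphB rn_real.
Qed.

Lemma box_compact us : compact (box us).
Proof.
elim: us => [|u us IH] /=; first exact: compact_set1.
apply: continuous_compact; last by apply: compact_setX => //; exact: segment_compact.
apply: continuous_subspaceT => p.
apply: cvgD; last exact: cvg_snd.
apply: cvgZr_tmp.
apply: (@cvg_comp _ _ _ (fst : R * V -> R) (fun x : R => (x%:C%C : R[i]^o)) _ (nbhs p.1)).
  exact: cvg_fst.
exact: real_complex_continuous.
Qed.

Lemma box_sum (T : Type) (s : seq T) (c : T -> R[i]) (e : T -> V) :
  (forall x, rn (c x) <= 1) ->
  box (flatten [seq [:: e x; 'i%C *: e x] | x <- s]) (\sum_(x <- s) c x *: e x).
Proof.
move=> c1; elim: s => [|x s IH] /=; first by rewrite big_nil.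
have itvP (t : R) : `|t| <= rn (c x) -> `[-1, 1]%classic t.
  by move=> h; rewrite /= in_itv /= -ler_norml; exact: le_trans h (c1 x).
exists (complex.Re (c x), (complex.Im (c x))%:C%C *: ('i%C *: e x) + \sum_(x <- s) c x *: e x).
  split => /=; first exact/itvP/normRe_le_rn.
  exists (complex.Im (c x), \sum_(x <- s) c x *: e x) => //.
  by split => //=; exact/itvP/normIm_le_rn.
rewrite big_cons /= addrA scalerA -scalerDl; congr (_ *: _ + _).
by rewrite [in RHS](complexE (c x)) [X in _ + X]mulrC.
Qed.

End compact_box.

Section kernel_operator.
Variables (R : realType) (S : choiceType) (W : seq S) (q : S -> S -> R).
Local Notation l2 := (l2 R S).
Implicit Types f g : l2.

Definition kop f : l2 := fsupp W (fun x => \sum_(y <- W) (q x y)%:C%C * val f y).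

Lemma kopE f x :
  val (kop f) x = if x \in W then \sum_(y <- W) (q x y)%:C%C * val f y else 0.
Proof. by []. Qed.

Let kop_linear : linear kop.
Proof.
move=> c f g; apply: l2_ext => x; rewrite l2D l2Z !kopE.
case: ifP => xW; last by rewrite mulr0 addr0.
rewrite mulr_sumr -big_split; apply: eq_bigr => y _.
by rewrite l2D l2Z mulrDr mulrCA.
Qed.

HB.instance Definition _ := GRing.isLinear.Build R[i] l2 l2 *:%R kop kop_linear.

Hypotheses (uW : uniq W) (qC : forall x y, q x y = q y x).

Lemma kop_self_adjoint : self_adjoint kop.
Proof.
move=> f g; rewrite /hdot /=.
rewrite (@l2dot_fin _ _ _ _ W)//; last by move=> x xW; rewrite kopE (negPf xW) mul0r.
rewrite (@l2dot_fin _ _ _ _ W)//; last first.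
  by move=> x xW; rewrite kopE (negPf xW) rmorph0 mulr0.
transitivity (\sum_(x <- W) \sum_(y <- W) (q x y)%:C%C * val f y * Num.conj (val g x)).
  by rewrite big_seq [RHS]big_seq; apply: eq_bigr => x xW; rewrite kopE xW mulr_suml.
rewrite exchange_big big_seq [RHS]big_seq; apply: eq_bigr => y yW.
rewrite kopE yW cj_sum mulr_sumr; apply: eq_bigr => x _.
by rewrite cjM cj_real (qC y) mulrCA mulrA.
Qed.

Hypothesis qq : forall x z, x \in W -> z \in W -> \sum_(y <- W) q x y * q y z = q x z.

Lemma kop_idem : kop \o kop =1 kop.
Proof.
move=> f; change (kop (kop f) = kop f); apply: l2_ext => x.
rewrite (kopE (kop f)) (kopE f); case: ifP => // xW.
transitivity (\sum_(y <- W) \sum_(z <- W) (q x y * q y z)%:C%C * val f z).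
  rewrite big_seq [RHS]big_seq; apply: eq_bigr => y yW; rewrite kopE yW mulr_sumr.
  by apply: eq_bigr => z _; rewrite mulrA -rmorphM.
rewrite exchange_big big_seq [RHS]big_seq; apply: eq_bigr => z zW.
by rewrite -mulr_suml -rmorph_sum qq.
Qed.

Lemma kop_contract f : rn (kop f) <= rn f.
Proof. exact: (proj_contract kop_self_adjoint kop_idem). Qed.

Lemma kop_compact : compact_op kop.
Proof.
pose us := flatten [seq [:: delta R x; 'i%C *: delta R x] | x <- W].
have cK : compact (box us) by exact: box_compact.
have hK := compact_precompact (@norm_hausdorff _ l2) cK.
apply: precompact_subset hK => _ [f /= f1 <-].
have -> : kop f = \sum_(x <- W) val (kop f) x *: delta R x.
  rewrite -fsupp_delta//; apply: l2_ext => x; rewrite fsuppE kopE.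
  by case: ifP.
apply: box_sum => x; apply: le_trans (l2_coord_le _ _) _.
rewrite -l2_rnE; apply: le_trans (kop_contract f) _.
by rewrite -lecR -rnE.
Qed.

Definition kbop : bounded_op l2 :=
  @mk_bounded_op R l2 kop 1 (fun f => ltac:(rewrite mul1r; exact: kop_contract)).

Section commutator.
Variables (G : groupType) (act : G -> S -> S).
Hypotheses (act1 : act 1%g =1 id) (actM : forall (g h : G) x, act (g * h)%g x = act g (act h x)).
Hypothesis q0 : forall x y, x \notin W -> q x y = 0.

(** Up to the unitary of [g], the commutator has kernel [q (g x) (g y) - q x y], to which the Schur
    test applies. The list [V] contains both [W] and its preimage under [g], outside which this
    kernel vanishes. *)
Lemma kop_comm (g : G) (rho : R) f : 0 <= rho ->
  (forall V x, uniq V -> \sum_(y <- V) `|q (act g x) (act g y) - q x y| <= rho) ->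
  rn (kop (perm_rep R act1 actM g f) - perm_rep R act1 actM g (kop f)) <= rho * rn f.
Proof.
move=> rho0 hrho; set h := (X in rn X).
pose V := undup (W ++ [seq act g^-1%g x | x <- W]).
have aK := actK act1 actM; have aVK := actVK act1 actM.
pose d x y := q (act g x) (act g y) - q x y.
have uV : uniq V by exact: undup_uniq.
have WV x : x \in W -> x \in V by move=> xW; rewrite mem_undup mem_cat xW.
have gWV x : act g x \in W -> x \in V.
  move=> xW; rewrite mem_undup mem_cat; apply/orP; right.
  by apply/mapP; exists (act g x) => //; rewrite aK.
have kE x : val (kop f) x = \sum_(y <- V) (q x y)%:C%C * val f y.
  rewrite (@big_uniq_sub _ _ _ _ W V)//; last first.
    by move=> y _ yW; rewrite qC q0// mul0r.
  rewrite kopE; case: ifP => // /negbT xW.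
  by rewrite big1// => y _; rewrite q0// mul0r.
have kgE x : val (kop (perm_rep R act1 actM g f)) (act g x) =
    \sum_(y <- V) (q (act g x) (act g y))%:C%C * val f y.
  have -> : val (kop (perm_rep R act1 actM g f)) (act g x) =
      \sum_(y <- W) (q (act g x) y)%:C%C * val f (act g^-1%g y).
    rewrite kopE; case: ifP => [xW|/negbT xW]; first by apply: eq_bigr => y _.
    by rewrite big1// => y _; rewrite q0// mul0r.
  rewrite -(@big_uniq_sub _ _ _ _ W [seq act g y | y <- V]) ?big_map//.
  - by apply: eq_bigr => y _; rewrite aK.
  - by rewrite map_inj_uniq//; exact: can_inj (aK g).
  - move=> y yW; apply/mapP; exists (act g^-1%g y); last by rewrite aVK.
    by apply: gWV; rewrite aVK.
  - by move=> y _ yW; rewrite qC q0// mul0r.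
have hE x : val h (act g x) = \sum_(y <- V) (d x y)%:C%C * val f y.
  rewrite /h l2B kgE perm_repE aK kE -sumrB; apply: eq_bigr => y _.
  by rewrite -mulrBl -rmorphB.
have h0 x : x \notin [seq act g y | y <- V] -> val h x = 0.
  move=> xV; rewrite -(aVK g x) hE big1// => y _.
  have xW : x \notin W.
    apply: contra xV => xW; apply/mapP; exists (act g^-1%g x); last by rewrite aVK.
    by apply: gWV; rewrite aVK.
  have gxW : act g^-1%g x \notin W.
    apply: contra xV => xW'; apply/mapP; exists (act g^-1%g x); last by rewrite aVK.
    exact: WV.
  by rewrite /d aVK !q0// subrr mul0r.
rewrite l2_rnE -(@ler_pXn2r _ 2) ?nnegrE ?l2n_ge0 ?mulr_ge0 ?rn_ge0//.
rewrite (@l2n_fin _ _ _ [seq act g y | y <- V])//; last first.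
  by rewrite map_inj_uniq//; exact: can_inj (aK g).
rewrite big_map exprMn.
under eq_bigr do rewrite /sqn hE.
apply: le_trans (@schur_test R _ V d (val f) rho _ _ rho0) _.
- by move=> x y; rewrite /d qC (qC x y).
- by move=> x _; exact: hrho.
by rewrite ler_wpM2l ?sqr_ge0//; exact: l2n_ub.
Qed.

End commutator.
End kernel_operator.

(** * Separability from a countable family with dense span *)

Section separability.
Variables (R : realType) (V : normedModType R[i]) (T : countType) (e : T -> V).

Lemma rat_approx (x d : R) : 0 < d -> exists r : rat, `|x - ratr r| < d.
Proof.
move=> d0; have /rat_in_itvoo[r] : x - d < x + d by lra.
rewrite in_itv /= => /andP[h1 h2]; exists r.
by rewrite ltr_distlC h1 h2.
Qed.

Definition ratc (p : rat * rat) : R[i] := Complex (ratr p.1) (ratr p.2).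

Lemma ratc_approx (z : R[i]) (d : R) : 0 < d -> exists p, rn (z - ratc p) < d.
Proof.
move=> d0; have d2 : 0 < d / 2 by rewrite divr_gt0.
have [r hr] := rat_approx (complex.Re z) d2.
have [r' hr'] := rat_approx (complex.Im z) d2.
exists (r, r'); apply: le_lt_trans (rn_le_ReIm _) _.
by rewrite ReB ImB [d]splitr ltrD.
Qed.

Lemma dense_span_separable :
  dense (range (fun s : seq (R[i] * T) => \sum_(p <- s) p.1 *: e p.2)) ->
  separable V.
Proof.
move=> /dense_rnP dV.
exists (range (fun s : seq ((rat * rat) * T) => \sum_(p <- s) ratc p.1 *: e p.2)).
split; first by apply: sub_countable (card_image_le _ _) (countableP _).
apply/dense_rnP => v d d0; have d2 : 0 < d / 2 by rewrite divr_gt0.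
have [_ [s _ <-] vs] := dV v _ d2.
suff [s' hs'] : exists s' : seq ((rat * rat) * T),
    rn (\sum_(p <- s) p.1 *: e p.2 - \sum_(p <- s') ratc p.1 *: e p.2) < d / 2.
  exists (\sum_(p <- s') ratc p.1 *: e p.2); first by exists s'.
  apply: le_lt_trans (rn_triangle (\sum_(p <- s) p.1 *: e p.2) _ _) _.
  by rewrite [ltRHS]splitr ltrD.
elim: s (d / 2) d2 {vs} => [|[c t] s IH] b b0.
  by exists [::]; rewrite !big_nil subrr rn0.
have b2 : 0 < b / 2 by rewrite divr_gt0.
have [s' hs'] := IH _ b2.
have t1 : 0 < rn (e t) + 1 by rewrite ltr_wpDl ?rn_ge0.
have [p hp] := ratc_approx c (divr_gt0 b2 t1).
exists ((p, t) :: s'); rewrite !big_cons /= opprD addrACA.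
apply: le_lt_trans (rnD _ _) _; rewrite [b]splitr; apply: ltrD => //.
rewrite -scalerBl rnZ; apply: le_lt_trans (_ : _ <= rn (c - ratc p) * (rn (e t) + 1)) _.
  by rewrite ler_wpM2l ?rn_ge0// lerDl.
by rewrite -ltr_pdivlMr.
Qed.

End separability.

Lemma l2_separable (R : realType) (S : countType) : separable (l2 R S).
Proof.
apply: (@dense_span_separable R (l2 R S) S (@delta R S)).
apply/dense_rnP => f e e0; have [s us hs] := l2_approx f e0.
exists (fsupp s (val f)) => //; exists [seq (val f x, x) | x <- s] => //.
by rewrite big_map -fsupp_delta.
Qed.

(** * Berg's technique *)

Section berg_kernel.
Variables (R : realType) (a m : int) (L : nat) (phi psi : int -> R).
Hypotheses (L0 : (0 < L)%N) (Lm : L%:Z <= m).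
Hypotheses (phi01 : forall x, 0 <= phi x <= 1)
  (psi2 : forall x, psi x ^+ 2 = phi x * (1 - phi x)) (psi1 : forall x, `|psi x| <= 1)
  (phi0 : forall x, x <= a -> phi x = 0) (phi1 : forall x, a + L%:Z <= x -> phi x = 1).

Lemma sum_indicator (V : seq int) (c : int) (F : int -> R) : uniq V ->
  \sum_(y <- V) (y == c)%:R * F y = (c \in V)%:R * F c.
Proof.
move=> uV; case: (boolP (c \in V)) => cV.
  rewrite (bigD1_seq c)//= eqxx big1 ?addr0// => y /negPf ->.
  by rewrite mul0r.
rewrite big_seq big1 ?mul0r// => y yV; case: eqP => [yc|]; last by rewrite mul0r.
by rewrite -yc yV in cV.
Qed.

(* With [phi = al ^ 2], [psi = al * be] and [al ^ 2 + be ^ 2 = 1], the projection onto the span of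
   [al x e_x + be x e_(x+m)] for [x] in the ramp [a, a + L] and of [e_x] for [x] between the two
   ramps; [phi (x - m)] accounts for the second ramp, near [a + m]. *)
Definition bergk (x y : int) : R :=
  (y == x)%:R * (phi x - phi (x - m)) + (y == x + m)%:R * psi x
  + (y == x - m)%:R * psi (x - m).

Lemma psi_out x : (x <= a) || (a + L%:Z <= x) -> psi x = 0.
Proof.
move=> h; apply/eqP; rewrite -sqrf_eq0 psi2.
by case/orP: h => [/phi0|/phi1] ->; rewrite ?mul0r ?subrr ?mulr0.
Qed.

Lemma bergkC x y : bergk x y = bergk y x.
Proof.
rewrite /bergk.
case: (eqVneq x y) => [->//|xy].
case: (eqVneq y (x + m)) => [h1|h1].
  have -> : (y == x - m) = false by lia.
  have -> : (x == y + m) = false by lia.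
  have -> : (x == y - m) by lia.
  have -> : y - m = x by lia.
  by rewrite !mul0r !add0r addr0.
case: (eqVneq y (x - m)) => [h2|h2].
  have -> : (x == y + m) by lia.
  have -> : (x == y - m) = false by lia.
  by rewrite -h2 !mul0r !add0r addr0.
have -> : (x == y + m) = false by lia.
have -> : (x == y - m) = false by lia.
by rewrite !mul0r !addr0.
Qed.

Lemma bergk_supp x y : ~~ ((a < x) && (x < a + m + L%:Z)) -> bergk x y = 0.
Proof.
move=> hx; rewrite /bergk.
have -> : psi x = 0 by apply: psi_out; lia.
have -> : psi (x - m) = 0 by apply: psi_out; lia.
have -> : phi x - phi (x - m) = 0.
  have [xa|xa] := leP x a; first by rewrite !phi0 ?subrr//; lia.
  by rewrite !phi1 ?subrr//; lia.
by rewrite !mulr0 !addr0.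
Qed.

Lemma bergk_core x y : a + L%:Z <= x -> x <= a + m -> bergk x y = (y == x)%:R.
Proof.
move=> h1 h2; rewrite /bergk.
have -> : psi x = 0 by apply: psi_out; rewrite h1 orbT.
have -> : psi (x - m) = 0 by apply: psi_out; apply/orP; left; lia.
rewrite phi1// phi0 ?subr0; last by lia.
by rewrite mulr1 !mulr0 !addr0.
Qed.

(** A row of [bergk] has entries only at shifts by 0, [m] and [-m], so a row of its square has
    entries only at shifts by 0, [m], [-m], [2m] and [-2m]; each is compared separately. *)
Lemma bergk_idem (V : seq int) x z : uniq V ->
  (forall y, a < y -> y < a + m + L%:Z -> y \in V) ->
  \sum_(y <- V) bergk x y * bergk y z = bergk x z.
Proof.
move=> uV hV.
transitivity ((phi x - phi (x - m)) * bergk x z + psi x * bergk (x + m) z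
    + psi (x - m) * bergk (x - m) z).
  transitivity (\sum_(y <- V) ((y == x)%:R * ((phi x - phi (x - m)) * bergk y z) +
      (y == x + m)%:R * (psi x * bergk y z) +
      (y == x - m)%:R * (psi (x - m) * bergk y z))).
    by apply: eq_bigr => y _; rewrite {1}/bergk; ring.
  rewrite !big_split /= !(sum_indicator _ (fun y => _ * _))//.
  (* A coefficient attached to an index outside [V] is already zero, so the truncation to [V] loses
     nothing. *)
  have out y c : (y \notin V -> c = 0) -> (y \in V)%:R * (c * bergk y z) = c * bergk y z.
    by case: (y \in V) => h; rewrite ?mul1r// h// !mul0r ?mulr0.
  rewrite !out// => yV.
  - by apply: psi_out; have := hV (x - m); case: (x - m \in V) yV => // _ h; lia.
  - by apply: psi_out; have := hV (x + m); case: (x + m \in V) yV => // _ h; lia.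
  - have hx : ~~ ((a < x) && (x < a + m + L%:Z)).
      by apply: contra yV => /andP[]; exact: hV.
    have := bergk_supp x hx; rewrite /bergk eqxx.
    have -> : (x == x + m) = false by lia.
    have -> : (x == x - m) = false by lia.
    by rewrite mul1r !mul0r !addr0.
(* Since [L <= m], the ramps at [a] and [a + m] do not overlap. [F1] to [F4] express this and cancel
   the mixed terms; what remains is [psi^2 = phi (1 - phi)]. *)
have F1 y : phi (y - m) * (1 - phi y) = 0.
  have [ya|ya] := leP (y - m) a; first by rewrite phi0// mul0r.
  by rewrite (phi1 (x := y)) ?subrr ?mulr0//; lia.
have F2 y : psi y * phi (y - m) = 0.
  have [ya|ya] := leP (a + L%:Z) y; first by rewrite psi_out ?mul0r// ya orbT.
  by rewrite phi0 ?mulr0//; lia.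
have F3 y : psi y * (1 - phi (y + m)) = 0.
  have [ya|ya] := leP y a; first by rewrite psi_out ?mul0r// ya.
  by rewrite phi1 ?subrr ?mulr0//; lia.
have F4 y : psi y * psi (y + m) = 0.
  have [ya|ya] := leP y a; first by rewrite psi_out ?mul0r// ya.
  by rewrite (psi_out (x := y + m)) ?mulr0//; apply/orP; right; lia.
have P2 := psi2 x; have P2' := psi2 (x - m).
have F1x := F1 x; have F2x := F2 x; have F3x := F3 x; have F4x := F4 x.
have F2' := F2 (x - m); have F3' := F3 (x - m); have F4' := F4 (x - m - m).
rewrite ?subrK in F3' F4'.
rewrite /bergk !addrK !subrK.
have [->|z0] := eqVneq z x.
  have -> : (x == x + m) = false by lia.
  have -> : (x == x - m) = false by lia.
  have -> : (x == x + m + m) = false by lia.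
  have -> : (x == x - m - m) = false by lia.
  rewrite ?eqxx /=; nra.
have [->|z1] := eqVneq z (x + m).
  have -> : (x + m == x - m) = false by lia.
  have -> : (x + m == x + m + m) = false by lia.
  have -> : (x + m == x - m - m) = false by lia.
  rewrite ?eqxx /=; nra.
have [->|z2] := eqVneq z (x - m).
  have -> : (x - m == x + m + m) = false by lia.
  have -> : (x - m == x - m - m) = false by lia.
  rewrite ?eqxx /=; nra.
have [z3|z3] := eqVneq z (x + m + m).
  have -> : (z == x - m - m) = false by lia.
  rewrite /=; nra.
have [z4|z4] := eqVneq z (x - m - m).
  rewrite /=; nra.
by rewrite /=; ring.
Qed.

Lemma sum_indicator_le (V : seq int) (c : int) (r : R) : uniq V ->
  \sum_(y <- V) `|(y == c)%:R * r| <= `|r|.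
Proof.
move=> uV.
have -> : \sum_(y <- V) `|(y == c)%:R * r| = \sum_(y <- V) (y == c)%:R * `|r|.
  by apply: eq_bigr => y _; rewrite normrM normr_nat.
rewrite (sum_indicator _ (fun=> `|r|))//.
by case: (c \in V); rewrite ?mul1r ?mul0r.
Qed.

Lemma sum3_indicator_le (V : seq int) (c1 c2 c3 : int) (r1 r2 r3 b1 b2 b3 : R) : uniq V ->
  `|r1| <= b1 -> `|r2| <= b2 -> `|r3| <= b3 ->
  \sum_(y <- V) `|(y == c1)%:R * r1 + (y == c2)%:R * r2 + (y == c3)%:R * r3| <= b1 + b2 + b3.
Proof.
move=> uV h1 h2 h3.
apply: (@le_trans _ _ (\sum_(y <- V) (`|(y == c1)%:R * r1| + `|(y == c2)%:R * r2| +
    `|(y == c3)%:R * r3|))).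
  apply: ler_sum => y _; apply: le_trans (ler_normD _ _) _.
  by rewrite lerD2r ler_normD.
rewrite !big_split /=.
apply: lerD; [apply: lerD|]; by apply: le_trans (sum_indicator_le _ _ uV) _.
Qed.

Lemma bergk_row (V : seq int) x : uniq V -> \sum_(y <- V) `|bergk x y| <= 3.
Proof.
move=> uV; have -> : (3 : R) = 1 + 1 + 1 by ring.
apply: sum3_indicator_le => //.
have := phi01 x; have := phi01 (x - m); move=> /andP[? ?] /andP[? ?].
by rewrite ler_norml; apply/andP; split; lra.
Qed.

Section displacement.
Variables (g : int -> int) (C : nat) (K : R).
Hypotheses (ginj : injective g) (gC : forall x, (absz (g x - x) <= C)%N)
  (gper : forall x, a - C%:Z <= x -> x <= a + L%:Z + C%:Z -> g (x + m) = g x + m).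
Hypotheses (K0 : 0 <= K)
  (phiK : forall x y, `|phi x - phi y| <= K * (absz (x - y))%:R)
  (psiK : forall x y, `|psi x - psi y| <= K * (absz (x - y))%:R).

Lemma bergk_row_disp (V : seq int) x : uniq V ->
  \sum_(y <- V) `|bergk (g x) (g y)| <= 3.
Proof.
move=> uV; have := @bergk_row [seq g y | y <- V] (g x).
by rewrite big_map; apply; rewrite map_inj_uniq.
Qed.

(** Where [psi (g x)] is nonzero, [g x] is on the ramp, so [x] is within [C] of it and there [g]
    commutes with the translation by [m]. *)
Let psi_shift x y : (g y == g x + m)%:R * psi (g x) = (y == x + m)%:R * psi (g x).
Proof.
have [h|h] := boolP ((g x <= a) || (a + L%:Z <= g x)); first by rewrite psi_out// !mulr0.
have gx := gC x; rewrite -gper; [|lia|lia].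
by rewrite (inj_eq ginj).
Qed.

Let psi_shift' x y : (g y == g x - m)%:R * psi (g x - m) = (y == x - m)%:R * psi (g (x - m)).
Proof.
have [h|h] := boolP ((g x - m <= a) || (a + L%:Z <= g x - m)).
  rewrite psi_out// mulr0.
  (* If [g (x - m)] were on the ramp, [g] would commute with the translation at [x - m] and
     [g x - m] would be on the ramp too. *)
  have [h'|h'] := boolP ((g (x - m) <= a) || (a + L%:Z <= g (x - m))).
    by rewrite psi_out// mulr0.
  have g1 := gC (x - m).
  have g2 := @gper (x - m); rewrite subrK in g2.
  by rewrite g2 in h; lia.
have g1 := gC x; have g2 := @gper (x - m); rewrite subrK in g2.
have g3 : g x = g (x - m) + m by apply: g2; lia.
rewrite g3 addrK (inj_eq ginj).
by [].
Qed.

(** The three diagonals stay aligned under conjugation by [g], so only the slow variation of [phi]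
    and [psi] counts: two displacements on the main diagonal and one on each of the others, hence
    the factor 4. *)
Lemma bergk_disp (V : seq int) x : uniq V ->
  \sum_(y <- V) `|bergk (g x) (g y) - bergk x y| <= 4 * (K * C%:R).
Proof.
move=> uV.
have KC z w : (absz (z - w) <= C)%N -> K * (absz (z - w))%:R <= K * C%:R.
  by move=> h; rewrite ler_wpM2l// ler_nat.
apply: (@le_trans _ _ (\sum_(y <- V) `|(y == x)%:R * (phi (g x) - phi (g x - m) - (phi x - phi (x - m)))
   + (y == x + m)%:R * (psi (g x) - psi x)
   + (y == x - m)%:R * (psi (g (x - m)) - psi (x - m))|)).
  apply: ler_sum => y _; rewrite /bergk psi_shift psi_shift' (inj_eq ginj).
  by rewrite le_eqVlt; apply/orP; left; apply/eqP; congr (`|_|); ring.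
have -> : 4 * (K * C%:R) = (K * C%:R + K * C%:R) + K * C%:R + K * C%:R by ring.
apply: sum3_indicator_le => //.
- have -> : phi (g x) - phi (g x - m) - (phi x - phi (x - m)) =
    (phi (g x) - phi x) - (phi (g x - m) - phi (x - m)) by ring.
  apply: le_trans (ler_normB _ _) _; apply: lerD.
    by apply: le_trans (phiK _ _) _; apply: KC.
  by apply: le_trans (phiK _ _) _; apply: KC; have := gC x; lia.
- by apply: le_trans (psiK _ _) _; apply: KC.
- by apply: le_trans (psiK _ _) _; apply: KC.
Qed.

End displacement.
End berg_kernel.

(** * A Lipschitz profile for the rotation *)

Section profile.
Variable R : realType.

(* Rational parametrisation of the quarter circle, so that no trigonometry is needed. *)
Definition al (t : R) := 2 * t / (1 + t ^+ 2).
Definition be (t : R) := (1 - t ^+ 2) / (1 + t ^+ 2).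

Lemma one_sqr_gt0 (t : R) : 0 < 1 + t ^+ 2.
Proof. by rewrite ltr_pwDl// sqr_ge0. Qed.

Lemma al_be (t : R) : al t ^+ 2 + be t ^+ 2 = 1.
Proof. by rewrite /al /be; field; rewrite lt0r_neq0// one_sqr_gt0. Qed.

Lemma al01 t : 0 <= t <= 1 -> 0 <= al t <= 1.
Proof.
move=> /andP[t0 t1]; rewrite /al ler_pdivrMr ?one_sqr_gt0// mul1r.
rewrite divr_ge0 ?(ltW (one_sqr_gt0 t)) ?mulr_ge0//=.
by have := sqr_ge0 (1 - t); nra.
Qed.

Lemma be01 t : 0 <= t <= 1 -> 0 <= be t <= 1.
Proof.
move=> /andP[t0 t1]; rewrite /be ler_pdivrMr ?one_sqr_gt0// mul1r.
rewrite divr_ge0 ?(ltW (one_sqr_gt0 t))//=; nra.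
Qed.

Lemma al_lip s t : 0 <= s <= 1 -> 0 <= t <= 1 -> `|al s - al t| <= 2 * `|s - t|.
Proof.
move=> /andP[s0 s1] /andP[t0 t1].
have hs := one_sqr_gt0 s; have ht := one_sqr_gt0 t.
have -> : al s - al t = (s - t) * (2 * (1 - s * t) / ((1 + s ^+ 2) * (1 + t ^+ 2))).
  by rewrite /al; field; rewrite !lt0r_neq0.
rewrite normrM mulrC ler_wpM2r// ger0_norm.
  by rewrite ler_pdivrMr ?mulr_gt0//; nra.
by rewrite divr_ge0 ?mulr_ge0//; nra.
Qed.

Lemma be_lip s t : 0 <= s <= 1 -> 0 <= t <= 1 -> `|be s - be t| <= 4 * `|s - t|.
Proof.
move=> /andP[s0 s1] /andP[t0 t1].
have hs := one_sqr_gt0 s; have ht := one_sqr_gt0 t.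
have -> : be s - be t = (t - s) * (2 * (s + t) / ((1 + s ^+ 2) * (1 + t ^+ 2))).
  by rewrite /be; field; rewrite !lt0r_neq0.
rewrite normrM mulrC (distrC s t) ler_wpM2r// ger0_norm.
  by rewrite ler_pdivrMr ?mulr_gt0//; nra.
by rewrite divr_ge0 ?mulr_ge0//; nra.
Qed.

Lemma mul_lip (a a' b b' d e : R) : 0 <= a <= 1 -> 0 <= a' <= 1 -> 0 <= b <= 1 ->
  0 <= b' <= 1 -> `|a - a'| <= d -> `|b - b'| <= e -> `|a * b - a' * b'| <= d + e.
Proof.
move=> /andP[a0 a1] /andP[a0' a1'] /andP[b0 b1] /andP[b0' b1'] h1 h2.
have -> : a * b - a' * b' = (a - a') * b + a' * (b - b') by ring.
apply: le_trans (ler_normD _ _) _; rewrite !normrM (ger0_norm b0) (ger0_norm a0').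
by apply: lerD; [apply: le_trans h1; rewrite ler_piMr|apply: le_trans h2; rewrite ler_piMl].
Qed.

Variables (a : int) (L : nat).
Hypothesis L0 : (0 < L)%N.

Definition ramp (x : int) : R :=
  if x <= a then 0 else if a + L%:Z <= x then 1 else (absz (x - a))%:R / L%:R.

Lemma ramp01 x : 0 <= ramp x <= 1.
Proof.
rewrite /ramp; case: (leP x a) => h1; first by rewrite lexx ler01.
case: (leP (a + L%:Z) x) => h2; first by rewrite ler01 lexx.
by rewrite divr_ge0//= ler_pdivrMr ?ltr0n// mul1r ler_nat; lia.
Qed.

Lemma ramp_lip x y : `|ramp x - ramp y| <= (absz (x - y))%:R / L%:R.
Proof.
have Lr : 0 < L%:R :> R by rewrite ltr0n.
have E z : ramp z * L%:R = (if z <= a then 0%N else if a + L%:Z <= z then L else absz (z - a))%:R.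
  rewrite /ramp; case: (leP z a) => h1; first by rewrite mul0r.
  case: (leP (a + L%:Z) z) => h2; first by rewrite mul1r.
  by rewrite mulfVK// lt0r_neq0.
rewrite ler_pdivlMr// -[X in _ * X](gtr0_norm Lr) -normrM mulrBl !E.
set n1 := (if x <= a then _ else _); set n2 := (if y <= a then _ else _).
have h : (n1 <= n2 + absz (x - y))%N && (n2 <= n1 + absz (x - y))%N.
  by rewrite /n1 /n2; case: (leP x a) => ?; case: (leP y a) => ?;
    case: (leP (a + L%:Z) x) => ?; case: (leP (a + L%:Z) y) => ?; lia.
move/andP: h => []; rewrite -!(ler_nat R) !natrD => h1 h2.
by rewrite ler_norml; apply/andP; split; lra.
Qed.

Definition bphi x := al (ramp x) ^+ 2.
Definition bpsi x := al (ramp x) * be (ramp x).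

Lemma bphi01 x : 0 <= bphi x <= 1.
Proof.
by have /andP[h1 h2] := al01 (ramp01 x); rewrite /bphi sqr_ge0 expr_le1.
Qed.

Lemma bpsi2 x : bpsi x ^+ 2 = bphi x * (1 - bphi x).
Proof. by rewrite /bpsi /bphi exprMn -[X in X - _](al_be (ramp x)); ring. Qed.

Lemma bpsi1 x : `|bpsi x| <= 1.
Proof.
have /andP[h1 h2] := al01 (ramp01 x); have /andP[h3 h4] := be01 (ramp01 x).
rewrite /bpsi ger0_norm; [nra|exact: mulr_ge0].
Qed.

Lemma bphi0 x : x <= a -> bphi x = 0.
Proof. by rewrite /bphi /ramp => ->; rewrite /al mulr0 mul0r expr0n. Qed.

Lemma bphi1 x : a + L%:Z <= x -> bphi x = 1.
Proof.
move=> h; rewrite /bphi /ramp; have -> : (x <= a) = false by lia.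
by rewrite h /al; field.
Qed.

Lemma bphi_lip x y : `|bphi x - bphi y| <= 6 / L%:R * (absz (x - y))%:R.
Proof.
have r := ramp_lip x y.
have h := al_lip (ramp01 x) (ramp01 y).
rewrite /bphi !expr2; apply: le_trans (mul_lip _ _ _ _ h h) _; rewrite ?al01 ?ramp01//.
have -> : 6 / L%:R * (absz (x - y))%:R = 6 * ((absz (x - y))%:R / L%:R) :> R by ring.
have := normr_ge0 (ramp x - ramp y); lra.
Qed.

(** Here 6 is 2 + 4, from the Lipschitz constants of [al] and [be]. For [bphi] 4 would do, but
    [bergk_disp] takes one constant for both. *)
Lemma bpsi_lip x y : `|bpsi x - bpsi y| <= 6 / L%:R * (absz (x - y))%:R.
Proof.
have r := ramp_lip x y.
have h := al_lip (ramp01 x) (ramp01 y); have h' := be_lip (ramp01 x) (ramp01 y).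
rewrite /bpsi; apply: le_trans (mul_lip _ _ _ _ h h') _; rewrite ?al01 ?be01 ?ramp01//.
have -> : 6 / L%:R * (absz (x - y))%:R = 6 * ((absz (x - y))%:R / L%:R) :> R by ring.
have := normr_ge0 (ramp x - ramp y); lra.
Qed.

End profile.

(** * Tensor powers of a kernel on the integers *)

Section tensor_kernel.
Variable R : realType.
Implicit Types (p : int -> int -> R) (x y z : seq int) (V : seq int).

(** The kernel of the direct sum of all tensor powers of the operator with kernel [p], block
    diagonal with respect to length. *)
Fixpoint tker p x y : R :=
  match x, y with
  | [::], [::] => 1
  | a :: x', b :: y' => p a b * tker p x' y'
  | _, _ => 0
  end.

Fixpoint tups V k : seq (seq int) :=
  if k is k'.+1 then [seq b :: y | b <- V, y <- tups V k'] else [:: [::]].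

Lemma mem_tups V k y : (y \in tups V k) = (size y == k) && all [in V] y.
Proof.
elim: k y => [|k IH] [|b y] //=.
  by apply/negP => /allpairsP[[c z] []].
rewrite eqSS andbCA -IH; apply/allpairsP/andP.
  by move=> [[c z] [/= cV zV [-> ->]]].
by move=> [bV yV]; exists (b, y).
Qed.

Lemma tups_uniq V k : uniq V -> uniq (tups V k).
Proof.
move=> uV; elim: k => [//|k IH] /=; apply: allpairs_uniq => //.
by move=> [c z] [c' z'] _ _ /= [-> ->].
Qed.

Lemma tker_size p x y : size x != size y -> tker p x y = 0.
Proof.
elim: x y => [|a x IH] [|b y] //=; rewrite eqSS => /IH ->.
by rewrite mulr0.
Qed.

Lemma tkerC p : (forall a b, p a b = p b a) -> forall x y, tker p x y = tker p y x.
Proof. by move=> pC; elim=> [|a x IH] [|b y] //=; rewrite pC IH. Qed.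

Lemma tker_map p (g : int -> int) x y :
  tker p (map g x) (map g y) = tker (fun a b => p (g a) (g b)) x y.
Proof. by elim: x y => [|a x IH] [|b y] //=; rewrite IH. Qed.

Lemma tker_supp p V x y : (forall a b, a \notin V -> p a b = 0) ->
  ~~ all [in V] x -> tker p x y = 0.
Proof.
move=> p0; elim: x y => [|a x IH] [|b y] //=.
by rewrite negb_and => /orP[/p0 ->|/IH ->]; rewrite ?mul0r ?mulr0.
Qed.

Lemma tker_core p x y : (forall a b, a \in x -> p a b = (b == a)%:R) ->
  tker p x y = (y == x)%:R.
Proof.
elim: x y => [|a x IH] [|b y] //= h.
rewrite h ?inE ?eqxx// IH => [|c d cx]; last by rewrite h// inE cx orbT.
by rewrite -natrM mulnb eqseq_cons.
Qed.

Lemma sum_tups (V : seq int) k (F : seq int -> R) :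
  \sum_(y <- tups V k.+1) F y = \sum_(b <- V) \sum_(y <- tups V k) F (b :: y).
Proof.
rewrite /= big_flatten /= big_map; apply: eq_bigr => b _.
by rewrite big_map.
Qed.

Lemma tker_idem p V x z : (forall a c, \sum_(b <- V) p a b * p b c = p a c) ->
  \sum_(y <- tups V (size x)) tker p x y * tker p y z = tker p x z.
Proof.
move=> pp; elim: x z => [|a x IH] z.
  by rewrite big_seq1 /= mul1r; case: z.
rewrite sum_tups /=; case: z => [|c z].
  by rewrite big1// => b _; rewrite big1// => y _; rewrite mulr0.
rewrite -pp mulr_suml; apply: eq_bigr => b _.
rewrite -IH mulr_sumr; apply: eq_bigr => y _ /=; ring.
Qed.

Lemma tker_row p V x :
  (forall U a, uniq U -> \sum_(b <- U) `|p a b| <= 3) -> uniq V ->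
  \sum_(y <- tups V (size x)) `|tker p x y| <= 3 ^+ size x.
Proof.
move=> p3 uV; elim: x => [|a x IH]; first by rewrite big_seq1 /= normr1.
rewrite sum_tups /= exprS.
under eq_bigr do under eq_bigr do rewrite normrM.
under eq_bigr do rewrite -mulr_sumr.
rewrite -mulr_suml; apply: ler_pM => //; last exact: p3.
  by rewrite sumr_ge0.
by rewrite sumr_ge0.
Qed.

(** Change one tensor factor at a time and bound each remaining factor by its row sum, at most 3.
    The exponential growth comes from using row sums instead of operator norms. *)
Lemma tker_diff_row p p' (d : R) V x : 0 <= d ->
  (forall U a, uniq U -> \sum_(b <- U) `|p a b| <= 3) ->
  (forall U a, uniq U -> \sum_(b <- U) `|p' a b| <= 3) ->
  (forall U a, uniq U -> \sum_(b <- U) `|p' a b - p a b| <= d) -> uniq V ->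
  \sum_(y <- tups V (size x)) `|tker p' x y - tker p x y| <=
    (size x)%:R * 3 ^+ size x * d.
Proof.
move=> d0 p3 p3' pd uV; elim: x => [|a x IH].
  by rewrite big_seq1 /= subrr normr0 !mul0r.
rewrite sum_tups /=.
apply: (@le_trans _ _ (\sum_(b <- V) \sum_(y <- tups V (size x))
   (`|p' a b - p a b| * `|tker p' x y| + `|p a b| * `|tker p' x y - tker p x y|))).
  apply: ler_sum => b _; apply: ler_sum => y _.
  have -> : p' a b * tker p' x y - p a b * tker p x y =
     (p' a b - p a b) * tker p' x y + p a b * (tker p' x y - tker p x y) by ring.
  by apply: le_trans (ler_normD _ _) _; rewrite !normrM.
under eq_bigr do rewrite big_split /= -!mulr_sumr.
rewrite big_split /= -!mulr_suml.
have h1 := tker_row x p3' uV; have h2 := pd V a uV; have h3 := p3 V a uV.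
have e1 : 1 <= 3 ^+ size x :> R by rewrite exprn_ege1// ler1n.
apply: (@le_trans _ _ (d * 3 ^+ size x + 3 * ((size x)%:R * 3 ^+ size x * d))).
  by apply: lerD; apply: ler_pM => //; rewrite sumr_ge0.
rewrite exprS (_ : (size x).+1%:R = (size x)%:R + 1 :> R) ?natr1//.
set E : R := 3 ^+ size x; set k : R := (size x)%:R.
have dE : 0 <= d * E by rewrite mulr_ge0// exprn_ge0.
rewrite -subr_ge0 (_ : _ - _ = d * E + d * E) ?addr_ge0//.
by ring.
Qed.

Variable n : nat.

Definition tkern p x y : R := if (size x <= n)%N then tker p x y else 0.

Definition tlists V : seq (seq int) := flatten [seq tups V k | k <- iota 0 n.+1].

Lemma mem_tlists V x : (x \in tlists V) = (size x <= n)%N && all [in V] x.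
Proof.
apply/flatten_mapP/andP.
  by move=> [k]; rewrite mem_iota add0n ltnS mem_tups => kn /andP[/eqP -> ->].
move=> [xn xV]; exists (size x); first by rewrite mem_iota add0n ltnS.
by rewrite mem_tups eqxx.
Qed.

Lemma tlists_uniq V : uniq V -> uniq (tlists V).
Proof.
move=> uV; rewrite /tlists; elim: (iota 0 n.+1) (iota_uniq 0 n.+1) => //= k s IH /andP[ks us].
rewrite cat_uniq tups_uniq// IH// andbT; apply/hasPn => x /flatten_mapP[j js].
rewrite !mem_tups => /andP[/eqP sx _]; apply/negP => /andP[/eqP sx' _].
by rewrite -sx' sx js in ks.
Qed.

Lemma tkernC p : (forall a b, p a b = p b a) -> forall x y, tkern p x y = tkern p y x.
Proof.
move=> pC x y; rewrite /tkern; have [sxy|sxy] := eqVneq (size x) (size y).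
  by rewrite sxy tkerC.
by rewrite tker_size// tker_size 1?eq_sym// !if_same.
Qed.

Lemma tkern_supp p V x y : (forall a b, a \notin V -> p a b = 0) ->
  x \notin tlists V -> tkern p x y = 0.
Proof.
move=> p0; rewrite mem_tlists negb_and /tkern; case: ifP => //= _.
exact: tker_supp.
Qed.

Lemma tkern_idem p V x z : uniq V -> (forall a c, \sum_(b <- V) p a b * p b c = p a c) ->
  \sum_(y <- tlists V) tkern p x y * tkern p y z = tkern p x z.
Proof.
move=> uV pp; rewrite /tkern; case: (boolP (size x <= n)%N) => xn; last by rewrite big1// => y _; rewrite mul0r.
rewrite -(tker_idem x z pp) (@big_uniq_sub _ _ _ _ (tups V (size x)))//.
- rewrite big_seq [RHS]big_seq; apply: eq_bigr => y; rewrite mem_tups => /andP[/eqP -> _].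
  by rewrite xn.
- exact: tups_uniq.
- exact: tlists_uniq.
- by move=> y; rewrite mem_tups mem_tlists => /andP[/eqP -> ->]; rewrite xn.
- move=> y; rewrite mem_tlists mem_tups => /andP[_ ->]; rewrite andbT => sy.
  by rewrite tker_size ?mul0r// eq_sym.
Qed.

Lemma tkern_diff p (g : int -> int) (d : R) (U : seq (seq int)) x : 0 <= d ->
  (forall U a, uniq U -> \sum_(b <- U) `|p a b| <= 3) ->
  (forall U a, uniq U -> \sum_(b <- U) `|p (g a) (g b)| <= 3) ->
  (forall U a, uniq U -> \sum_(b <- U) `|p (g a) (g b) - p a b| <= d) -> uniq U ->
  \sum_(y <- U) `|tkern p (map g x) (map g y) - tkern p x y| <= n%:R * 3 ^+ n * d.
Proof.
move=> d0 p3 pg3 pd uU; rewrite /tkern size_map; case: (boolP (size x <= n)%N) => xn; last first.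
  rewrite big1 => [|y _]; last by rewrite subrr normr0.
  by rewrite !mulr_ge0// exprn_ge0.
under eq_bigr do rewrite tker_map.
(* Members of [U] whose length differs from that of [x] contribute nothing; the others are words
   over the letters occurring in [U]. *)
pose V := undup (flatten U).
apply: (@le_trans _ _ (\sum_(y <- tups V (size x))
    `|tker (fun a b => p (g a) (g b)) x y - tker p x y|)).
  have -> : \sum_(y <- U) `|tker (fun a b => p (g a) (g b)) x y - tker p x y| =
      \sum_(y <- [seq y <- U | size y == size x])
        `|tker (fun a b => p (g a) (g b)) x y - tker p x y|.
    rewrite big_filter [RHS]big_mkcond; apply: eq_bigr => y _.
    case: ifPn => // sy; rewrite !tker_size 1?eq_sym//.
    by rewrite subrr normr0.
  apply: sum_uniq_le => //; [exact: filter_uniq|exact/tups_uniq/undup_uniq|].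
  move=> y; rewrite mem_filter mem_tups => /andP[-> yU] /=.
  by apply/allP => a ay; rewrite mem_undup; apply/flattenP; exists y.
apply: le_trans (tker_diff_row x d0 p3 pg3 pd (undup_uniq _)) _.
rewrite ler_wpM2r//; apply: ler_pM; rewrite ?ler_nat//.
by rewrite ler_eXn2l// ltr1n.
Qed.

End tensor_kernel.

Definition irange (lo : int) (k : nat) : seq int := [seq lo + i%:Z | i <- iota 0 k].

Lemma irange_uniq lo k : uniq (irange lo k).
Proof.
rewrite map_inj_uniq ?iota_uniq// => i j /addrI /eqP.
by rewrite eqz_nat => /eqP.
Qed.

Lemma mem_irange lo k x : (x \in irange lo k) = (lo <= x) && (x < lo + k%:Z).
Proof.
apply/mapP/andP.
  by move=> [k']; rewrite mem_iota => /andP[_ h] ->; lia.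
move=> [h1 h2]; exists (absz (x - lo)); last by lia.
by rewrite mem_iota; lia.
Qed.

(** * Finite-rank projections from recurrence *)

Section berg_approximation.
Variables (R : realType) (G : groupType) (s : G -> int -> int).
Hypotheses (s_inj : forall g, injective (s g))
  (s_bd : forall g, exists C : nat, forall x, (absz (s g x - x) <= C)%N)
  (s_rec : forall (F : seq G) (N : nat) (j0 : int), exists L : nat, forall b : int,
     exists2 c : int, b <= c <= b + L%:Z &
       forall g i, g \in F -> (absz i <= N)%N -> s g (c + i) - (c + i) = s g (j0 + i) - (j0 + i)).

Lemma displacement_bound (F : seq G) :
  exists C : nat, forall g x, g \in F -> (absz (s g x - x) <= C)%N.
Proof.
elim: F => [|g F [C hC]]; first by exists 0%N.
have [D hD] := s_bd g; exists (maxn C D) => h x.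
rewrite inE => /orP[/eqP ->|/hC hF]; first by rewrite (leq_trans (hD x)) ?leq_maxr.
by rewrite (leq_trans (hF x)) ?leq_maxl.
Qed.

(** One stage of the construction. [N] and [n] prescribe the core on which the projection is the
    identity; [M] records how far its support reaches, so that the next stage can include it in its
    core. *)
Lemma berg_approx (F : seq G) (N n : nat) (e : R) : 0 < e ->
  exists (M : nat) (W : seq (seq int)) (q : seq int -> seq int -> R),
  [/\ uniq W, forall x y, q x y = q y x,
      forall x y, x \notin W -> q x y = 0,
      forall x z, \sum_(y <- W) q x y * q y z = q x z &
   [/\ forall x y, (size x <= n)%N -> (forall a, a \in x -> absz a <= N)%N ->
          q x y = (y == x)%:R,
      forall x, x \in W -> (size x <= n)%N /\ (forall a, a \in x -> absz a <= M)%N &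
      forall g U x, g \in F -> uniq U ->
        \sum_(y <- U) `|q (map (s g) x) (map (s g) y) - q x y| <= e]].
Proof.
move=> e0; have [C hC] := displacement_bound F.
(* The factor [n 3^n] comes from [tkern_diff], 4 from [bergk_disp], and [6 / L] is the Lipschitz
   constant of the profile. *)
pose B : R := n%:R * 3 ^+ n * (4 * (6 * C%:R)).
have B0 : 0 <= B by rewrite !mulr_ge0// exprn_ge0.
pose L := (Num.truncn (B / e)).+1.
have LB : B / L%:R <= e.
  rewrite ler_pdivrMr ?ltr0n// mulrC -ler_pdivrMr//.
  by apply/ltW; rewrite truncnS_gt.
(* The first ramp ends to the left of [-N] and the second starts at [c = a + m], to the right of
   [N]; in between the projection is the identity. The pattern of radius [L + C] around [a] covers
   the ramp with a margin [C] for displacements. *)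
pose a : int := - (N + L + C + 1)%N%:Z.
have [Lr hLr] := s_rec F (L + C) a.
have [c hc cper] := hLr (a + (2 * (N + L + C + 1))%N%:Z).
pose m := c - a.
have L0 : (0 < L)%N by [].
have Lm : L%:Z <= m by rewrite /m; lia.
have gper g x : g \in F -> a - C%:Z <= x -> x <= a + L%:Z + C%:Z -> s g (x + m) = s g x + m.
  move=> gF h1 h2; have := cper g (x - a) gF; rewrite /m.
  have -> : c + (x - a) = x + (c - a) by ring.
  have -> : a + (x - a) = x by ring.
  by move=> h; have := h _; lia.
pose p := bergk m (@bphi R a L) (@bpsi R a L).
pose w := absz (m + L%:Z); pose V := irange a w.
have VP x : a < x -> x < a + m + L%:Z -> x \in V by move=> h1 h2; rewrite mem_irange /w; lia.
have p0 x y : x \notin V -> p x y = 0.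
  move=> xV; apply: (bergk_supp L0 Lm (@bpsi2 R a L) (@bphi0 R a L) (@bphi1 R a L L0)).
  by apply: contra xV => /andP[]; exact: VP.
have pC x y : p x y = p y x.
  exact: (bergkC _ _ L0 Lm).
have uV : uniq V by exact: irange_uniq.
have pp x z : \sum_(y <- V) p x y * p y z = p x z.
  exact: (bergk_idem L0 Lm (@bpsi2 R a L) (@bphi0 R a L) (@bphi1 R a L L0)).
exists (absz a + w)%N, (tlists n V), (tkern n p); split.
- exact: tlists_uniq.
- exact: tkernC.
- by move=> x y; exact: tkern_supp.
- by move=> x z; exact: tkern_idem.
split.
- move=> x y xn xN; rewrite /tkern xn; apply: tker_core => b d bx.
  apply: (bergk_core L0 Lm (@bpsi2 R a L) (@bphi0 R a L) (@bphi1 R a L L0)).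
    by have := xN b bx; lia.
  by have := xN b bx; rewrite /m; lia.
- move=> x; rewrite mem_tlists => /andP[xn /allP xV]; split=> // b /xV /=.
  rewrite mem_irange; lia.
move=> g U x gF uU.
apply: le_trans (_ : _ <= n%:R * 3 ^+ n * (4 * (6 / L%:R * C%:R))) _; last first.
  by apply: le_trans LB; rewrite /B le_eqVlt; apply/orP; left; apply/eqP; ring.
apply: tkern_diff => //.
- by move=> U' b uU'; apply: (bergk_row m (@bphi01 R a L L0) (@bpsi1 R a L L0)).
- move=> U' b uU'.
  by apply: (bergk_row_disp m (@bphi01 R a L L0) (@bpsi1 R a L L0)) => //; exact: s_inj.
move=> U' b uU'.
apply: (bergk_disp L0 Lm (@bpsi2 R a L) (@bphi0 R a L) (@bphi1 R a L L0)) => //.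
- by move=> z; exact: hC.
- by move=> z; exact: gper.
- exact: bphi_lip.
- exact: bpsi_lip.
Qed.

End berg_approximation.

(** * Almost invariant vectors *)

Section half_line_configurations.
Variables (R : realType) (w : nat).

Definition right_half (j : int) : bool := 0 <= j.

Definition conf (M : int -> bool) : Prop := forall j, (w < absz j)%N -> M j = right_half j.

Let k := (2 * w).+1.
Definition win := irange (- w%:Z) k.

Lemma mem_win j : (j \in win) = (absz j <= w)%N.
Proof. by rewrite mem_irange /k; apply/andP/idP => [[]|]; lia. Qed.

Definition conf_of (E : {ffun 'I_k -> bool}) (j : int) : bool :=
  if (absz j <= w)%N then E (inord (absz (j + w%:Z))) else right_half j.

Definition confs : seq (int -> bool) := [seq conf_of E | E <- enum {ffun 'I_k -> bool}].

Lemma conf_of_conf E : conf (conf_of E).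
Proof. by move=> j wj; rewrite /conf_of leqNgt wj. Qed.

Let pos (i : 'I_k) : int := - w%:Z + i%:Z.

Let conf_of_pos E i : conf_of E (pos i) = E i.
Proof.
rewrite /conf_of; have -> : (absz (pos i) <= w)%N by rewrite /pos; have := ltn_ord i; rewrite /k; lia.
congr (E _); apply: val_inj; rewrite /= inordK /pos; have := ltn_ord i; rewrite /k; lia.
Qed.

Lemma confsP M : M \in confs <-> conf M.
Proof.
split=> [/mapP[E _ ->]|cM]; first exact: conf_of_conf.
apply/mapP; exists [ffun i => M (pos i)]; first by rewrite mem_enum.
apply/funext => j; have [jw|jw] := leqP (absz j) w; last first.
  by rewrite /conf_of leqNgt jw cM.
have E : pos (inord (absz (j + w%:Z))) = j.
  by rewrite /pos inordK; [lia|rewrite /k; lia].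
by rewrite -[in RHS]E conf_of_pos ffunE E.
Qed.

Lemma confs_uniq : uniq confs.
Proof.
rewrite map_inj_uniq ?enum_uniq// => E E' EE'.
by apply/ffunP => i; rewrite -!conf_of_pos EE'.
Qed.

(** Distributivity over the independent sites of the window: inner products of product vectors
    factor into one two-term sum per site. *)
Lemma sum_confs (F : int -> bool -> R) :
  \sum_(M <- confs) \prod_(j <- win) F j (M j) = \prod_(j <- win) \sum_(b : bool) F j b.
Proof.
rewrite big_map.
have P (phi : int -> R) : \prod_(j <- win) phi j = \prod_(i < k) phi (pos i).
  by rewrite big_map -[iota 0 k]/(index_iota 0 k) big_mkord.
rewrite P bigA_distr_bigA /= big_enum /=; apply: eq_bigr => E _.
by rewrite P; apply: eq_bigr => i _; rewrite conf_of_pos.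
Qed.

Lemma size_win : size win = k.
Proof. by rewrite size_map size_iota. Qed.

Lemma win_uniq : uniq win. Proof. exact: irange_uniq. Qed.

End half_line_configurations.

Lemma bernoulli_le (R : realType) (d : R) n : 0 <= d <= 1 -> 1 - n%:R * d <= (1 - d) ^+ n.
Proof.
move=> /andP[d0 d1]; elim: n => [|n IH]; first by rewrite mul0r subr0 expr0.
rewrite exprS; apply: le_trans (_ : _ <= (1 - d) * (1 - n%:R * d)) _; last first.
  by rewrite ler_wpM2l// subr_ge0.
have : 0 <= n%:R * (d * d) by rewrite mulr_ge0// mulr_ge0.
rewrite -natr1; nra.
Qed.

Section product_vector.
Variables (R : realType) (n C : nat).
Hypothesis n0 : (0 < n)%N.

Definition wt (j : int) : R := (n - absz j)%N%:R / n%:R.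

Let n0R : 0 < n%:R :> R. Proof. by rewrite ltr0n. Qed.

Lemma wt01 j : 0 <= wt j <= 1.
Proof. by rewrite /wt divr_ge0//= ler_pdivrMr// mul1r ler_nat leq_subr. Qed.

Lemma wt_out j : (n <= absz j)%N -> wt j = 0.
Proof. by rewrite /wt -subn_eq0 => /eqP ->; rewrite mul0r. Qed.

Lemma wt_dist i j : (absz (i - j) <= C)%N -> `|wt i - wt j| <= C%:R / n%:R.
Proof.
move=> ij; rewrite /wt -mulrBl normrM [X in _ * X]ger0_norm ?invr_ge0// ler_pM2r ?invr_gt0//.
have h : (n - absz i <= n - absz j + C)%N && (n - absz j <= n - absz i + C)%N by lia.
move/andP: h => []; rewrite -!(ler_nat R) !natrD => h1 h2.
by rewrite ler_norml; apply/andP; split; lra.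
Qed.

Lemma wt_near0 j : (absz j <= C)%N -> 1 - C%:R / n%:R <= wt j.
Proof.
move=> jC; rewrite /wt lerBlDr -mulrDl ler_pdivlMr// mul1r -natrD ler_nat.
lia.
Qed.

Definition fac (t : R) (b b' : bool) : R := if b == b' then 1 else t.

Lemma fac_sq t b' : \sum_(b : bool) fac t b b' * fac t b b' = 1 + t ^+ 2.
Proof. by rewrite big_bool /fac; case: b' => /=; ring. Qed.

Lemma fac_ge0 t b b' : 0 <= t -> 0 <= fac t b b'.
Proof. by rewrite /fac; case: ifP. Qed.

(* The two half-line indicators can differ only when both sites are within C of 0, where the
   weights are close to 1. *)
Lemma fac_overlap i j : (absz (i - j) <= C)%N -> (2 * C <= n)%N ->
  let c := \sum_(b : bool) fac (wt i) b (right_half i) * fac (wt j) b (right_half j) in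
  0 <= c /\
  (1 + wt i ^+ 2) * (1 + wt j ^+ 2) * (1 - (2 * C%:R / n%:R) ^+ 2) <= c ^+ 2.
Proof.
move=> ij Cn c.
have /andP[i0 i1] := wt01 i; have /andP[j0 j1] := wt01 j.
split; first by apply: sumr_ge0 => b _; rewrite mulr_ge0 ?fac_ge0.
set d := 2 * C%:R / n%:R.
have dE : d = C%:R / n%:R + C%:R / n%:R by rewrite /d; ring.
have d0 : 0 <= C%:R / n%:R :> R by rewrite divr_ge0.
have d1 : d <= 1 by rewrite /d ler_pdivrMr// mul1r -natrM ler_nat.
have P1 : 1 <= (1 + wt i ^+ 2) * (1 + wt j ^+ 2).
  have := sqr_ge0 (wt i); have := sqr_ge0 (wt j); nra.
(* With [s = wt i] and [t = wt j], the defect [(1 + s^2) (1 + t^2) - c^2] is [(s - t)^2] when the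
   half-line indicators agree and [(1 - s t)^2] when they differ. In both cases it is the square of
   a number in [[0, d]]. *)
have step x : 0 <= x <= d -> (1 + wt i ^+ 2) * (1 + wt j ^+ 2) * (1 - d ^+ 2) <=
    (1 + wt i ^+ 2) * (1 + wt j ^+ 2) - x ^+ 2.
  move=> /andP[x0 xd]; have : x ^+ 2 <= d ^+ 2 by rewrite ler_pXn2r ?nnegrE// (le_trans x0).
  have := sqr_ge0 d; nra.
have [hij|hij] := eqVneq (right_half i) (right_half j).
  have -> : c = 1 + wt i * wt j.
    by rewrite /c big_bool /fac hij; case: (right_half j) => /=; ring.
  apply: le_trans (step `|wt i - wt j| _) _.
    by rewrite normr_ge0 /= (le_trans (wt_dist ij))// dE lerDl.
  by rewrite real_normK ?num_real// le_eqVlt; apply/orP; left; apply/eqP; ring.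
have -> : c = wt i + wt j.
  by rewrite /c big_bool /fac; move: hij; case: (right_half i); case: (right_half j) => //= _; ring.
have iC : (absz i <= C)%N by move: hij; rewrite /right_half; lia.
have jC : (absz j <= C)%N by move: hij; rewrite /right_half; lia.
have hi := wt_near0 iC; have hj := wt_near0 jC.
apply: le_trans (step (1 - wt i * wt j) _) _.
  by rewrite dE; apply/andP; split; nra.
by rewrite le_eqVlt; apply/orP; left; apply/eqP; ring.
Qed.

Variable w : nat.
Hypotheses (nCw : (n + C <= w)%N).

Definition xi (M : int -> bool) : R :=
  if `[< conf w M >] then \prod_(j <- win w) fac (wt j) (M j) (right_half j) else 0.

Variables g gi : int -> int.
Hypotheses (gK : cancel g gi) (giK : cancel gi g)
  (gC : forall x, (absz (g x - x) <= C)%N).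

Let giC x : (absz (gi x - x) <= C)%N.
Proof. by have := gC (gi x); rewrite giK; lia. Qed.

(** Reindexing by [g], with weights and displaced weights vanishing outside the window because
    [n + C <= w]. If [M \o g] leaves [conf w], it is wrong at some [j] outside the window; the
    factor at [g j] is then [wt j = 0], so the right-hand side vanishes too. *)
Lemma xi_comp M : conf w M ->
  xi (M \o g) = \prod_(j <- win w) fac (wt (gi j)) (M j) (right_half (gi j)).
Proof.
move=> cM; rewrite /xi; case: asboolP => [cMg|ncMg].
  transitivity (\prod_(j <- [seq g j | j <- win w]) fac (wt (gi j)) (M j) (right_half (gi j))).
    by rewrite big_map; apply: eq_bigr => j _; rewrite gK.
  apply: big_uniq_eq; [by rewrite map_inj_uniq ?win_uniq//; exact: can_inj gK|exact: win_uniq| |].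
    move=> j _; rewrite mem_win -ltnNge => jw; rewrite cM// /fac.
    have -> : right_half j = right_half (gi j) by rewrite /right_half; have := giC j; lia.
    by rewrite eqxx.
  move=> j _ jg; have jw : (w < absz (gi j))%N.
    rewrite ltnNge; apply: contra jg => jw; apply/mapP; exists (gi j); last by rewrite giK.
    by rewrite mem_win.
  by have := cMg _ jw; rewrite /= giK /fac => ->; rewrite eqxx.
have [j [jw Mj]] : exists j, (w < absz j)%N /\ M (g j) != right_half j.
  apply: contra_notP ncMg => h j jw; apply/eqP/negP => /negP Mj; apply: h.
  by exists j.
have gjw : g j \in win w.
  rewrite mem_win leqNgt; apply/negP => gjw; move: Mj; rewrite cM// /right_half.
  by have := gC j; lia.
rewrite (bigD1_seq (g j)) ?win_uniq//= gK /fac (negPf Mj) wt_out ?mul0r//.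
lia.
Qed.

Lemma xi_conf M : conf w M -> xi M = \prod_(j <- win w) fac (wt j) (M j) (right_half j).
Proof. by move=> cM; rewrite /xi asboolT. Qed.

Let N1 := \prod_(j <- win w) (1 + wt j ^+ 2).

Lemma xi_norm : \sum_(M <- confs w) xi M * xi M = N1.
Proof.
rewrite big_seq; under eq_bigr => M /confsP cM.
  by rewrite xi_conf// -big_split /=; over.
rewrite -big_seq (@sum_confs R w (fun j b => fac (wt j) b (right_half j) * fac (wt j) b (right_half j))).
by apply: eq_bigr => j _; rewrite fac_sq.
Qed.

(** Both sums are products over the [2 w + 1] sites. In the square each site loses at most a factor
    [1 - d] with [d] of order [1 / n^2]; Bernoulli bounds the total loss by [e], and
    [(1 - e)^2 <= 1 - e] allows square roots to be taken. *)
Lemma xi_overlap (e : R) : 0 <= e -> (2 * C <= n)%N ->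
  (2 * w).+1%:R * (2 * C%:R / n%:R) ^+ 2 <= e ->
  (1 - e) * \sum_(M <- confs w) xi M * xi M <= \sum_(M <- confs w) xi (M \o g) * xi M.
Proof.
move=> e0 Cn he; rewrite xi_norm.
pose c j := \sum_(b : bool) fac (wt (gi j)) b (right_half (gi j)) * fac (wt j) b (right_half j).
have -> : \sum_(M <- confs w) xi (M \o g) * xi M = \prod_(j <- win w) c j.
  rewrite big_seq; under eq_bigr => M /confsP cM.
    by rewrite (xi_comp cM) (xi_conf cM) -big_split /=; over.
  by rewrite -big_seq (@sum_confs R w
    (fun j b => fac (wt (gi j)) b (right_half (gi j)) * fac (wt j) b (right_half j))).
have cP j : 0 <= c j /\ (1 + wt (gi j) ^+ 2) * (1 + wt j ^+ 2) *
    (1 - (2 * C%:R / n%:R) ^+ 2) <= c j ^+ 2 by exact: fac_overlap.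
have N1E : \prod_(j <- win w) (1 + wt (gi j) ^+ 2) = N1.
  transitivity (\prod_(j <- [seq gi j | j <- win w]) (1 + wt j ^+ 2)); first by rewrite big_map.
  apply: big_uniq_eq; [by rewrite map_inj_uniq ?win_uniq//; exact: can_inj giK|exact: win_uniq| |].
    move=> j _; rewrite mem_win -ltnNge => jw; rewrite wt_out ?expr0n ?addr0//; lia.
  move=> j _ jg; have jw : (w < absz (g j))%N.
    rewrite ltnNge; apply: contra jg => jw; apply/mapP; exists (g j); last by rewrite gK.
    by rewrite mem_win.
  by rewrite wt_out ?expr0n ?addr0//; have := gC j; lia.
set d := (2 * C%:R / n%:R) ^+ 2 in he cP *.
have d01 : 0 <= d <= 1.
  rewrite /d sqr_ge0 expr_le1// ?divr_ge0// ?mulr_ge0//.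
  by rewrite ler_pdivrMr// mul1r -natrM ler_nat.
have N1pos : 0 <= N1 by apply: prodr_ge0 => j _; rewrite addr_ge0 ?sqr_ge0.
have [e1|e1] := leP 1 e.
  apply: (@le_trans _ _ 0); first by rewrite mulr_le0_ge0// subr_le0.
  by apply: prodr_ge0 => j _; exact: (cP j).1.
have key : N1 ^+ 2 * (1 - e) <= (\prod_(j <- win w) c j) ^+ 2.
  rewrite -[leRHS]prodrXl.
  apply: (@le_trans _ _ (\prod_(j <- win w) ((1 + wt (gi j) ^+ 2) * (1 + wt j ^+ 2) * (1 - d)))).
    rewrite !big_split /= N1E -/N1 expr2 ler_wpM2l ?mulr_ge0//.
    rewrite big_const_seq count_predT size_win iter_mulr_1.
    by apply: le_trans (bernoulli_le _ d01); rewrite lerD2l lerN2.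
  apply: ler_prod => j _; apply/andP; split; last exact: (cP j).2.
  have d1 : 0 <= 1 - d by rewrite subr_ge0; case/andP: d01.
  apply: mulr_ge0 d1; apply: mulr_ge0.
    by have := sqr_ge0 (wt (gi j)); lra.
  by have := sqr_ge0 (wt j); lra.
have c0 : 0 <= \prod_(j <- win w) c j by apply: prodr_ge0 => j _; exact: (cP j).1.
rewrite -(@ler_pXn2r _ 2) ?nnegrE ?mulr_ge0 ?subr_ge0 ?(ltW e1)//.
apply: le_trans key; rewrite exprMn mulrC ler_wpM2l ?sqr_ge0//.
by rewrite expr2 ler_piMr ?subr_ge0 ?(ltW e1)// lerBlDr lerDl.
Qed.

Lemma xi_norm_gt0 : 0 < \sum_(M <- confs w) xi M * xi M.
Proof.
by rewrite xi_norm; apply: prodr_gt0 => j _; rewrite ltr_pwDl// sqr_ge0.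
Qed.

End product_vector.

Lemma finite_representatives (A : choiceType) (T : finType) (P : A -> Prop) (f : A -> T) :
  exists s : seq A, uniq s /\ forall a, P a -> exists2 b, b \in s & P b /\ f b = f a.
Proof.
have [[a0 Pa0]|nP] := pselect (exists a, P a); last first.
  by exists [::]; split => // a Pa; case: nP; exists a.
pose r t := xget a0 [set a | P a /\ f a = t].
exists (undup [seq r t | t <- enum T]); split; first exact: undup_uniq.
move=> a Pa; exists (r (f a)).
  by rewrite mem_undup; apply: map_f; rewrite mem_enum.
have h : [set b | P b /\ f b = f a] (r (f a)) by apply: xgetPex; exists a.
exact: h.
Qed.

Lemma absz_bound_inj (D : nat) (i j : int) : (absz i <= D)%N -> (absz j <= D)%N ->
  inord (n' := (2 * D)%N) (absz (i + D%:Z)) = inord (n' := (2 * D)%N) (absz (j + D%:Z)) -> i = j.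
Proof.
move=> iD jD /(congr1 (@nat_of_ord _)); rewrite !inordK; lia.
Qed.

(** * Lifting the vector from configurations to the group *)

Section almost_invariant_vectors.
Variables (R : realType) (G : groupType) (s : G -> int -> int).
Hypotheses (s1 : s 1%g =1 id) (sM : forall (g h : G) x, s (g * h)%g x = s g (s h x))
  (s_faithful : forall g, s g =1 id -> g = 1%g)
  (s_bd : forall g, exists C : nat, forall x, (absz (s g x - x) <= C)%N)
  (s_rec : forall (F : seq G) (N : nat) (j0 : int), exists L : nat, forall b : int,
     exists2 c : int, b <= c <= b + L%:Z &
       forall g i, g \in F -> (absz i <= N)%N -> s g (c + i) - (c + i) = s g (j0 + i) - (j0 + i)).

Let sK g : cancel (s g) (s g^-1%g).
Proof. by move=> x; rewrite -sM mulVg s1. Qed.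
Let sVK g : cancel (s g^-1%g) (s g).
Proof. by move=> x; rewrite -sM mulgV s1. Qed.

Section lift.
Variables (F : seq G) (C w L : nat).
Hypotheses (FC : forall g x, g \in F -> (absz (s g x - x) <= C)%N) (Cw : (C <= w)%N)
  (F1 : 1%g \in F) (FV : forall g, g \in F -> g^-1%g \in F).

Definition sdisp g j := s g j - j.

(** Near such an [m] the action repeats what it does near 0. An admissible [h] therefore carries the
    translate of [M0] by [m] to the translate by [m] of its image, which is the third clause of
    [admissible]. *)
Definition recurrent_shift (m : int) : Prop := forall g i, g \in F -> (absz i <= w + C)%N ->
  sdisp g (m + i) = sdisp g i.

Hypothesis ret_syndetic : forall b : int, exists2 m : int, b <= m <= b + L%:Z & recurrent_shift m.

Local Notation D := (2 * w + L + 1)%N.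

Definition same_type j j' : Prop := forall g i, g \in F -> (absz i <= D)%N ->
  sdisp g (j + i) = sdisp g (j' + i).

Definition move_conf h (M : int -> bool) : int -> bool := M \o s h^-1%g.

(* Such elements are determined by their displacement on each of finitely many local types,
   and the class is closed under left multiplication by F as long as one stays in conf w. *)
Definition admissible h M0 : Prop :=
  [/\ conf w M0, conf w (move_conf h M0),
      forall m j, recurrent_shift m -> move_conf h M0 (s h j - m) = M0 (j - m) &
      forall j j', same_type j j' -> sdisp h j = sdisp h j'].

Lemma move_confM g h M : move_conf (g * h)%g M = move_conf g (move_conf h M).
Proof. by apply/funext => j; rewrite /move_conf /= invgM sM. Qed.

Lemma move_conf1 M : move_conf 1%g M = M.
Proof. by apply/funext => j; rewrite /move_conf /= invg1 s1. Qed.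

Lemma admissible1 M0 : conf w M0 -> admissible 1%g M0.
Proof.
move=> cM; split => //; first by rewrite move_conf1.
  by move=> m j _; rewrite move_conf1 s1.
by move=> j j' _; rewrite /sdisp !s1 !subrr.
Qed.

(** Recurrent shifts act as barriers. A point more than [w] to the right of [m] lies in the
    translate of [M0] by [m], so its image lies in the translate of the moved configuration and
    cannot be more than [w] to the left of [m]; the other side is symmetric. Barriers occur in every
    interval of length [L]. *)
Lemma admissible_disp h M0 j : admissible h M0 -> (absz (sdisp h j) <= D)%N.
Proof.
move=> [cM0 cM1 hM _].
have [m hm rm] := ret_syndetic (j - (w + 1)%N%:Z - L%:Z).
have h1 : - w%:Z <= s h j - m.
  have e1 := hM m j rm; have e2 : M0 (j - m) = right_half (j - m) by apply: cM0; lia.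
  rewrite leNgt; apply/negP => lt1; move: e1; rewrite e2 cM1 /right_half; lia.
have [m' hm' rm'] := ret_syndetic (j + (w + 1)%N%:Z).
have h2 : s h j - m' <= w%:Z.
  have e1 := hM m' j rm'; have e2 : M0 (j - m') = right_half (j - m') by apply: cM0; lia.
  rewrite leNgt; apply/negP => lt1; move: e1; rewrite e2 cM1 /right_half; lia.
rewrite /sdisp; lia.
Qed.

Lemma admissible_step g h M0 : g \in F -> admissible h M0 ->
  conf w (move_conf g (move_conf h M0)) -> admissible (g * h)%g M0.
Proof.
move=> gF ad cM2; have [cM0 cM1 hM hD] := ad.
split => //; first by rewrite move_confM.
- move=> m j rm; rewrite move_confM sM -hM//; set i := s h j; set M1 := move_conf h M0.
  (* Close to [m], recurrence turns the action of [g] at [i] into that at [i - m]. Farther than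
     [w + C], both configurations are half-lines and a move by at most [C] does not change side. *)
  have [im|im] := leqP (absz (i - m)) (w + C).
    have := rm g (i - m) gF im; rewrite /sdisp.
    have -> : m + (i - m) = i by ring.
    move=> e; have -> : s g i - m = s g (i - m) by move: e; lia.
    by rewrite /move_conf /= sK.
  have gC := FC i gF.
  rewrite cM2; last by lia.
  rewrite /M1 cM1; last by lia.
  by rewrite /right_half; lia.
(* The radius [D] of [same_type] covers the displacement by [h], so [g] displaces [s h j] and
   [s h j'] equally. *)
- move=> j j' jj'; rewrite /sdisp !sM.
  have e1 := hD j j' jj'; have b1 := admissible_disp j ad.
  have := jj' g (sdisp h j) gF b1; rewrite {2}e1 /sdisp.
  by rewrite ![_ + (s h _ - _)]addrC !subrK; move: e1; rewrite /sdisp; lia.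
Qed.

(** The displacements at one point of each local type determine an admissible element, by
    faithfulness. The bound [C] leaves finitely many types, and [admissible_disp] finitely many
    values at each. *)
Lemma admissible_finite : exists Hs : seq G, uniq Hs /\
  forall h M0, admissible h M0 -> h \in Hs.
Proof.
pose code_type (j : int) : {ffun 'I_(size F) * 'I_(2 * D).+1 -> 'I_(2 * C).+1} :=
  [ffun p : 'I_(size F) * 'I_(2 * D).+1 => inord (absz (sdisp (nth 1%g F p.1) (j + (p.2%:Z - D%:Z)) + C%:Z))].
have code_typeP j j' : code_type j = code_type j' -> same_type j j'.
  move=> e g i gF iD.
  have gi : (index g F < size F)%N by rewrite index_mem.
  have iD' : (absz (i + D%:Z)%R < (2 * D).+1)%N by lia.
  have := congr1 (fun f : {ffun _ -> _} => f (Ordinal gi, Ordinal iD')) e.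
  rewrite !ffunE /= nth_index//.
  have -> : (absz (i + D%:Z))%:Z - D%:Z = i by lia.
  by apply: absz_bound_inj; exact: FC.
have [J [uJ hJ]] := finite_representatives (fun=> True) code_type.
pose code (h : G) : {ffun 'I_(size J) -> 'I_(2 * D).+1} :=
  [ffun p : 'I_(size J) => inord (absz (sdisp h (nth 0 J p) + D%:Z))].
have [Hs [uH hH]] := finite_representatives (fun h => exists M0, admissible h M0) code.
exists Hs; split => // h M0 ad.
have [|h' h'Hs [[M0' ad'] e]] := hH h; first by exists M0.
suff -> : h = h' by [].
have dispE j : sdisp h j = sdisp h' j.
  have [j' j'J [_ /code_typeP jj']] := hJ j I.
  have [_ _ _ hD] := ad; have [_ _ _ hD'] := ad'.
  rewrite -(hD _ _ jj') -(hD' _ _ jj').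
  have ji : (index j' J < size J)%N by rewrite index_mem.
  have := congr1 (fun f : {ffun _ -> _} => f (Ordinal ji)) e.
  rewrite !ffunE /= nth_index// => /esym.
  by apply: absz_bound_inj; [exact: admissible_disp ad|exact: admissible_disp ad'].
apply/(mulgI h'^-1%g); rewrite mulVg; apply: s_faithful => j; rewrite sM.
have := dispE j; rewrite /sdisp => /addIr ->.
exact: sK.
Qed.

Variables (Hs : seq G).
Hypotheses (uHs : uniq Hs) (HsP : forall h M0, admissible h M0 -> h \in Hs).
Variable v : (int -> bool) -> R.
Hypothesis v_conf : forall M, ~ conf w M -> v M = 0.

Definition admissible_to h M0 M : bool := `[< admissible h M0 /\ move_conf h M0 = M >].

Definition fibre M : R := \sum_(M0 <- confs w) \sum_(h <- Hs) (admissible_to h M0 M)%:R.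

Lemma fibre_gt0 M : conf w M -> 0 < fibre M.
Proof.
move=> cM; rewrite /fibre (bigD1_seq M) ?confs_uniq//=; last exact/confsP.
have ad1 := admissible1 cM.
rewrite (bigD1_seq 1%g)//=; last exact: HsP ad1.
have -> : admissible_to 1%g M M by apply/asboolP; split => //; exact: move_conf1.
rewrite -addrA ltr_pwDl//.
by rewrite addr_ge0// ?sumr_ge0// => M0 _; rewrite sumr_ge0.
Qed.

(** Left multiplication by [g] is a bijection between the two fibres, by [admissible_step] for [g]
    and for its inverse. *)
Lemma fibre_invariant g M : g \in F -> conf w M -> conf w (move_conf g M) ->
  fibre (move_conf g M) = fibre M.
Proof.
move=> gF cM cgM; apply: eq_bigr => M0 _.
transitivity (\sum_(h <- [seq (g * h)%g | h <- Hs]) (admissible_to h M0 (move_conf g M))%:R : R).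
  apply: big_uniq_eq => //; first by rewrite map_inj_uniq//; exact: mulgI.
    move=> h _ hg; rewrite /admissible_to; case: asboolP => //= -[ad e]; case/negP: hg.
    apply/mapP; exists (g^-1 * h)%g; last by rewrite mulVKg.
    apply: (HsP (M0 := M0)); apply: admissible_step => //; first exact: FV.
    by rewrite e -move_confM mulVg move_conf1.
  move=> h _ hHs; rewrite /admissible_to; case: asboolP => //= -[ad e]; case/negP: hHs; exact: HsP ad.
rewrite big_map; apply: eq_bigr => h _; congr (_%:R); congr nat_of_bool.
apply/asboolP/asboolP => -[ad e]; split.
- rewrite -[h](mulKg g); apply: admissible_step => //; first exact: FV.
  by rewrite e -move_confM mulVg move_conf1.
- have := congr1 (move_conf g^-1%g) e.
  by rewrite -!move_confM mulKg mulVg move_conf1.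
- by apply: admissible_step; rewrite ?e.
- by rewrite move_confM e.
Qed.

(* Dividing by the root of the fibre size, which is F-invariant, makes the lift isometric. *)
Definition lift_vec (M0 : int -> bool) (h : G) : R :=
  if `[< admissible h M0 >] then v (move_conf h M0) / Num.sqrt (fibre (move_conf h M0)) else 0.

Lemma lift_vec_out M0 h : h \notin Hs -> lift_vec M0 h = 0.
Proof. by rewrite /lift_vec; case: asboolP => // /HsP ->. Qed.

(** Sort the pairs [(M0, h)] by their endpoint [M]: the [fibre M] pairs over [M] contribute equally,
    and the two square roots divide by exactly this number. *)
Lemma lift_vec_overlap g : g \in F ->
  \sum_(M0 <- confs w) \sum_(h <- Hs) lift_vec M0 (g^-1 * h)%g * lift_vec M0 h =
  \sum_(M <- confs w) v (M \o s g) * v M.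
Proof.
move=> gF.
pose f M := v (M \o s g) * v M / fibre M.
have fE M0 h : lift_vec M0 (g^-1 * h)%g * lift_vec M0 h =
    \sum_(M <- confs w) (admissible_to h M0 M)%:R * f M.
  rewrite {2}/lift_vec; case: asboolP => [ad|nad]; last first.
    rewrite mulr0 big1// => M _; rewrite /admissible_to; case: asboolP => [[]//|_].
    by rewrite /= mul0r.
  have [_ cM _ _] := ad; set M := move_conf h M0 in cM *.
  rewrite (bigD1_seq M) ?confs_uniq//=; last exact/confsP.
  rewrite [X in _ + X]big1 ?addr0; last first.
    move=> M' M'M; rewrite /admissible_to; case: asboolP => [[_ e]|_]; last by rewrite /= mul0r.
    by move: M'M; rewrite -e eqxx.
  have -> : admissible_to h M0 M by apply/asboolP.
  have gE : move_conf (g^-1)%g M = M \o s g by rewrite /move_conf invgK.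
  (* If the moved configuration leaves [conf w], then [v] vanishes there and the moved pair is not
     admissible, so both sides are zero. *)
  rewrite mul1r /f; have [cgM|ncgM] := pselect (conf w (M \o s g)); last first.
    rewrite (v_conf ncgM) !mul0r /lift_vec; case: asboolP => [[_ cgM _ _]|_]; last by rewrite mul0r.
    by case: ncgM; rewrite -gE -move_confM.
  have ad' : admissible (g^-1 * h)%g M0.
    by apply: admissible_step; [exact: FV|exact: ad|rewrite -/M gE].
  have fg : fibre (M \o s g) = fibre M by rewrite -gE fibre_invariant ?gE//; exact: FV.
  rewrite /lift_vec asboolT// move_confM -/M gE fg.
  have fM := fibre_gt0 cM.
  rewrite -[in RHS](sqr_sqrtr (ltW fM)).
  by field; rewrite sqrtr_eq0 -ltNge.
under eq_bigr do under eq_bigr do rewrite fE.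
under eq_bigr do rewrite exchange_big /=.
rewrite exchange_big /= big_seq [RHS]big_seq; apply: eq_bigr => M /confsP cM.
under eq_bigr do rewrite -mulr_suml.
rewrite -mulr_suml -/(fibre M) /f mulrC mulfVK//.
by rewrite lt0r_neq0// fibre_gt0.
Qed.

End lift.

(** The vector lives in a finite multiple of l2(G), one copy for each starting configuration; for
    weak containment this is as good as l2(G). *)
Lemma almost_invariant (F : seq G) (e : R) : 0 < e ->
  exists (Ms : seq (int -> bool)) (Hs : seq G) (eta : (int -> bool) -> G -> R),
  [/\ uniq Hs, forall M h, h \notin Hs -> eta M h = 0,
      0 < \sum_(M <- Ms) \sum_(h <- Hs) eta M h ^+ 2 &
      forall g, g \in F ->
        (1 - e) * \sum_(M <- Ms) \sum_(h <- Hs) eta M h ^+ 2 <=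
        \sum_(M <- Ms) \sum_(h <- Hs) eta M (g^-1 * h)%g * eta M h].
Proof.
move=> e0; pose F' := 1%g :: F ++ [seq g^-1%g | g <- F].
have F'V g : g \in F' -> g^-1%g \in F'.
  rewrite !inE !mem_cat => /orP[/eqP ->|/orP[gF|/mapP[h hF ->]]].
  - by rewrite invg1 eqxx.
  - by rewrite (map_f (fun g : G => g^-1%g) gF) !orbT.
  - by rewrite invgK hF orbT.
have FF' g : g \in F -> g \in F' by move=> gF; rewrite inE mem_cat gF orbT.
have [C hC] := displacement_bound s_bd F'.
(* At most [5 n] sites with defect [(2 C / n)^2] give [20 C^2 / n] in total; the summand [2 C]
   secures [2 C <= n]. *)
pose n := (Num.truncn (20 * C%:R ^+ 2 / e) + 2 * C).+1.
have n0 : (0 < n)%N by [].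
have Cn : (2 * C <= n)%N by rewrite (leq_trans (leq_addl (Num.truncn (20 * C%:R ^+ 2 / e)) _)).
pose w := (n + C)%N.
have n0R : 0 < n%:R :> R by rewrite ltr0n.
have he : (2 * w).+1%:R * (2 * C%:R / n%:R) ^+ 2 <= e.
  have nC : 20 * C%:R ^+ 2 / e <= n%:R.
    apply: ltW; apply: lt_le_trans (truncnS_gt _) _.
    by rewrite ler_nat ltnS leq_addr.
  have w5 : (2 * w).+1%:R <= 5 * n%:R :> R.
    by rewrite -natrM ler_nat /w; lia.
  apply: le_trans (_ : _ <= 5 * n%:R * (2 * C%:R / n%:R) ^+ 2) _.
    by rewrite ler_wpM2r ?sqr_ge0.
  have -> : 5 * n%:R * (2 * C%:R / n%:R) ^+ 2 = 20 * C%:R ^+ 2 / n%:R :> R.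
    by field; rewrite lt0r_neq0.
  by rewrite ler_pdivrMr// [leRHS]mulrC -ler_pdivrMr.
have [L hL] := s_rec F' (w + C) 0.
have synd b : exists2 m : int, b <= m <= b + L%:Z &
    forall g i, g \in F' -> (absz i <= w + C)%N -> s g (m + i) - (m + i) = s g i - i.
  have [m hm rm] := hL b; exists m => // g i gF iw.
  by rewrite rm// !add0r.
have Cw : (C <= w)%N by rewrite /w leq_addl.
have F'1 : 1%g \in F' by rewrite inE eqxx.
have [Hs [uHs HsP]] := admissible_finite hC Cw F'1 synd.
pose v := @xi R n w.
have v_conf M : ~ conf w M -> v M = 0 by move=> ncM; rewrite /v /xi asboolF.
exists (confs w), Hs, (lift_vec F' C w L Hs v).
have sqE : \sum_(M <- confs w) \sum_(h <- Hs) lift_vec F' C w L Hs v M h ^+ 2 =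
    \sum_(M <- confs w) v M * v M.
  have := lift_vec_overlap hC Cw F'1 F'V synd uHs HsP v_conf F'1.
  rewrite invg1; under eq_bigr do under eq_bigr do rewrite mul1g -expr2.
  move=> ->; apply: eq_bigr => M _; congr (v _ * _).
  by apply/funext => j /=; rewrite s1.
split => //.
- by move=> M h; exact: lift_vec_out.
- by rewrite sqE; exact: xi_norm_gt0.
move=> g gF; rewrite sqE lift_vec_overlap//; last exact: FF'.
apply: (@xi_overlap R n C n0 w (leqnn _) (s g) (s g^-1%g)) => //; last exact: ltW.
by move=> x; apply: hC; exact: FF'.
Qed.

End almost_invariant_vectors.

(** * Weak containment *)

Section gram_schmidt.
Variables (R : realType) (H : hilbertType R).
Implicit Types (es ws : seq H) (v w : H).

(** For an orthonormal [es] this is membership in the span. As an equation linear in [v] it is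
    stable under combinations and leaves no coefficients to choose. *)
Definition in_span es v := v = \sum_(e <- es) hdot v e *: e.

Lemma in_span0 es : in_span es 0.
Proof. by rewrite /in_span big1// => e _; rewrite hdot0l scale0r. Qed.

Lemma in_spanD es v w : in_span es v -> in_span es w -> in_span es (v + w).
Proof.
rewrite /in_span => hv hw; rewrite {1}hv {1}hw -big_split /=.
by apply: eq_bigr => e _; rewrite hdotDl scalerDl.
Qed.

Lemma in_spanZ es c v : in_span es v -> in_span es (c *: v).
Proof.
rewrite /in_span => hv; rewrite {1}hv scaler_sumr.
by apply: eq_bigr => e _; rewrite hdotZl scalerA.
Qed.

Lemma in_span_sum es I (r : seq I) (F : I -> H) :
  (forall i, in_span es (F i)) -> in_span es (\sum_(i <- r) F i).
Proof.
move=> hF; elim/big_rec : _ => [|i x _ hx]; first exact: in_span0.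
by apply: in_spanD.
Qed.

Lemma parseval es v : in_span es v -> rn v ^+ 2 = \sum_(e <- es) rn (hdot v e) ^+ 2.
Proof.
move=> hv; apply: (@complexI R); rewrite -hdotvv {1}hv hdot_suml rmorph_sum.
by apply: eq_bigr => e _; rewrite hdotZl (hdotC e) rn_mulJ.
Qed.

Lemma gram_schmidt ws : exists es, [/\ uniq es,
  {in es &, forall e e', hdot e e' = (e == e')%:R} & {in ws, forall w, in_span es w}].
Proof.
elim: ws => [|w ws [es [ues oes hes]]]; first by exists [::].
have proj e' : e' \in es -> hdot (\sum_(e <- es) hdot w e *: e) e' = hdot w e'.
  move=> e'es; rewrite hdot_suml (bigD1_seq e')//= hdotZl (oes e' e')// eqxx mulr1.
  rewrite big_seq_cond big1 ?addr0// => e /andP[ees ee'].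
  by rewrite hdotZl (oes e e')// (negPf ee') mulr0.
set u := w - \sum_(e <- es) hdot w e *: e.
have ou e : e \in es -> hdot u e = 0 by move=> ees; rewrite hdotBl proj// subrr.
have [u0|u0] := eqVneq u 0.
  exists es; split => // v; rewrite inE => /orP[/eqP ->|]; last exact: hes.
  by apply/eqP; rewrite -subr_eq0 -/u u0.
have ru : 0 < rn u by rewrite rn_gt0.
pose e0 := (rn u)^-1%:C%C *: u.
have oe0 e : e \in es -> hdot e0 e = 0 by move=> ees; rewrite hdotZl ou// mulr0.
have oe0' e : e \in es -> hdot e e0 = 0.
  by move=> ees; rewrite hdotC oe0//; exact: rmorph0.
have e0e0 : hdot e0 e0 = 1.
  rewrite hdotvv rnZ rn_real ger0_norm ?invr_ge0 ?rn_ge0// mulVf ?lt0r_neq0//.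
  by rewrite expr1n.
have e0es : e0 \notin es.
  by apply/negP => /oe0 /eqP; rewrite e0e0 oner_eq0.
exists (e0 :: es); split.
- by rewrite /= e0es.
- move=> e e'; rewrite !inE => /orP[/eqP ->|ees] /orP[/eqP ->|e'es].
  + by rewrite e0e0 eqxx.
  + rewrite oe0//; case: eqP => // e0e'; by rewrite -e0e' (negPf e0es) in e'es.
  + rewrite oe0'//; case: eqP => // e0e'; by rewrite e0e' (negPf e0es) in ees.
  + exact: oes.
- move=> v; rewrite inE /in_span big_cons => /orP[/eqP ->|vws].
    have we0 : hdot w e0 *: e0 = u.
      have wE : w = u + \sum_(e <- es) hdot w e *: e by rewrite /u subrK.
      rewrite {1}wE hdotDl hdot_suml big_seq big1 ?addr0; last first.
        by move=> e ees; rewrite hdotZl oe0' ?mulr0.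
      rewrite hdotZr hdotvv cj_real /e0 scalerA -rmorphM -rmorphM.
      by rewrite expr2 mulKf ?lt0r_neq0// mulfV ?lt0r_neq0// scale1r.
    by rewrite we0 subrK.
  have ve0 : hdot v e0 = 0.
    rewrite (hes v vws) hdot_suml big_seq big1// => e ees.
    by rewrite hdotZl oe0' ?mulr0.
  by rewrite ve0 scale0r add0r; exact: hes.
Qed.

End gram_schmidt.

Section ampliation.
Variables (R : realType) (S : choiceType) (G : groupType) (act : G -> S -> S).
Hypotheses (act1 : act 1%g =1 id) (actM : forall (g h : G) x, act (g * h)%g x = act g (act h x)).
Variable H : hilbertType R.
Let rho := perm_rep R act1 actM.

(* [rho l] acting on H-valued functions has the same norm bound as on scalar ones. *)
Lemma ampliation_bound (l : seq (R[i] * G)) (f : S -> H) (W U : seq S) :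
  uniq W -> uniq U -> (forall x, x \notin W -> f x = 0) ->
  \sum_(x <- U) rn (\sum_(p <- l) p.1 *: f (act (p.2)^-1%g x)) ^+ 2 <=
  opnorm (urep_sum rho l) ^+ 2 * \sum_(x <- W) rn (f x) ^+ 2.
Proof.
move=> uW uU f0; have [es [_ _ hes]] := gram_schmidt [seq f x | x <- W].
have fes x : in_span es (f x).
  have [xW|xW] := boolP (x \in W); first by apply: hes; exact: map_f.
  by rewrite f0//; exact: in_span0.
pose a e : l2 R S := fsupp W (fun x => hdot (f x) e).
have aE e x : val (a e) x = hdot (f x) e.
  by rewrite fsuppE; case: ifP => // /negbT xW; rewrite f0// hdot0l.
have raE e x : val (urep_sum rho l (a e)) x =
    hdot (\sum_(p <- l) p.1 *: f (act (p.2)^-1%g x)) e.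
  rewrite l2_sum hdot_suml; apply: eq_bigr => p _.
  by rewrite l2Z hdotZl perm_repE aE.
under eq_bigr => x _.
  rewrite (parseval (es := es)); last by apply: in_span_sum => p; exact: in_spanZ.
  over.
rewrite [X in _ <= _ * X](eq_bigr (fun x => \sum_(e <- es) rn (hdot (f x) e) ^+ 2)); last first.
  by move=> x _; exact: parseval.
rewrite exchange_big /= [X in _ <= _ * X]exchange_big /= mulr_sumr.
apply: ler_sum => e _.
apply: (@le_trans _ _ (l2n (urep_sum rho l (a e)) ^+ 2)).
  apply: le_trans (l2n_ub (urep_sum rho l (a e)) uU).
  by apply: ler_sum => x _; rewrite /sqn raE.
apply: (@le_trans _ _ ((opnorm (urep_sum rho l) * l2n (a e)) ^+ 2)).
  have h := urep_sum_opnorm rho l (a e).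
  by rewrite ler_pXn2r ?nnegrE ?l2n_ge0// (le_trans (l2n_ge0 _) h).
rewrite exprMn ler_wpM2l ?sqr_ge0// (@l2n_fin _ _ _ W)//.
  by apply: ler_sum => x _; rewrite /sqn aE.
by move=> x; exact: fsupp0.
Qed.

End ampliation.

Section weak_containment.
Variables (R : realType) (G : groupType) (s : G -> int -> int).
Hypotheses (s1 : s 1%g =1 id) (sM : forall (g h : G) x, s (g * h)%g x = s g (s h x))
  (s_faithful : forall g, s g =1 id -> g = 1%g)
  (s_bd : forall g, exists C : nat, forall x, (absz (s g x - x) <= C)%N)
  (s_rec : forall (F : seq G) (N : nat) (j0 : int), exists L : nat, forall b : int,
     exists2 c : int, b <= c <= b + L%:Z &
       forall g i, g \in F -> (absz i <= N)%N -> s g (c + i) - (c + i) = s g (j0 + i) - (j0 + i)).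

Definition lact_seq (g : G) (x : seq int) : seq int := map (s g) x.

Lemma lact_seq1 : lact_seq 1%g =1 id.
Proof. by move=> x; rewrite /lact_seq (eq_map s1) map_id. Qed.

Lemma lact_seqM (g h : G) x : lact_seq (g * h)%g x = lact_seq g (lact_seq h x).
Proof. by rewrite /lact_seq -map_comp; apply: eq_map => j; rewrite sM. Qed.

Definition seq_rep := perm_rep R lact_seq1 lact_seqM.

(** [x0] lists a witness for every pair, so its length grows with [Ks]: hence the need for sequences
    of unbounded length. *)
Lemma seq_separation (Ks : seq G) : exists x0 : seq int,
  {in Ks &, forall h k, lact_seq h x0 = lact_seq k x0 -> h = k}.
Proof.
pose wit h k := xget 0 [set j | s h j <> s k j].
exists [seq wit h k | h <- Ks, k <- Ks] => h k hK kK /eq_in_map e.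
apply: contrapT => hk.
have [j hj] : exists j, s h j <> s k j.
  apply: contra_notP hk => nj; apply/(mulgI k^-1%g); rewrite mulVg.
  apply: s_faithful => j; rewrite sM.
  have -> : s h j = s k j by apply: contra_notP nj => hj; exists j.
  by rewrite -sM mulVg s1.
have /= : [set j | s h j <> s k j] (wit h k) by apply: xgetPex; exists j.
by apply; apply: e; apply: allpairs_f.
Qed.

(** Fell absorption by hand. [f M] spreads [w] along the orbit of [x0] with weights [eta M] and the
    twist by [sigma h^-1]. Acting by [l] through [seq_rep] and undoing the twist gives [Z M k],
    which the ampliation bound controls. Pairing [Z] with [eta] gives [Y], which by almost
    invariance differs from [N] times the image of [w] under [l] by at most [e N A |w|]. *)
Lemma weak_containment (H : hilbertType R) (sigma : unitary_rep G H) (l : seq (R[i] * G)) :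
  opnorm (urep_sum sigma l) <= opnorm (urep_sum seq_rep l).
Proof.
set B := opnorm (urep_sum seq_rep l).
have B0 : 0 <= B := opnorm_ge0 (urep_sum_bound seq_rep l).
apply: opnorm_le => // w.
pose A := \sum_(p <- l) rn p.1.
have A0 : 0 <= A by rewrite sumr_ge0// => p _; exact: rn_ge0.
suff main (e : R) : 0 < e -> rn (urep_sum sigma l w) <= (B + e * A) * rn w.
  apply/ler_addgt0Pr => d d0.
  have A1 : 0 < A * rn w + 1 by rewrite ltr_wpDl// mulr_ge0// rn_ge0.
  apply: le_trans (main _ (divr_gt0 d0 A1)) _.
  rewrite mulrDl lerD2l -mulrA mulrAC ler_pdivrMr// ler_wpM2l ?(ltW d0)//.
  by rewrite lerDl.
move=> e0.
have [Ms [Hs [eta [uHs eta0 Npos heta]]]] :=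
  almost_invariant s1 sM s_faithful s_bd s_rec [seq p.2 | p <- l] e0.
set N := \sum_(M <- Ms) _ in Npos heta.
pose Ks := undup (Hs ++ [seq (p.2 * h)%g | p <- l, h <- Hs]).
have HK h : h \in Hs -> h \in Ks by move=> hH; rewrite mem_undup mem_cat hH.
have uKs : uniq Ks by exact: undup_uniq.
(* The elements [p.2^-1 * k] are included because acting by [l] evaluates [f] at their images of
   [x0]. *)
have [x0 hx0] := seq_separation (Ks ++ [seq (p.2^-1 * k)%g | p <- l, k <- Ks]).
pose f M (x : seq int) : H := \sum_(h <- Hs) ((x == lact_seq h x0)%:R * (eta M h)%:C%C) *: sigma h^-1%g w.
have fE M k : k \in Ks ++ [seq (p.2^-1 * k)%g | p <- l, k <- Ks] ->
    f M (lact_seq k x0) = (eta M k)%:C%C *: sigma k^-1%g w.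
  move=> kK; have [kH|kH] := boolP (k \in Hs); last first.
    rewrite eta0// scale0r /f big_seq big1// => h hH.
    case: eqP => [kh|_]; last by rewrite mul0r scale0r.
    have hk : k = h by apply: hx0 kh => //; rewrite mem_cat HK.
    by rewrite hk hH in kH.
  rewrite /f (bigD1_seq k)//= eqxx mul1r big_seq_cond big1 ?addr0// => h /andP[hH hk].
  case: eqP => [kh|_]; last by rewrite mul0r scale0r.
  have kh' : k = h by apply: hx0 kh => //; rewrite mem_cat HK.
  by rewrite kh' eqxx in hk.
pose Z M k := \sum_(p <- l) (p.1 * (eta M (p.2^-1 * k)%g)%:C%C) *: sigma p.2 w.
have ZE M k : k \in Ks -> rn (\sum_(p <- l) p.1 *: f M (lact_seq (p.2)^-1%g (lact_seq k x0))) = rn (Z M k).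
  move=> kK; rewrite -(urep_rn sigma k^-1%g (Z M k)); congr rn.
  rewrite /Z linear_sum /= big_seq [RHS]big_seq; apply: eq_bigr => p pl.
  rewrite -lact_seqM fE; last first.
    by rewrite mem_cat; apply/orP; right; apply/allpairsP; exists (p, k).
  by rewrite scalerA invgM invgK urepM [RHS]linearZ.
have Zbound M : \sum_(k <- Ks) rn (Z M k) ^+ 2 <=
    B ^+ 2 * ((\sum_(h <- Hs) eta M h ^+ 2) * rn w ^+ 2).
  have uU : uniq [seq lact_seq k x0 | k <- Ks].
    rewrite map_inj_in_uniq// => h k hK kK; apply: hx0; rewrite mem_cat ?hK ?kK//.
  have uW : uniq [seq lact_seq h x0 | h <- Hs].
    rewrite map_inj_in_uniq// => h k hK kK; apply: hx0; rewrite mem_cat HK//.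
  have f0 x : x \notin [seq lact_seq h x0 | h <- Hs] -> f M x = 0.
    move=> xW; rewrite /f big_seq big1// => h hH; case: eqP => [xh|_].
      by move: xW; rewrite xh (map_f (fun h => lact_seq h x0) hH).
    by rewrite mul0r scale0r.
  have := ampliation_bound lact_seq1 lact_seqM l uW uU f0.
  rewrite !big_map; congr (_ <= _).
    by rewrite big_seq [RHS]big_seq; apply: eq_bigr => k kK; rewrite ZE.
  congr (_ * _); rewrite mulr_suml big_seq [RHS]big_seq; apply: eq_bigr => h hH.
  rewrite fE ?mem_cat ?HK// rnZ rn_real urep_rn exprMn.
  by rewrite real_normK ?num_real.
(* The matrix coefficient of the almost invariant vector; it lies between [(1 - e) N] and [N] at the
   group elements of [l]. *)
pose kappa g := \sum_(M <- Ms) \sum_(k <- Hs) eta M (g^-1 * k)%g * eta M k.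
have kappa_le g : kappa g <= N.
  have shift M : \sum_(k <- Hs) eta M (g^-1 * k)%g ^+ 2 <= \sum_(k <- Hs) eta M k ^+ 2.
    rewrite -[leRHS](@big_uniq_sub _ _ _ _ Hs (undup (Hs ++ [seq (g^-1 * k)%g | k <- Hs]))) ?undup_uniq//; last 2 first.
    - by move=> k kH; rewrite mem_undup mem_cat kH.
    - by move=> k _ kH; rewrite eta0// ?expr0n.
    have -> : \sum_(k <- Hs) eta M (g^-1 * k)%g ^+ 2 =
        \sum_(k <- [seq (g^-1 * k)%g | k <- Hs]) eta M k ^+ 2 by rewrite big_map.
    apply: sum_uniq_le; rewrite ?undup_uniq//; first by move=> k; exact: sqr_ge0.
      by rewrite map_inj_uniq//; exact: mulgI.
    by move=> k kH; rewrite mem_undup mem_cat kH orbT.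
  apply: ler_sum => M _.
  apply: (@le_trans _ _ (\sum_(k <- Hs) (2^-1 * eta M (g^-1 * k)%g ^+ 2 + 2^-1 * eta M k ^+ 2))).
    apply: ler_sum => k _.
    have := sqr_ge0 (eta M (g^-1 * k)%g - eta M k); nra.
  rewrite big_split /= -!mulr_sumr; have := shift M; lra.
pose P := [seq (M, k) | M <- Ms, k <- Ks].
have sumP (V : nmodType) (F : (int -> bool) -> G -> V) :
    \sum_(q <- P) F q.1 q.2 = \sum_(M <- Ms) \sum_(k <- Ks) F M k.
  rewrite big_flatten /= big_map; apply: eq_bigr => M _.
  by rewrite big_map.
have Neq : \sum_(q <- P) `|eta q.1 q.2| ^+ 2 = N.
  rewrite (sumP _ (fun M k => `|eta M k| ^+ 2)); apply: eq_bigr => M _.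
  rewrite (@big_uniq_sub _ _ _ _ Hs Ks)//.
    by apply: eq_bigr => k _; rewrite real_normK ?num_real.
  by move=> k _ kH; rewrite eta0// normr0 expr0n.
pose Y := \sum_(q <- P) (eta q.1 q.2)%:C%C *: Z q.1 q.2.
have Yle : rn Y <= B * N * rn w.
  have sN : 0 <= Num.sqrt N by exact: sqrtr_ge0.
  have sNN : Num.sqrt N ^+ 2 = N by rewrite sqr_sqrtr// ltW.
  apply: le_trans (rn_sum _ _ _) _.
  apply: (@le_trans _ _ (\sum_(q <- P) `|eta q.1 q.2| * rn (Z q.1 q.2))).
    by apply: ler_sum => q _; rewrite rnZ rn_real.
  (* Cauchy-Schwarz over the pairs in [P]: the family [eta] has norm [sqrt N] and the family [Z] has
     norm at most [B sqrt N |w|]. *)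
  have -> : B * N * rn w = Num.sqrt N * (B * Num.sqrt N * rn w) by rewrite -{1}sNN; ring.
  apply: prod_sum_le => //; first by move=> q; exact: rn_ge0.
  - by rewrite !mulr_ge0 ?rn_ge0.
  - by rewrite Neq sNN.
  rewrite (sumP _ (fun M k => rn (Z M k) ^+ 2)) !exprMn sNN.
  rewrite -mulrA /N mulr_suml mulr_sumr; apply: ler_sum => M _; exact: Zbound.
have YE : Y = \sum_(p <- l) (p.1 * (kappa p.2)%:C%C) *: sigma p.2 w.
  rewrite /Y (sumP _ (fun M k => (eta M k)%:C%C *: Z M k)).
  transitivity (\sum_(M <- Ms) \sum_(k <- Hs) (eta M k)%:C%C *: Z M k).
    apply: eq_bigr => M _; apply: (@big_uniq_sub _ _ _ _ Hs Ks) => //.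
    by move=> k _ kH; rewrite eta0// scale0r.
  transitivity (\sum_(M <- Ms) \sum_(p <- l) \sum_(k <- Hs)
      (p.1 * (eta M (p.2^-1 * k)%g * eta M k)%:C%C) *: sigma p.2 w).
    apply: eq_bigr => M _; rewrite exchange_big /=; apply: eq_bigr => k _.
    rewrite scaler_sumr; apply: eq_bigr => p _.
    by rewrite scalerA rmorphM /= mulrCA [X in _ * X]mulrC.
  rewrite exchange_big /=; apply: eq_bigr => p _.
  rewrite /kappa rmorph_sum mulr_sumr scaler_suml; apply: eq_bigr => M _.
  by rewrite -scaler_suml rmorph_sum -mulr_sumr.
have diff : rn (N%:C%C *: urep_sum sigma l w - Y) <= e * N * A * rn w.
  rewrite YE /urep_sum scaler_sumr -sumrB; apply: le_trans (rn_sum _ _ _) _.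
  rewrite -mulrA /A mulr_suml mulr_sumr big_seq [leRHS]big_seq; apply: ler_sum => p pl.
  rewrite scalerA mulrC -scalerBl -mulrBr -rmorphB rnZ rnM rn_real urep_rn.
  rewrite mulrAC mulrC ler_wpM2r ?mulr_ge0 ?rn_ge0//.
  have h1 := kappa_le p.2; have h2 := heta p.2 (map_f _ pl); rewrite -/(kappa p.2) in h2.
  by rewrite ger0_norm ?subr_ge0//; move: h2; lra.
rewrite -(ler_pM2l Npos).
have -> : N * rn (urep_sum sigma l w) = rn (N%:C%C *: urep_sum sigma l w).
  by rewrite rnZ rn_real ger0_norm// ltW.
have := rnD (N%:C%C *: urep_sum sigma l w - Y) Y; rewrite subrK => h.
by apply: (le_trans h); move: diff Yle; lra.
Qed.

Lemma universal_norm_seq_rep (l : seq (R[i] * G)) :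
  universal_norm l = opnorm (urep_sum seq_rep l).
Proof.
apply/eqP; rewrite eq_le opnorm_universal andbT.
apply: ge_sup; first by exists (opnorm (urep_sum seq_rep l)), (l2 R (seq int)), seq_rep.
by move=> _ [H [sigma ->]]; exact: weak_containment.
Qed.

End weak_containment.

(** * Representations of the group C*-algebra *)

Section group_algebra.
Variables (R : realType) (G : groupType).
Implicit Types l : seq (R[i] * G).

Definition scale_sum (c : R[i]) l := [seq (c * p.1, p.2) | p <- l].
Definition mul_sum l1 l2 := [seq (p.1 * q.1, (p.2 * q.2)%g) | p <- l1, q <- l2].
Definition adj_sum l := [seq (Num.conj p.1, (p.2)^-1%g) | p <- l].

Section rep.
Variables (H : hilbertType R) (sigma : unitary_rep G H).

Lemma urep_sum_cat l1 l2 v : urep_sum sigma (l1 ++ l2) v = urep_sum sigma l1 v + urep_sum sigma l2 v.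
Proof. exact: big_cat. Qed.

Lemma urep_sum_scale c l v : urep_sum sigma (scale_sum c l) v = c *: urep_sum sigma l v.
Proof.
by rewrite /urep_sum big_map scaler_sumr; apply: eq_bigr => p _; rewrite scalerA.
Qed.

Lemma urep_sum_mul l1 l2 v :
  urep_sum sigma (mul_sum l1 l2) v = urep_sum sigma l1 (urep_sum sigma l2 v).
Proof.
rewrite /urep_sum big_flatten /= big_map; apply: eq_bigr => p _.
rewrite big_map linear_sum scaler_sumr; apply: eq_bigr => q _ /=.
by rewrite urepM linearZ /= scalerA.
Qed.

Lemma urep_sumB l v w : urep_sum sigma l (v - w) = urep_sum sigma l v - urep_sum sigma l w.
Proof. by rewrite -(scaleN1r w) urep_sumD urep_sumZ scaleN1r. Qed.

Lemma urep_adj g v w : hdot (sigma g^-1%g v) w = hdot v (sigma g w).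
Proof. by rewrite -(urep_dot sigma g) -urepM mulgV urep1. Qed.

Lemma urep_sum_adj l v w :
  hdot (urep_sum sigma (adj_sum l) v) w = hdot v (urep_sum sigma l w).
Proof.
rewrite /urep_sum big_map hdot_suml hdot_sumr; apply: eq_bigr => p _.
by rewrite hdotZl hdotZr urep_adj.
Qed.

End rep.

Section algebra.
Variables (A : cstarAlgType R) (u : G -> A).
Hypotheses (uM : forall g h, u (g * h)%g = cmul (u g) (u h))
  (uV : forall g, u (g^-1)%g = star (u g)).

Definition alg_sum l : A := \sum_(p <- l) p.1 *: u p.2.

Lemma alg_sum_cat l1 l2 : alg_sum (l1 ++ l2) = alg_sum l1 + alg_sum l2.
Proof. exact: big_cat. Qed.

Lemma alg_sum_scale c l : alg_sum (scale_sum c l) = c *: alg_sum l.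
Proof.
by rewrite /alg_sum big_map scaler_sumr; apply: eq_bigr => p _; rewrite scalerA.
Qed.

Lemma cmulDl (a b c : A) : cmul (a + b) c = cmul a c + cmul b c.
Proof. exact: linearDl. Qed.
Lemma cmulBl (a b c : A) : cmul (a - b) c = cmul a c - cmul b c.
Proof. exact: linearBl. Qed.
Lemma cmulZl x (a b : A) : cmul (x *: a) b = x *: cmul a b.
Proof. exact: linearZl_LR. Qed.
Lemma cmulDr (a b c : A) : cmul a (b + c) = cmul a b + cmul a c.
Proof. exact: linearDr. Qed.
Lemma cmulBr (a b c : A) : cmul a (b - c) = cmul a b - cmul a c.
Proof. exact: linearBr. Qed.
Lemma cmulZr x (a b : A) : cmul a (x *: b) = x *: cmul a b.
Proof. exact: linearZr_LR. Qed.

Lemma cmul0l (a : A) : cmul 0 a = 0.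
Proof. by rewrite -[X in cmul X](scale0r 0) cmulZl scale0r. Qed.
Lemma cmul0r (a : A) : cmul a 0 = 0.
Proof. by rewrite -[X in cmul a X](scale0r 0) cmulZr scale0r. Qed.
Lemma star0 : star (0 : A) = 0.
Proof.
by rewrite -[X in star X](scale0r 0) starZ (_ : Num.conj 0 = 0) ?scale0r//; exact: rmorph0.
Qed.

Lemma starB (a b : A) : star (a - b) = star a - star b.
Proof.
rewrite starD -(scaleN1r b) starZ (_ : Num.conj (-1) = -1) ?scaleN1r//.
exact: rmorphN1.
Qed.

Lemma alg_sum_mul l1 l2 : alg_sum (mul_sum l1 l2) = cmul (alg_sum l1) (alg_sum l2).
Proof.
rewrite {1}/alg_sum big_flatten /= big_map {1}/alg_sum.
elim: l1 => [|p l1 IH]; first by rewrite !big_nil cmul0l.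
rewrite !big_cons IH cmulDl; congr (_ + _); rewrite big_map /alg_sum.
elim: l2 {IH} => [|q l2 IH]; first by rewrite !big_nil cmul0r.
rewrite !big_cons IH cmulDr; congr (_ + _).
by rewrite /= cmulZl cmulZr scalerA uM.
Qed.

Lemma alg_sum_adj l : alg_sum (adj_sum l) = star (alg_sum l).
Proof.
rewrite /alg_sum big_map; elim: l => [|p l IH]; first by rewrite !big_nil star0.
by rewrite !big_cons IH starD starZ uV.
Qed.

Lemma rn_cmul (a b : A) : rn (cmul a b) <= rn a * rn b.
Proof. by rewrite -lecR rmorphM /= -!rnE norm_cmul_le. Qed.

(** The C*-identity and submultiplicativity give [|b|^2 <= |star b| |b|]; apply this to [a] and to
    [star a]. *)
Lemma rn_star (a : A) : rn (star a) = rn a.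
Proof.
have le_star (b : A) : rn b <= rn (star b).
  have [->|b0] := eqVneq b 0; first by rewrite rn0 rn_ge0.
  have rb : 0 < rn b by rewrite rn_gt0.
  rewrite -(ler_pM2r rb); apply: le_trans (rn_cmul _ _).
  rewrite -expr2 le_eqVlt; apply/orP; left; apply/eqP/(@complexI R).
  by rewrite rmorphXn /= -!rnE cstar_identity.
by apply/eqP; rewrite eq_le le_star -{2}(starK a) le_star.
Qed.

End algebra.
End group_algebra.

(** * Extending a norm-attaining representation to the C*-algebra *)

Section extension.
Variables (R : realType) (G : groupType) (A : cstarAlgType R) (u : G -> A).
Hypothesis uA : full_group_cstar u.
Variables (H : hilbertType R) (rho : unitary_rep G H).
Hypothesis rho_univ : forall l : seq (R[i] * G), universal_norm l = opnorm (urep_sum rho l).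

Let uM : forall g h, u (g * h)%g = cmul (u g) (u h). Proof. by case: uA. Qed.
Let uV : forall g, u (g^-1)%g = star (u g). Proof. by case: uA. Qed.

Local Notation iota l := (alg_sum u l).

Let rn_iota l : rn (iota l) = opnorm (urep_sum rho l).
Proof.
case: uA => _ _ hn _; apply: (@complexI R); rewrite -rnE -rho_univ.
exact: hn.
Qed.

Lemma alg_approx (a : A) (e : R) : 0 < e -> exists l, rn (a - iota l) < e.
Proof.
case: uA => _ _ _ /dense_rnP dA e0; have [_ [l _ <-] h] := dA a e e0.
by exists l.
Qed.

Lemma urep_sum_dist l l' v :
  rn (urep_sum rho l v - urep_sum rho l' v) <= rn (iota l - iota l') * rn v.
Proof.
have E : iota l - iota l' = iota (l ++ scale_sum (-1) l').
  by rewrite alg_sum_cat alg_sum_scale scaleN1r.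
have E' : urep_sum rho l v - urep_sum rho l' v = urep_sum rho (l ++ scale_sum (-1) l') v.
  by rewrite urep_sum_cat urep_sum_scale scaleN1r.
by rewrite E E' rn_iota; exact: urep_sum_opnorm.
Qed.

(** The value is the limit of [urep_sum rho (L n) v] along formal sums [L n] tending to [a]. The
    estimate against every [l] determines it and replaces the limit from here on. *)
Lemma ext_exists (a : A) (v : H) :
  exists h : H, forall l, rn (h - urep_sum rho l v) <= rn (a - iota l) * rn v.
Proof.
have v1 : 0 < rn v + 1 by rewrite ltr_wpDl// rn_ge0.
have [L hL] := choice (fun n : nat => alg_approx a (divr_gt0 (ltr01 : 0 < 1 :> R) (ltr0Sn R n))).
have LL m n l : (n <= m)%N -> rn (iota (L m) - iota l) <= n.+1%:R^-1 + rn (a - iota l).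
  move=> nm; apply: le_trans (rn_triangle a _ _) _; rewrite lerD2r rnBC.
  apply: le_trans (ltW (hL m)) _.
  by rewrite mul1r lef_pV2 ?posrE ?ltr0Sn// ler_nat ltnS.
have small (e : R) : 0 < e -> exists n : nat, n.+1%:R^-1 <= e.
  move=> e0; exists (Num.truncn e^-1).
  rewrite -[leRHS]invrK lef_pV2 ?posrE ?ltr0Sn ?invr_gt0//.
  by apply/ltW; rewrite truncnS_gt.
have [h hh] : exists h, forall e : R, 0 < e -> exists N, forall n, (N <= n)%N ->
    rn (urep_sum rho (L n) v - h) < e.
  apply: cauchy_rn => e e0.
  have [N hN] := small (e / 3 / (rn v + 1)) (divr_gt0 (divr_gt0 e0 (ltr0Sn _ _)) v1).
  exists N => m n Nm Nn; apply: le_lt_trans (urep_sum_dist _ _ _) _.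
  have h1 := LL m N (L n) Nm.
  have h2 : rn (a - iota (L n)) <= N.+1%:R^-1.
    apply: le_trans (ltW (hL n)) _.
    by rewrite mul1r lef_pV2 ?posrE ?ltr0Sn// ler_nat ltnS.
  have h3 : rn (iota (L m) - iota (L n)) <= 2 * (e / 3 / (rn v + 1)).
    apply: (le_trans h1); rewrite mulr_natl mulr2n; apply: lerD => //.
    exact: le_trans h2 hN.
  apply: (@le_lt_trans _ _ (2 * (e / 3 / (rn v + 1)) * (rn v + 1))).
    by apply: ler_pM => //; rewrite ?rn_ge0// lerDl.
  rewrite -mulrA divfK ?lt0r_neq0//; move: e0; lra.
exists h => l; apply/ler_addgt0Pr => e e0.
have e2 : 0 < e / 2 by rewrite divr_gt0.
have [N hN] := hh _ e2.
have [N' hN'] := small _ (divr_gt0 e2 v1).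
pose n := maxn N N'.
have h1 := hN n (leq_maxl _ _).
have h2 := LL n N' l (leq_maxr _ _).
apply: le_trans (rn_triangle (urep_sum rho (L n) v) _ _) _; rewrite rnBC.
have h3 := urep_sum_dist (L n) l v.
have h4 : rn (iota (L n) - iota l) * rn v <= e / 2 + rn (a - iota l) * rn v.
  apply: le_trans (_ : _ <= (e / 2 / (rn v + 1) + rn (a - iota l)) * rn v) _.
    by rewrite ler_wpM2r ?rn_ge0// (le_trans h2)// lerD2r.
  rewrite mulrDl lerD2r -mulrA ler_piMr ?(ltW e2)//.
  by rewrite ler_pdivrMl// mulr1 lerDl.
lra.
Qed.

Definition ext (a : A) : H -> H := projT1 (choice (ext_exists a)).

Lemma extP a v l : rn (ext a v - urep_sum rho l v) <= rn (a - iota l) * rn v.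
Proof. by rewrite /ext; case: choice => f hf; exact: hf. Qed.

(** Reduces each identity for [ext] to formal sums, by approximating [a] and [h] through the same
    [l]. The restriction [e <= 1] keeps the approximants bounded, as the product rule requires. *)
Lemma ext_unique a v h (C : R) :
  (forall e : R, 0 < e -> e <= 1 -> exists2 l, rn (a - iota l) <= C * e &
    rn (h - urep_sum rho l v) <= C * e) -> ext a v = h.
Proof.
move=> hC; apply/eqP; rewrite -subr_eq0; apply/eqP.
apply/rn0_eq0/eqP; rewrite eq_le rn_ge0 andbT; apply/ler_addgt0Pr => d d0; rewrite add0r.
pose B := `|C| * rn v + `|C| + 1.
have B0 : 0 < B by rewrite ltr_wpDl// addr_ge0// mulr_ge0// rn_ge0.
pose e := Num.min 1 (d / B).
have e0 : 0 < e by rewrite lt_min ltr01 divr_gt0.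
have e1 : e <= 1 by rewrite ge_min lexx.
have eB : e * B <= d by rewrite -ler_pdivlMr// ge_min lexx orbT.
have [l h1 h2] := hC e e0 e1.
apply: le_trans (rn_triangle (urep_sum rho l v) _ _) _; rewrite [X in _ + X]rnBC.
have h3 := extP a v l.
have Ce : C * e <= `|C| * e by rewrite ler_wpM2r ?(ltW e0)// ler_norm.
have h4 : rn (a - iota l) * rn v <= `|C| * e * rn v.
  by rewrite ler_wpM2r ?rn_ge0// (le_trans h1).
apply: le_trans eB; rewrite /B; lra.
Qed.

Lemma ext_bound a v : rn (ext a v) <= rn a * rn v.
Proof.
have := extP a v [::]; rewrite /urep_sum /alg_sum !big_nil !subr0.
exact.
Qed.

Lemma ext_linear a : linear (ext a).
Proof.
move=> c v w; apply: (@ext_unique _ _ _ (1 + rn c * rn v + rn w)) => e e0 e1.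
have [l hl] := alg_approx a e0; exists l.
  apply: le_trans (ltW hl) _; rewrite ler_peMl ?(ltW e0)//.
  by rewrite -addrA lerDl addr_ge0 ?mulr_ge0 ?rn_ge0.
rewrite urep_sumD urep_sumZ opprD addrACA -scalerBr.
apply: le_trans (rnD _ _) _; rewrite rnZ.
have h1 := extP a v l; have h2 := extP a w l.
have k1 : rn (ext a v - urep_sum rho l v) <= e * rn v.
  by rewrite (le_trans h1)// ler_wpM2r ?rn_ge0 ?ltW.
have k2 : rn (ext a w - urep_sum rho l w) <= e * rn w.
  by rewrite (le_trans h2)// ler_wpM2r ?rn_ge0 ?ltW.
have k3 : rn c * rn (ext a v - urep_sum rho l v) <= rn c * (e * rn v).
  by rewrite ler_wpM2l ?rn_ge0.
lra.
Qed.

HB.instance Definition _ a := GRing.isLinear.Build R[i] H H *:%R (ext a) (ext_linear a).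

Definition ext_op a : bounded_op H := mk_bounded_op (ext_bound a).

Lemma ext_rep_linear (c : R[i]) a b v : ext (c *: a + b) v = c *: ext a v + ext b v.
Proof.
apply: (@ext_unique _ _ _ ((rn c + 1) * (rn v + 1))) => e e0 e1.
have [l hl] := alg_approx a e0; have [l' hl'] := alg_approx b e0.
exists (scale_sum c l ++ l').
  rewrite alg_sum_cat alg_sum_scale opprD addrACA -scalerBr.
  apply: le_trans (rnD _ _) _; rewrite rnZ.
  have k : rn c * rn (a - iota l) <= rn c * e by rewrite ler_wpM2l ?rn_ge0 ?ltW.
  have k2 : 0 <= (rn c + 1) * rn v * e by rewrite !mulr_ge0 ?addr_ge0 ?rn_ge0// ltW.
  move: hl' k k2; lra.
rewrite urep_sum_cat urep_sum_scale opprD addrACA -scalerBr.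
apply: le_trans (rnD _ _) _; rewrite rnZ.
have h1 := extP a v l; have h2 := extP b v l'.
have k1 : rn (ext a v - urep_sum rho l v) <= e * rn v.
  by rewrite (le_trans h1)// ler_wpM2r ?rn_ge0 ?ltW.
have k2 : rn (ext b v - urep_sum rho l' v) <= e * rn v.
  by rewrite (le_trans h2)// ler_wpM2r ?rn_ge0 ?ltW.
have k3 : rn c * rn (ext a v - urep_sum rho l v) <= rn c * (e * rn v).
  by rewrite ler_wpM2l ?rn_ge0.
have k4 : 0 <= (rn c + 1) * e by rewrite mulr_ge0 ?addr_ge0 ?rn_ge0// ltW.
lra.
Qed.

Lemma ext_rep_mul a b v : ext (cmul a b) v = ext a (ext b v).
Proof.
apply: (@ext_unique _ _ _ (rn b + (rn a + 1) + rn (ext b v) + (rn a + 1) * rn v)) => e e0 e1.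
have [l hl] := alg_approx a e0; have [l' hl'] := alg_approx b e0.
have il : rn (iota l) <= rn a + 1.
  have := rn_dist (iota l) a; rewrite ler_norml => /andP[_]; rewrite rnBC; lra.
have p1 : 0 <= (rn a + 1) * rn v * e by rewrite !mulr_ge0 ?addr_ge0 ?rn_ge0// ltW.
have p2 : 0 <= rn (ext b v) * e by rewrite mulr_ge0 ?rn_ge0// ltW.
have p3 : 0 <= (rn b + (rn a + 1)) * e by rewrite mulr_ge0 ?addr_ge0 ?rn_ge0// ltW.
exists (mul_sum l l').
  rewrite (alg_sum_mul uM).
  have -> : cmul a b - cmul (iota l) (iota l') =
      cmul (a - iota l) b + cmul (iota l) (b - iota l').
    by rewrite cmulBl cmulBr addrA subrK.
  apply: le_trans (rnD _ _) _.
  have q1 : rn (cmul (a - iota l) b) <= e * rn b.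
    by apply: le_trans (rn_cmul _ _) _; rewrite ler_wpM2r ?rn_ge0 ?ltW.
  have q2 : rn (cmul (iota l) (b - iota l')) <= (rn a + 1) * e.
    by apply: le_trans (rn_cmul _ _) _; apply: ler_pM (rn_ge0 _) (rn_ge0 _) il (ltW hl').
  lra.
rewrite urep_sum_mul; apply: le_trans (rn_triangle (urep_sum rho l (ext b v)) _ _) _.
have q1 : rn (ext a (ext b v) - urep_sum rho l (ext b v)) <= e * rn (ext b v).
  by apply: le_trans (extP _ _ _) _; rewrite ler_wpM2r ?rn_ge0 ?ltW.
have q2 : rn (urep_sum rho l (ext b v) - urep_sum rho l (urep_sum rho l' v)) <=
    (rn a + 1) * (e * rn v).
  have -> : urep_sum rho l (ext b v) - urep_sum rho l (urep_sum rho l' v) =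
      urep_sum rho l (ext b v - urep_sum rho l' v).
    by rewrite urep_sumB.
  apply: le_trans (urep_sum_opnorm _ _ _) _; rewrite -rn_iota.
  apply: ler_pM; rewrite ?rn_ge0//.
  by apply: le_trans (extP _ _ _) _; rewrite ler_wpM2r ?rn_ge0 ?ltW.
lra.
Qed.

Lemma ext_rep_star a v w : hdot (ext (star a) v) w = hdot v (ext a w).
Proof.
apply/eqP; rewrite -subr_eq0; apply/eqP.
apply: (@rn_small_eq0 _ _ _ (2 * rn v * rn w)) => e e0.
have [l hl] := alg_approx a e0.
have -> : hdot (ext (star a) v) w - hdot v (ext a w) =
    hdot (ext (star a) v - urep_sum rho (adj_sum l) v) w - hdot v (ext a w - urep_sum rho l w).
  by rewrite hdotBl hdotBr urep_sum_adj; ring.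
apply: le_trans (rnB _ _) _.
have h1 : rn (hdot (ext (star a) v - urep_sum rho (adj_sum l) v) w) <= e * rn v * rn w.
  apply: le_trans (hdot_CS _ _) _; rewrite ler_wpM2r ?rn_ge0//.
  apply: le_trans (extP _ _ _) _; rewrite ler_wpM2r ?rn_ge0//.
  have -> : star a - iota (adj_sum l) = star (a - iota l).
    by rewrite (alg_sum_adj uV) starB.
  by rewrite rn_star ltW.
have h2 : rn (hdot v (ext a w - urep_sum rho l w)) <= rn v * (e * rn w).
  apply: le_trans (hdot_CS _ _) _; rewrite ler_wpM2l ?rn_ge0//.
  by apply: le_trans (extP _ _ _) _; rewrite ler_wpM2r ?rn_ge0 ?ltW.
lra.
Qed.

Definition ext_rep : cstar_rep A H :=
  CStarRep (rep_fun := ext_op) ext_rep_linear ext_rep_mul ext_rep_star.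

(** [rho] attains the universal norm: if [a] acts by zero, a formal sum near [a] has small operator
    norm, hence small norm in [A]. *)
Lemma ext_rep_faithful : faithful ext_rep.
Proof.
move=> a a0; apply: (@rn_small_eq0 _ _ _ 2) => e e0.
have [l hl] := alg_approx a e0.
have il : rn (iota l) <= rn (a - iota l).
  rewrite rn_iota; apply: opnorm_le; first exact: rn_ge0.
  move=> v; have := extP a v l; have -> : ext a v = 0 by exact: a0.
  by rewrite sub0r rnN.
have := rnD (a - iota l) (iota l); rewrite subrK; lra.
Qed.

Lemma ext_opnorm_dist a b : opnorm (fun v => ext_rep a v - ext_rep b v) <= rn (a - b).
Proof.
apply: opnorm_le; first exact: rn_ge0.
move=> v; rewrite [X in rn X](_ : _ = ext (a - b) v); first exact: ext_bound.
by rewrite [a - b]addrC -(scaleN1r b) ext_rep_linear scaleN1r addrC.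
Qed.

End extension.

Lemma sum_quarters_le (R : realType) (b e x y z w : R) :
  x <= e / 4 * b -> y <= e / 4 * b -> z <= e / 4 * b -> w <= z + y -> 0 <= e * b ->
  x + w <= e * b.
Proof. lra. Qed.

(** * The increasing projections and quasidiagonality *)

Section quasidiagonality.
Variables (R : realType) (G : groupType) (s : G -> int -> int).
Hypotheses (s1 : s 1%g =1 id) (sM : forall (g h : G) x, s (g * h)%g x = s g (s h x))
  (s_faithful : forall g, s g =1 id -> g = 1%g)
  (s_bd : forall g, exists C : nat, forall x, (absz (s g x - x) <= C)%N)
  (s_rec : forall (F : seq G) (N : nat) (j0 : int), exists L : nat, forall b : int,
     exists2 c : int, b <= c <= b + L%:Z &
       forall g i, g \in F -> (absz i <= N)%N -> s g (c + i) - (c + i) = s g (j0 + i) - (j0 + i)).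
Variables (T : countType) (code : G -> T).
Hypothesis code_inj : injective code.
Variables (A : cstarAlgType R) (u : G -> A).
Hypothesis uA : full_group_cstar u.

Let decode (t : T) : G := xget 1%g [set g | code g = t].

Let codeK g : decode (code g) = g.
Proof.
apply: code_inj.
have : [set h | code h = code g] (decode (code g)) by apply: xgetPex; exists g.
by [].
Qed.

Lemma group_cstar_separable : separable A.
Proof.
apply: (@dense_span_separable R A T (u \o decode)).
case: uA => _ _ _ /dense_rnP dA; apply/dense_rnP => a e e0.
have [_ [l _ <-] h] := dA a e e0.
exists (\sum_(p <- l) p.1 *: u p.2) => //.
exists [seq (p.1, code p.2) | p <- l] => //.
by rewrite big_map; apply: eq_bigr => p _ /=; rewrite codeK.
Qed.

Let Fn (n : nat) : seq G := [seq decode t | t <- pmap choice.unpickle (iota 0 n)].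

Let FnP g n : (choice.pickle (code g) < n)%N -> g \in Fn n.
Proof.
move=> gn; apply/mapP; exists (code g); last by rewrite codeK.
rewrite mem_pmap; apply/mapP; exists (choice.pickle (code g)); last by rewrite choice.pickleK.
by rewrite mem_iota.
Qed.

Let s_inj g : injective (s g).
Proof. by apply: (can_inj (g := s g^-1%g)) => x; rewrite -sM mulVg s1. Qed.

Let stage : Type := (nat * seq (seq int) * (seq int -> seq int -> R))%type.

Let stage_spec (p : nat * nat) (x : stage) : Prop :=
  let: (n, N) := p in let: (M, W, q) := x in
  [/\ uniq W, forall x y, q x y = q y x,
      forall x y, x \notin W -> q x y = 0,
      forall x z, \sum_(y <- W) q x y * q y z = q x z &
   [/\ forall x y, (size x <= n)%N -> (forall a, a \in x -> absz a <= N)%N ->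
          q x y = (y == x)%:R,
      forall x, x \in W -> (size x <= n)%N /\ (forall a, a \in x -> absz a <= M)%N &
      forall g U x, g \in Fn n -> uniq U ->
        \sum_(y <- U) `|q (map (s g) x) (map (s g) y) - q x y| <= n.+1%:R^-1]].

Let stage_exists p : exists x, stage_spec p x.
Proof.
case: p => n N; have n0 : 0 < n.+1%:R^-1 :> R by rewrite invr_gt0.
have [M [W [q h]]] := berg_approx s_inj s_bd s_rec (Fn n) N n n0.
by exists (M, W, q).
Qed.

Let pick_stage := projT1 (choice stage_exists).
Let pick_stageP p : stage_spec p (pick_stage p) := projT2 (choice stage_exists) p.

(** The radius on which stage [n] is the identity. It is at least the reach [M] of the previous
    stage, so the projections increase, and at least [n], so they tend strongly to the identity. *)
Let core := fix core n := if n is n'.+1 then maxn (pick_stage (n', core n')).1.1 n else 0%N.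
Let W n := (pick_stage (n, core n)).1.2.
Let q n := (pick_stage (n, core n)).2.

Let stageP n :
  [/\ uniq (W n), forall x y, q n x y = q n y x,
      forall x y, x \notin W n -> q n x y = 0,
      forall x z, \sum_(y <- W n) q n x y * q n y z = q n x z &
   [/\ forall x y, (size x <= n)%N -> (forall a, a \in x -> absz a <= core n)%N ->
          q n x y = (y == x)%:R,
      forall x, x \in W n -> (size x <= n)%N /\ (forall a, a \in x -> absz a <= core n.+1)%N &
      forall g U x, g \in Fn n -> uniq U ->
        \sum_(y <- U) `|q n (map (s g) x) (map (s g) y) - q n x y| <= n.+1%:R^-1]].
Proof.
have := pick_stageP (n, core n); rewrite /W /q [core n.+1]/=.
case: (pick_stage (n, core n)) => [[M W'] q'] /= [h1 h2 h3 h4 [h5 h6 h7]].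
split => //; split => // x xW; have [h8 h9] := h6 x xW.
by split => // a /h9 h10; rewrite leq_max h10.
Qed.

Let core_ge n : (n <= core n)%N.
Proof. by case: n => //= n; rewrite leq_maxr. Qed.

Local Notation H := (l2 R (seq int)).

Let uW n : uniq (W n). Proof. by have [] := stageP n. Qed.
Let qC n x y : q n x y = q n y x. Proof. by have [] := stageP n. Qed.
Let q0 n x y : x \notin W n -> q n x y = 0. Proof. by have [_ _ h] := stageP n => *; exact: h. Qed.
Let qq n x z : x \in W n -> z \in W n -> \sum_(y <- W n) q n x y * q n y z = q n x z.
Proof. by have [_ _ _ h _] := stageP n => *; exact: h. Qed.
Let qcore n x y : (size x <= n)%N -> (forall a, a \in x -> absz a <= core n)%N ->
  q n x y = (y == x)%:R.
Proof. by have [_ _ _ _ [h _ _]] := stageP n; exact: h. Qed.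

Let P n : bounded_op H := kbop (uW n) (@qC n) (@qq n).

Let P_contract n (f : H) : rn (P n f) <= rn f.
Proof. exact: (kop_contract (uW n) (@qC n) (@qq n)). Qed.

Let coreW n x : (size x <= n)%N -> (forall a, a \in x -> absz a <= core n)%N -> x \in W n.
Proof.
move=> xn xc; apply/negPn/negP => /(@q0 n x x); rewrite qcore// eqxx.
by move/eqP; rewrite oner_eq0.
Qed.

Let P_core n (f : H) x : (size x <= n)%N -> (forall a, a \in x -> absz a <= core n)%N ->
  val (P n f) x = val f x.
Proof.
move=> xn xc; have xW := coreW xn xc.
transitivity (\sum_(y <- W n) (q n x y)%:C%C * val f y); first by rewrite kopE xW.
rewrite (bigD1_seq x)//= qcore// eqxx mul1r big1 ?addr0// => y /negPf yx.
by rewrite qcore// yx mul0r.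
Qed.

(** [P n] reads only the coordinates in [W n], which lie in the core of the next stage, where
    [P n.+1] changes nothing. *)
Let PP n : P n \o P n.+1 =1 P n.
Proof.
move=> f; apply: l2_ext => x.
change (val (kop (W n) (q n) (P n.+1 f)) x = val (kop (W n) (q n) f) x).
rewrite !kopE; case: ifP => // _; rewrite big_seq [RHS]big_seq; apply: eq_bigr => y yW.
have [_ _ _ _ [_ h _]] := stageP n; have [h1 h2] := h y yW.
by rewrite P_core//; exact: leqW.
Qed.

Let P_cvg (f : H) : P n f @[n --> \oo] --> f.
Proof.
apply/cvg_rnP => e e0; have e2 : 0 < e / 2 by rewrite divr_gt0.
have [r ur hr] := l2_approx f e2; set f0 := fsupp r (val f) in hr.
pose K := \max_(x <- r) maxn (size x) (\max_(a <- x) absz a).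
exists K => // n /= Kn.
have rcore x : x \in r -> (size x <= n)%N /\ (forall a, a \in x -> absz a <= core n)%N.
  move=> xr; have h : (maxn (size x) (\max_(a <- x) absz a) <= n)%N.
    by apply: leq_trans Kn; exact: (leq_bigmax_seq (F := fun x => maxn (size x) (\max_(a <- x) absz a))).
  move: h; rewrite geq_max => /andP[h1 h2]; split => // a ax.
  apply: leq_trans (core_ge n); apply: leq_trans h2.
  exact: (leq_bigmax_seq (F := absz)).
have Pf0 : P n f0 = f0.
  apply: l2_ext => x; have [xr|xr] := boolP (x \in r).
    by have [h1 h2] := rcore x xr; rewrite P_core.
  rewrite [RHS]fsupp0//.
  change (val (kop (W n) (q n) f0) x = 0); rewrite kopE; case: ifP => // _.
  rewrite big1// => y _; have [yr|yr] := boolP (y \in r); last by rewrite fsupp0// mulr0.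
  have [h1 h2] := rcore y yr; rewrite qC qcore//.
  case: eqP => [xy|_]; last by rewrite mul0r.
  by rewrite xy yr in xr.
have -> : P n f - f = P n (f - f0) - (f - f0).
  by rewrite [in RHS]linearB /= Pf0 opprB addrA subrK.
apply: le_lt_trans (rnB _ _) _; rewrite [e]splitr.
apply: le_lt_trans (_ : _ <= rn (f - f0) + rn (f - f0)) _; last exact: ltrD.
by rewrite lerD2r P_contract.
Qed.

Let rho := seq_rep R s1 sM.
Let rho_univ (l : seq (R[i] * G)) : universal_norm l = opnorm (urep_sum rho l) :=
  universal_norm_seq_rep s1 sM s_faithful s_bd s_rec l.

Let P_comm g n (f : H) : (choice.pickle (code g) < n)%N ->
  rn (P n (rho g f) - rho g (P n f)) <= n.+1%:R^-1 * rn f.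
Proof.
move=> gn; have [_ _ _ _ [_ _ h]] := stageP n.
apply: (kop_comm (uW n) (@qC n) (lact_seq1 s1) (lact_seqM sM) (@q0 n)).
  by rewrite invr_ge0.
by move=> U x uU; apply: h => //; exact: FnP.
Qed.

Let P_comm_sum (l : seq (R[i] * G)) n (f : H) :
  (forall p, p \in l -> choice.pickle (code p.2) < n)%N ->
  rn (P n (urep_sum rho l f) - urep_sum rho l (P n f)) <=
    (\sum_(p <- l) rn p.1) * n.+1%:R^-1 * rn f.
Proof.
move=> ln.
have -> : P n (urep_sum rho l f) - urep_sum rho l (P n f) =
    \sum_(p <- l) p.1 *: (P n (rho p.2 f) - rho p.2 (P n f)).
  rewrite /urep_sum [P n _]linear_sum /= -sumrB; apply: eq_bigr => p _.
  by rewrite scalerBr; congr (_ - _); exact: linearZ.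
apply: le_trans (rn_sum _ _ _) _; rewrite -mulrA mulr_suml.
rewrite big_seq [leRHS]big_seq; apply: ler_sum => p pl.
by rewrite rnZ ler_wpM2l ?rn_ge0//; apply: P_comm; exact: ln.
Qed.

Lemma group_cstar_quasidiagonal : quasidiagonal A.
Proof.
split; first exact: group_cstar_separable.
exists H, (ext_rep uA rho_univ); split; first exact: ext_rep_faithful.
split; first exact: l2_separable.
  have [D [cD /dense_rnP dD]] := group_cstar_separable.
  exists (ext_rep uA rho_univ @` D); split.
  - exact: sub_countable (card_image_le _ _) cD.
  - by move=> _ [a _ <-]; exists a.
  - move=> _ [a _ <-] e e0; have [d Dd ad] := dD a e e0.
    exists (ext_rep uA rho_univ d); first by exists d.
    exact: le_lt_trans (ext_opnorm_dist _ _ _ _) ad.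
exists P; split.
- move=> n; split.
  + exact: (kop_compact (uW n) (@qC n) (@qq n)).
  + exact: (kop_self_adjoint (uW n) (@qC n)).
  + exact: (kop_idem (@qq n)).
- move=> n; apply: proj_op_le.
  + exact: (kop_self_adjoint (uW n) (@qC n)).
  + exact: (kop_idem (@qq n)).
  + exact: (kop_self_adjoint (uW n.+1) (@qC n.+1)).
  + exact: (kop_idem (@qq n.+1)).
  + exact: PP.
- exact: P_cvg.
move=> _ [a _ <-]; apply/cvgrPdist_le => e e0.
(* Three errors of at most [e / 4] arise: replacing [a] by a formal sum [l] on [v] and on [P n v],
   and commuting [P n] with [l]. *)
have e4 : 0 < e / 4 by rewrite divr_gt0.
have [l hl] := alg_approx uA a e4.
pose B := \sum_(p <- l) rn p.1.
have B0 : 0 <= B by rewrite sumr_ge0// => p _; exact: rn_ge0.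
(* From [K] on, every group element of [l] belongs to [Fn n] and [B / (n + 1) <= e / 4]. *)
pose K := (\max_(p <- l) (choice.pickle (code p.2)).+1 + Num.truncn (B / (e / 4)))%N.
exists K => // n /= Kn.
have ln p : p \in l -> (choice.pickle (code p.2) < n)%N.
  move=> pl; apply: leq_trans (leq_trans (leq_addr _ _) Kn).
  exact: (leq_bigmax_seq (F := fun p : R[i] * G => (choice.pickle (code p.2)).+1)).
have Bn : B * n.+1%:R^-1 <= e / 4.
  rewrite ler_pdivrMr ?ltr0Sn// mulrC -ler_pdivrMr//.
  apply/ltW; apply: lt_le_trans (truncnS_gt _) _.
  by rewrite ler_nat ltnS; apply: leq_trans (leq_addl _ _) Kn.
set op := opnorm _.
have bound v : rn (P n (ext_rep uA rho_univ a v) - ext_rep uA rho_univ a (P n v)) <= e * rn v.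
  have h1 := extP uA rho_univ a v l.
  have h2 := extP uA rho_univ a (P n v) l.
  have h3 := @P_comm_sum l n v ln.
  set av := ext_rep uA rho_univ a v; set aPv := ext_rep uA rho_univ a (P n v).
  have k1 : rn (P n av - P n (urep_sum rho l v)) <= e / 4 * rn v.
    rewrite -linearB; apply: le_trans (P_contract _ _) _.
    by apply: le_trans h1 _; rewrite ler_wpM2r ?rn_ge0 ?ltW.
  have k2 : rn (aPv - urep_sum rho l (P n v)) <= e / 4 * rn v.
    apply: le_trans h2 _; apply: ler_pM; rewrite ?rn_ge0 ?P_contract//.
    exact: ltW.
  have k3 : rn (P n (urep_sum rho l v) - urep_sum rho l (P n v)) <= e / 4 * rn v.
    by apply: le_trans h3 _; rewrite ler_wpM2r ?rn_ge0.
  apply: le_trans (rn_triangle (P n (urep_sum rho l v)) _ _) _.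
  have := rn_triangle (urep_sum rho l (P n v)) (P n (urep_sum rho l v)) aPv.
  rewrite [X in _ <= _ + X]rnBC => k4.
  have ev : 0 <= e * rn v by rewrite mulr_ge0 ?rn_ge0// ltW.
  exact: sum_quarters_le k1 k2 k3 k4 ev.
have op0 : 0 <= op := opnorm_ge0 bound.
rewrite sub0r normrN ger0_norm//.
exact: opnorm_le (ltW e0) bound.
Qed.

End quasidiagonality.

(** * Minimal homeomorphisms of the Cantor space *)

Section cylinders.
Local Notation X := cantor_space.

Definition cyl (x : X) (n : nat) : set X := [set y | forall i, (i < n)%N -> y i = x i].

Lemma cyl_nbhs (x : X) (A : set X) : nbhs x A -> exists n, cyl x n `<=` A.
Proof.
pose F : set_system X := [set B | exists n, cyl x n `<=` B].
have FF : Filter F.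
  split; first by exists 0%N.
    move=> B B' [n nB] [m mB]; exists (maxn n m) => y yx; split.
      by apply: nB => i ni; apply: yx; rewrite leq_max ni.
    by apply: mB => i mi; apply: yx; rewrite leq_max mi orbT.
  by move=> B B' BB' [n nB]; exists n; exact: subset_trans BB'.
(* The product topology is the supremum of the coordinate topologies, so only sets depending on one
   coordinate [k] have to be tested. *)
have Fx : F --> x.
  apply/cvg_sup => k U [V] [[W] oW <-] WfN WU.
  exists k.+1 => y yx; apply: WU; rewrite /= yx//.
exact: Fx.
Qed.

Lemma cyl_open (x : X) n : open (cyl x n).
Proof.
rewrite openE => y yx; rewrite /interior.
have near_coord : forall m, nbhs y [set z : X | forall i, (i < m)%N -> z i = y i].
  elim=> [|m IH]; first by apply: filterS filterT => z _ i.
  have hm : nbhs y [set z : X | z m = y m].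
    exact: (@proj_continuous _ (fun=> bool) m y [set b | b = y m]).
  apply: filterS2 IH hm => z h1 h2 i; rewrite ltnS leq_eqVlt => /orP[/eqP ->|] //.
  exact: h1.
by apply: filterS (near_coord n) => z zy i ni; rewrite zy// yx.
Qed.

(** Cylinders indexed by finite words, a countable type, for the coding of group elements. *)
Definition scyl (b : seq bool) : set X := [set y | forall i, (i < size b)%N -> y i = nth false b i].

Lemma scyl_cyl (b : seq bool) : scyl b = cyl (fun i => nth false b i) (size b).
Proof. by []. Qed.

Lemma cyl_scyl (x : X) n : cyl x n = scyl (mkseq x n).
Proof.
apply/seteqP; split => y h i; rewrite ?size_mkseq => ni.
  by rewrite nth_mkseq// h.
by have := h i; rewrite size_mkseq nth_mkseq//; exact.
Qed.

Lemma cantor_finite_closed (A : set X) : finite_set A -> closed A.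
Proof.
by move: A; apply/accessible_finite_set_closed/hausdorff_accessible/cantor_space_hausdorff.
Qed.

Lemma cantor_infinite : infinite_set [set: X].
Proof.
move=> fX; pose x : X := fun=> false.
have /(_ x) := iffLR perfectTP cantor_perfect; apply.
rewrite -closedC; apply: cantor_finite_closed.
exact: sub_finite_set fX.
Qed.

Lemma cantor_finite_cover (I : choiceType) (f : I -> set X) :
  (forall i, open (f i)) -> (forall x, exists i, f i x) ->
  exists D : {fset I}, forall x, exists2 i, i \in D & f i x.
Proof.
move=> fo fx; have := cantor_space_compact; rewrite compact_cover => cX.
have [|x _|D _ hD] := cX I setT f.
- by move=> i _; exact: fo.
- by have [i fi] := fx x; exists i.
by exists D => x; have [i iD fi] := hD x Logic.I; exists i.
Qed.

End cylinders.

Section minimal_system.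
Local Notation X := cantor_space.
Variable T : homeo X.
Hypothesis minT : minimal_homeo T.

Lemma zexpg_add m n (x : X) : zexpg T (m + n) x = zexpg T m (zexpg T n x).
Proof. by rewrite zexpgD. Qed.

Lemma zexpg_inj n : injective (zexpg T n).
Proof. exact: can_inj (@homeoK _ (zexpg T n)). Qed.

(* A periodic orbit would be finite and dense, hence all of the Cantor space. *)
Lemma minimal_aperiodic (x : X) (n : int) : zexpg T n x = x -> n = 0.
Proof.
move=> nx; apply: contrapT => n0.
have mul_n (k : int) : zexpg T (k * n) x = x.
  have nat_n (m : nat) : zexpg T (m%:Z * n) x = x.
    elim: m => [|m IH]; first by rewrite mul0r.
    by rewrite -addn1 PoszD mulrDl mul1r zexpg_add nx.
  case: (intP k) => [|m|m]; first by rewrite mul0r.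
    exact: nat_n.
  by apply: (@zexpg_inj (m.+1%:Z * n)); rewrite -zexpg_add mulNr subrr nat_n.
pose O := [set y | exists k : int, y = zexpg T k x].
have Ofin : finite_set O.
  apply: (@sub_finite_set _ _ ((fun i : nat => zexpg T i%:Z x) @` `I_(absz n))); last first.
    exact/finite_image/finite_II.
  move=> _ [k ->]; have kn := modz_ge0 k (introN eqP n0).
  exists (absz (k %% n)%Z).
    rewrite /= -ltz_nat gez0_abs//.
    by apply: lt_le_trans (ltz_mod k (introN eqP n0)) _; rewrite abszE.
  have kE : k = (k %% n)%Z + (k %/ n)%Z * n by rewrite addrC -divz_eq.
  by rewrite gez0_abs// [in RHS]kE (zexpg_add (k %% n)%Z ((k %/ n)%Z * n)) mul_n.
have Ocl := cantor_finite_closed Ofin.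
apply: cantor_infinite; apply: sub_finite_set Ofin => y _.
apply: contrapT => Oy.
have [|z [Oz zO]] := minT x (O := ~` O) (ex_intro _ y Oy); first by rewrite openC.
exact: Oz.
Qed.

Lemma zexpg_eq (x : X) m n : zexpg T m x = zexpg T n x -> m = n.
Proof.
move=> e; apply/eqP; rewrite -subr_eq0; apply/eqP/(@minimal_aperiodic x).
apply: (@zexpg_inj n); rewrite -zexpg_add.
by rewrite addrC subrK.
Qed.

(** By minimality the preimages of [U] under the powers of [T] cover the space; compactness leaves
    finitely many powers. *)
Lemma minimal_return (U : set X) : open U -> U !=set0 ->
  exists L : nat, forall x, exists2 n : int, (absz n <= L)%N & U (zexpg T n x).
Proof.
move=> Uo U0.
have [||D hD] := @cantor_finite_cover _ (fun n : int => zexpg T n @^-1` U).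
- move=> n; apply: open_comp => // x _; exact: homeo_continuous.
- by move=> x; have [y [Uy [n yn]]] := minT x U0 Uo; exists n; rewrite /preimage /= -yn.
exists (\max_(n <- enum_fset D) absz n) => x.
have [n nD Un] := hD x; exists n => //.
exact: (leq_bigmax_seq (F := absz)).
Qed.

(** * The action on an orbit *)

Section orbit_action.
Variables (G : groupType) (phi : G -> homeo X).
Hypotheses (phi1 : phi 1%g = 1%g) (phiM : forall g h, phi (g * h)%g = (phi g * phi h)%g)
  (phi_inj : injective phi)
  (phi_full : forall g (x : X), exists n : int, \forall y \near x, phi g y = zexpg T n y).
Variable x0 : X.

(** The default 0 never occurs, since [g] is a power of [T] near the point; aperiodicity makes the
    exponent unique. *)
Definition orbit_act (g : G) (j : int) : int :=
  xget 0 [set k | phi g (zexpg T j x0) = zexpg T k x0].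

Lemma orbit_actP g j : phi g (zexpg T j x0) = zexpg T (orbit_act g j) x0.
Proof.
have [n /nbhs_singleton hn] := phi_full g (zexpg T j x0).
have : [set k | phi g (zexpg T j x0) = zexpg T k x0] (orbit_act g j).
  by apply: xgetPex; exists (n + j); rewrite /= zexpg_add -hn.
by [].
Qed.

Lemma orbit_act_eq g j k : phi g (zexpg T j x0) = zexpg T k x0 -> orbit_act g j = k.
Proof. by rewrite orbit_actP; exact: zexpg_eq. Qed.

Lemma orbit_act1 : orbit_act 1%g =1 id.
Proof. by move=> j; apply: orbit_act_eq; rewrite phi1. Qed.

Lemma orbit_actM (g h : G) j : orbit_act (g * h)%g j = orbit_act g (orbit_act h j).
Proof. by apply: orbit_act_eq; rewrite phiM -orbit_actP -orbit_actP. Qed.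

(** Near any [y], [g] is a single power [T^n]. The dense orbit meets that neighbourhood in a point
    fixed by [g], so [n = 0] by aperiodicity and [g] fixes [y]. *)
Lemma orbit_act_faithful g : orbit_act g =1 id -> g = 1%g.
Proof.
move=> gid; apply: phi_inj; rewrite phi1; apply: homeo_ext => y /=.
have [n hn] := phi_full g y.
have /(minT x0)/(_ (open_interior _)) [z [/interior_subset zn [k zk]]] :
    (interior [set y | phi g y = zexpg T n y]) !=set0 by exists y.
have n0 : n = 0.
  apply: (@minimal_aperiodic z); rewrite -zn zk orbit_actP gid//.
by rewrite (nbhs_singleton hn) n0.
Qed.

(** By compactness finitely many powers of [T] describe [g], and a displacement is one of their
    exponents. *)
Lemma orbit_act_bounded g : exists C : nat, forall j, (absz (orbit_act g j - j) <= C)%N.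
Proof.
have [||D hD] := @cantor_finite_cover _ (fun n : int => interior [set y | phi g y = zexpg T n y]).
- by move=> n; exact: open_interior.
- by move=> x; have [n hn] := phi_full g x; exists n.
exists (\max_(n <- enum_fset D) absz n) => j.
have [n nD /interior_subset hn] := hD (zexpg T j x0).
have -> : orbit_act g j - j = n.
  by rewrite (@orbit_act_eq g j (n + j)) ?addrK// zexpg_add.
exact: (leq_bigmax_seq (F := absz)).
Qed.

Lemma near_all_seq (I : eqType) (r : seq I) (y : X) (P : I -> X -> Prop) :
  (forall i, i \in r -> \forall z \near y, P i z) ->
  \forall z \near y, forall i, i \in r -> P i z.
Proof.
elim: r => [|i r IH] h; first by apply: filterS filterT => z _ i.
have h1 := h i (mem_head _ _).
have h2 : \forall z \near y, forall j, j \in r -> P j z.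
  by apply: IH => j jr; apply: h; rewrite inE jr orbT.
apply: filterS2 h1 h2 => z z1 z2 j; rewrite inE => /orP[/eqP ->//|].
exact: z2.
Qed.

Lemma orbit_act_recurrent (F : seq G) (N : nat) (j0 : int) :
  exists L : nat, forall b : int, exists2 c : int, b <= c <= b + L%:Z &
    forall g i, g \in F -> (absz i <= N)%N ->
      orbit_act g (c + i) - (c + i) = orbit_act g (j0 + i) - (j0 + i).
Proof.
pose d g i := orbit_act g (j0 + i) - (j0 + i).
pose I := irange (- N%:Z) (2 * N).+1.
pose U := interior [set y | forall g, g \in F -> forall i, i \in I ->
  phi g (zexpg T i y) = zexpg T (d g i) (zexpg T i y)].
(* The displacement at an orbit point is the exponent valid on a whole neighbourhood, so the finite
   pattern persists near [T^j0 x0]. *)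
have Ux : U (zexpg T j0 x0).
  apply: near_all_seq => g gF; apply: near_all_seq => i iI.
  have [n hn] := phi_full g (zexpg T i (zexpg T j0 x0)).
  have nE : n = d g i.
    rewrite /d (@orbit_act_eq g (j0 + i) (n + (j0 + i))) ?addrK//.
    have E : zexpg T (j0 + i) x0 = zexpg T i (zexpg T j0 x0) by rewrite addrC zexpg_add.
    by rewrite (zexpg_add n (j0 + i)) E; exact: nbhs_singleton hn.
  rewrite -nE; exact: (@homeo_continuous _ (zexpg T i) (zexpg T j0 x0) _ hn).
have [L hL] := minimal_return (open_interior _ : open U) (ex_intro _ _ Ux).
(* Return times have either sign; starting from [b + L] makes them land in [[b, b + 2 L]]. *)
exists (2 * L)%N => b.
have [n nL /interior_subset Un] := hL (zexpg T (b + L%:Z) x0).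
exists (n + (b + L%:Z)); first by lia.
move=> g i gF iN; have iI : i \in I by rewrite mem_irange; lia.
have := Un g gF i iI; set c := n + (b + L%:Z).
have -> : zexpg T i (zexpg T n (zexpg T (b + L%:Z) x0)) = zexpg T (c + i) x0.
  by rewrite [c + i]addrC (zexpg_add i c) (zexpg_add n).
by rewrite -zexpg_add => /orbit_act_eq ->; rewrite addrK.
Qed.

(** By compactness an element is determined by finitely many cylinders with a power of [T] attached
    to each. *)
Lemma full_group_countable : exists code : G -> {fset seq bool * int}, injective code.
Proof.
have cover_ex g : exists D : {fset seq bool * int},
    (forall p, p \in D -> forall y, scyl p.1 y -> phi g y = zexpg T p.2 y) /\
    (forall x, exists2 p, p \in D & scyl p.1 x).
  pose good := [set p : seq bool * int | forall y, scyl p.1 y -> phi g y = zexpg T p.2 y].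
  have := cantor_space_compact; rewrite compact_cover => cX.
  have [|x _|D Dg hD] := cX _ good (fun p => scyl p.1).
  - by move=> p _; rewrite scyl_cyl; exact: cyl_open.
  - have [n /cyl_nbhs[m hm]] := phi_full g x.
    exists (mkseq x m, n) => /=; last by rewrite -cyl_scyl.
    by move=> y; rewrite /= -cyl_scyl; exact: hm.
  exists D; split; first by move=> p /Dg; rewrite inE.
  by move=> x; have [p pD xp] := hD x Logic.I; exists p.
have [code hcode] := choice cover_ex.
exists code => g h gh; apply: phi_inj; apply: homeo_ext => y.
have [h1 h2] := hcode g; have [k1 _] := hcode h.
have [p pD yp] := h2 y; rewrite (h1 p pD)//.
by rewrite gh in pD; rewrite (k1 p pD).
Qed.

Lemma full_group_quasidiagonal (R : realType) (A : cstarAlgType R) (u : G -> A) :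
  full_group_cstar u -> quasidiagonal A.
Proof.
move=> uA; have [code code_inj] := full_group_countable.
exact: (group_cstar_quasidiagonal orbit_act1 orbit_actM orbit_act_faithful
  orbit_act_bounded orbit_act_recurrent code_inj uA).
Qed.

End orbit_action.
End minimal_system.

Theorem mainTheorem7 (R : realType) (T : homeo cantor_space) :
  minimal_homeo T ->
  (forall (A : cstarAlgType R) (u : full_group T -> A),
     full_group_cstar u -> quasidiagonal A) /\
  (infinite_group (commutator_subgroup (full_group T)) ->
   simple_group (commutator_subgroup (full_group T)) ->
   amenable R (commutator_subgroup (full_group T)) ->
   finitely_generated (commutator_subgroup (full_group T)) ->
   forall (A : cstarAlgType R) (u : commutator_subgroup (full_group T) -> A),
     full_group_cstar u -> quasidiagonal A).
Proof.
move=> minT.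
have full (S : full_group T) (x : cantor_space) : exists n : int, \forall y \near x, val S y = zexpg T n y.
  by have /asboolP h := valP S; exact: h.
pose x0 : cantor_space := fun=> false.
split=> [A u uA|_ _ _ _ A u uA].
  apply: (@full_group_quasidiagonal T minT _ (fun S => val S) _ _ val_inj full x0 R A u uA).
  - exact: val1.
  - exact: valM.
apply: (@full_group_quasidiagonal T minT _ (fun S => val (val S)) _ _ _ _ x0 R A u uA).
- by rewrite !val1.
- by move=> g h; rewrite !valM.
- by move=> g h /val_inj/val_inj.
- by move=> g x; exact: full.
Qed.
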